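(* In the one-sided Gaussian contamination model with $\sigma=1$, there exist universal positive constants $c_1,c_2,c_3,n_0$ such that the following holds for any $n\ge n_0$, any integer $k\in\big[e^{2a}\sqrt n,\ n-64\,n^{1-1/(4a)}\big)$, any $\mu\in\mathcal M_k$ and any $\theta\in\mathbb R$. Let $q_k=\lfloor \frac1a\log(\frac{k}{\sqrt n})\rfloor_{\mathrm{even}}\wedge q_{\max}$. The estimator $\widehat\theta_{q_k}$ satisfies $$\mathbb P_{\theta,\mu}\left(\widehat\theta_{q_k}\notin\left[\theta,\ \theta+c_1\frac{\log^{2}\big(1+\sqrt{\frac{k}{n-k}}\big)}{\log^{3/2}\big(\frac{k}{\sqrt n}\big)}\right]\right)\le c_3\left(\frac{\sqrt n}{k}\right)^{4/3}\log^{3}\Big(\frac{k}{\sqrt n}\Big)$$ and $$\mathbb E_{\theta,\mu}\big[|\widehat\theta_{q_k}-\theta|\big]\le c_2\,\frac{\log^{2}\big(1+\sqrt{\frac{k}{n-k}}\big)}{\log^{3/2}\big(\frac{k}{\sqrt n}\big)}.$$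
   Context: Model: $Y_i=\theta+\mu_i+\xi_i$, $1\le i\le n$, with $\xi_i$ i.i.d. $\mathcal N(0,1)$, $\theta\in\mathbb R$, $\mu\in\mathbb R_+^n$; $\mathbb P_{\theta,\mu},\mathbb E_{\theta,\mu}$ denote probability and expectation. $\mathcal M_k=\{\mu\in\mathbb R_+^n:\ \sum_i\mathbf 1\{\mu_i\ne0\}\le k\}$. $Y_{(j)}$ is the $j$-th smallest element among $Y_1,\dots,Y_n$. $\lfloor x\rfloor_{\mathrm{even}}$ is the largest even integer not larger than $x$; $x\wedge y=\min(x,y)$. Constants: $a=3[1+\log(3+2\sqrt2)]$ and $q_{\max}=\lfloor\frac{1}{2a}\log n\rfloor_{\mathrm{even}}-2$. Rough estimators: $\widehat\theta_{\mathrm{med}}=Y_{(\lceil n/2\rceil)}$; $\widehat\theta_{\mathrm{up}}=Y_{(1)}+2\sqrt{\log n}$; for a positive even integer $q$, $\widehat\theta_{\mathrm{low},q}=\widehat\theta_{\mathrm{med}}-\overline v$ with $\overline v=\pi^2/(144\,q_{\max}^{3/2})$ (here $\pi=3.14159\ldots$) if $q\le\frac{3}{10a}\log n$, and $\widehat\theta_{\mathrm{low},q}=-\infty$ otherwise. For an even integer $q\ge2$ and $0\le j\le q$ let $a_{j,q}=(-4)^j\frac{q\,(q+j-1)!}{(q-j)!\,(2j)!}$ (so that $\sum_{j=0}^q a_{j,q}e^{xj}=T_q(2e^x-1)$ with $T_q$ the Chebyshev polynomial of the first kind of degree $q$). For $\lambda\ge 0$ and $u\in\mathbb R$ let $\widehat\eta_\lambda(u)=\frac1n\sum_{i=1}^n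 e^{\lambda(u-Y_i)-\lambda^2/2}$ and $\widehat\psi_{q,\lambda}(u)=\sum_{j=0}^q a_{j,q}\,\widehat\eta_{j\lambda}(u)$. For even $2\le q\le q_{\max}$ put $\lambda_q=\sqrt{2/q}$ and $$\widehat\theta_q=\inf\Big\{u\in[\widehat\theta_{\mathrm{low},q},\widehat\theta_{\mathrm{up}}]:\ \widehat\psi_{q,\lambda_q}(u)>1+\frac{e^{aq}}{\sqrt n}\Big\},$$ with the convention $\inf\emptyset=\widehat\theta_{\mathrm{up}}$ (if $\widehat\theta_{\mathrm{low},q}=-\infty$ the interval is $(-\infty,\widehat\theta_{\mathrm{up}}]$). Universal constants do not depend on $n,k,\theta,\mu$. *)

(* Defs.v *)
From HB Require Import structures.
From mathcomp Require Import all_boot all_order all_algebra.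
From mathcomp Require Import all_classical all_reals all_analysis.

Set Implicit Arguments.
Unset Strict Implicit.
Unset Printing Implicit Defensive.

Import Order.TTheory GRing.Theory Num.Theory.
Import numFieldNormedType.Exports.

Local Open Scope classical_set_scope.
Local Open Scope ring_scope.

Definition mutually_independent {d : measure_display} {T : measurableType d}
    {R : realType} {P : probability T R} {I : finType}
    (X : I -> {RV P >-> R}) : Prop :=
  forall (J : {set I}) (B : I -> set R),
    (forall i, i \in J -> measurable (B i)) ->
    P (\bigcap_(i in [set` J]) (X i @^-1` B i)) =
    (\prod_(i in J) P (X i @^-1` B i))%E.

(* The laws are compared on Borel sets only: outside of them the values of
   [P] and [normal_prob] carry no meaning. [normal_prob m s] takes the
   standard deviation [s]. *)
Definition standard_normal {d : measure_display} {T : measurableType d}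
    {R : realType} {P : probability T R} (X : {RV P >-> R}) : Prop :=
  forall B : set R, measurable B -> distribution P X B = normal_prob 0 1 B.

Definition iid_standard_normal {d : measure_display} {T : measurableType d}
    {R : realType} {P : probability T R} {I : finType}
    (xi : I -> {RV P >-> R}) : Prop :=
  mutually_independent xi /\ forall i, standard_normal (xi i).

Definition sparse_nonneg {R : realType} {n : nat} (k : nat)
    (mu : 'I_n -> R) : Prop :=
  (forall i, 0 <= mu i) /\ (#|[pred i | mu i != 0%R]| <= k)%N.

Definition sample {T : Type} {R : realType} {n : nat} (theta : R)
    (mu : 'I_n -> R) (xi : 'I_n -> T -> R) (w : T) : 'I_n -> R :=
  fun i => theta + mu i + xi i w.

Definition aconst (R : realType) : R := 3 * (1 + ln (3 + 2 * Num.sqrt 2)).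

Definition floor_even {R : realType} (x : R) : int := 2 * Num.floor (x / 2).

Definition qmax (R : realType) (n : nat) : int :=
  floor_even (ln n%:R / (2 * aconst R)) - 2.

Definition qsel (R : realType) (n k : nat) : int :=
  Num.min (floor_even (ln (k%:R / Num.sqrt n%:R) / aconst R)) (qmax R n).

(* [order_stat y j] is the j-th smallest entry of [y], for 1 <= j <= n. *)
Definition order_stat {R : realType} {n : nat} (y : 'I_n -> R) (j : nat) : R :=
  nth 0 (sort <=%R (codom y)) j.-1.

(* [uphalf n] is the ceiling of n / 2. *)
Definition theta_med {R : realType} {n : nat} (y : 'I_n -> R) : R :=
  order_stat y (uphalf n).

Definition theta_up {R : realType} {n : nat} (y : 'I_n -> R) : R :=
  order_stat y 1 + 2 * Num.sqrt (ln n%:R).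

Definition vbar (R : realType) (n : nat) : R :=
  pi ^+ 2 / (144 * ((qmax R n)%:~R `^ (3 / 2))).

Definition theta_low {R : realType} {n : nat} (q : nat) (y : 'I_n -> R) :
    \bar R :=
  if q%:R <= 3 / (10 * aconst R) * ln n%:R
  then (theta_med y - vbar R n)%:E else -oo%E.

(* Coefficients of T_q (2 z - 1) in z, for q even, q >= 2, and j <= q. *)
Definition cheb_coef (R : realType) (q j : nat) : R :=
  (-4) ^+ j * (q%:R * ((q + j - 1)`!)%:R) / (((q - j)`!)%:R * ((2 * j)`!)%:R).

Definition eta_hat {R : realType} {n : nat} (lam : R) (y : 'I_n -> R) (u : R) :
    R :=
  n%:R^-1 * \sum_(i < n) expR (lam * (u - y i) - lam ^+ 2 / 2).

Definition psi_hat {R : realType} {n : nat} (q : nat) (lam : R)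
    (y : 'I_n -> R) (u : R) : R :=
  \sum_(j < q.+1) cheb_coef R q j * eta_hat (j%:R * lam) y u.

Definition lambdaq (R : realType) (q : nat) : R := Num.sqrt (2 / q%:R).

Definition crossing {R : realType} {n : nat} (q : nat) (y : 'I_n -> R) :
    set R :=
  [set u | [/\ (theta_low q y <= u%:E)%E, u <= theta_up y &
    1 + expR (aconst R * q%:R) / Num.sqrt n%:R < psi_hat q (lambdaq R q) y u]].

(* [inf] is the infimum in R. When [theta_low q y = -oo], [crossing q y] is
   still bounded below (for 1 <= n and 1 <= q), because
   psi_hat q (lambdaq R q) y u tends to cheb_coef R q 0 = 1 as u tends to
   -oo; hence the junk value that [inf] takes on sets without a lower bound
   is never used. *)
Definition theta_hat {R : realType} {n : nat} (q : nat) (y : 'I_n -> R) : R :=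
  if `[< crossing q y !=set0 >] then inf (crossing q y) else theta_up y.

Definition rate (R : realType) (n k : nat) : R :=
  ln (1 + Num.sqrt (k%:R / (n%:R - k%:R))) ^+ 2 /
  (ln (k%:R / Num.sqrt n%:R) `^ (3 / 2)).

(* Main.v *)
Require Import Defs.
From HB Require Import structures.
From mathcomp Require Import all_boot all_order all_algebra.
From mathcomp Require Import all_classical all_reals all_analysis.
From mathcomp Require Import measurable_realfun ring lra zify.

Set Implicit Arguments.
Unset Strict Implicit.
Unset Printing Implicit Defensive.

Import Order.TTheory GRing.Theory Num.Theory.
Import numFieldNormedType.Exports.

Local Open Scope classical_set_scope.
Local Open Scope ring_scope.

(* Writing Y_i = theta + mu_i + xi_i, the statistic psi_{q,lambda}(theta + z) equals
   the average of T_q(2 e^{lambda (z - mu_i)} - 1) plus a noise term that is at most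
   N = sum_j |a_{j,q}| |Z_j| (times e^{lambda z} or e^{q lambda z}).  As T_q is bounded
   by 1 on [-1,1], that average is <= 1 for z <= 0; as T_q grows fast beyond 1, it
   exceeds 1 + B, B = e^{aq}/sqrt n, once z is a little above the rate.  So the
   estimator leaves the interval only if N >= B/8 or if a rough estimator is wrong.
   By Cauchy-Schwarz and sum_j |a_{j,q}| = T_q(3), E N^2 <= e^{2aq/3}/n, hence
   P(N >= B/8) <= 64 e^{-4aq/3}, which is the stated probability.

   For the risk, e^{lambda (theta - u)} <= N/B at each crossing u <= theta, so the lower
   error is at most (N/B)^2 / (2 lambda).  That is too large when k is small; there the
   median brings u within 1/(q^2 lambda) of theta, and the quadratic decay of T_q to
   the left of 1 gives an error N^2 / (B q^2 lambda).  The upper error outside the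
   good event is controlled by the minimum of the sample.

   Every stochastic bound is a pointwise domination by nonnegative random variables
   of known mean; products of an unbounded variable with an indicator are split by
   x 1_A <= eps e^{2x} + 1_A / eps, which avoids Hoelder's inequality. *)

(** * Chebyshev polynomials *)

(** The constant [a] satisfies e^{aq/3} = (3 + 2 sqrt 2)^q e^q: the first factor bounds T_q(3), the
    second comes from the variances e^{(j lam)^2}/n, since lam^2 = 2/q. Thus B exceeds the size of N
    by e^{2aq/3}, and the degree is chosen with aq <= log(k / sqrt n) so that B <= k/n. Put l = log
    n and ell = log(k / sqrt n), so that k/n = e^{ell - l/2}; the rate is at least (k/n)/(4 l^2).
    The split at aq = 3l/10, built into [theta_low], balances the lower error. Above it, E (N/B)^2
    <= e^{-2l/5} while k/n >= e^{-l/5}, and the spare e^{-l/5} absorbs all powers of l. Below it, k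
    <= e^{2a} n^{4/5}: so few outliers move the median by a distance of order l^{-2} with
    probability at most n^{-3}. One random variable N controls every z at once, because z enters the
    noise only through deterministic factors; hence no union bound over z. *)

Fixpoint chebT {F : comPzRingType} (x : F) (p : nat) : F :=
  match p with
  | 0%N => 1
  | p'.+1 => match p' with
             | 0%N => x
             | p''.+1 => 2 * x * chebT x p' - chebT x p''
             end
  end.

Lemma chebTSS {F : comPzRingType} (x : F) p :
  chebT x p.+2 = 2 * x * chebT x p.+1 - chebT x p.
Proof. by []. Qed.

Lemma nat_ind2 (Q : nat -> Prop) :
  Q 0%N -> Q 1%N -> (forall p, Q p -> Q p.+1 -> Q p.+2) -> forall p, Q p.
Proof.
move=> Q0 Q1 QSS p; suff: Q p /\ Q p.+1 by case.
by elim: p => // p [Qp QSp]; split => //; exact: QSS.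
Qed.

Lemma chebTN {F : comPzRingType} (x : F) p :
  chebT (- x) p = (-1) ^+ p * chebT x p.
Proof.
elim/nat_ind2: p => [||p IH0 IH1]; rewrite ?mulN1r ?mul1r//.
by rewrite !chebTSS IH0 IH1 !exprS; ring.
Qed.

(** The recurrence preserves this quadratic form in two consecutive values, so its value at p = 0
    decides. It stands in for the substitution x = cos t. *)
Lemma chebT_invariant {F : comPzRingType} (x : F) p :
  chebT x p.+1 ^+ 2 - 2 * x * chebT x p.+1 * chebT x p + chebT x p ^+ 2 =
  1 - x ^+ 2.
Proof.
elim: p => [|p IH]; first by rewrite /=; ring.
by rewrite chebTSS -IH; ring.
Qed.

Lemma chebT1 {F : comPzRingType} p : chebT (1 : F) p = 1.
Proof. by elim/nat_ind2: p => // p IH0 IH1; rewrite chebTSS IH0 IH1; ring. Qed.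

(** Completing the square in the invariant gives (T_{p+1} - x T_p)^2 = (1 - x^2)(1 - T_p^2), a form
    of Pell's equation. The endpoints are separate because 1 - x^2 is cancelled. *)
Lemma chebT_le1 {F : realFieldType} (x : F) p : `|x| <= 1 -> `|chebT x p| <= 1.
Proof.
rewrite ler_norml => /andP[xl xu].
have [->|x1] := eqVneq x 1; first by rewrite chebT1 normr1.
have [->|xN1] := eqVneq x (-1).
  by rewrite chebTN chebT1 mulr1 normrX normrN1 expr1n.
have x2 : 0 < 1 - x ^+ 2.
  have -> : 1 - x ^+ 2 = (1 - x) * (x - -1) by ring.
  by rewrite mulr_gt0// subr_gt0 lt_neqAle ?x1// eq_sym xN1.
have H : (chebT x p.+1 - x * chebT x p) ^+ 2 =
    (1 - x ^+ 2) * (1 - chebT x p ^+ 2).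
  have := chebT_invariant x p; set u := chebT x p.+1; set v := chebT x p => E.
  suff -> : (u - x * v) ^+ 2 =
    (u ^+ 2 - 2 * x * u * v + v ^+ 2) - (1 - x ^+ 2) * v ^+ 2 by rewrite E; ring.
  by ring.
have := sqr_ge0 (chebT x p.+1 - x * chebT x p).
rewrite H pmulr_rge0// subr_ge0 => le1.
by rewrite -(@ler_pXn2r _ 2)// ?nnegrE// expr1n real_normK// num_real.
Qed.

(** The slope p^2 is that of T_p at 1. Each increment T_{p+1} - T_p exceeds the previous one by 2(x
    - 1) T_p >= 2(x - 1), and the odd numbers sum to squares. *)
Lemma chebT_ge {F : realFieldType} (x : F) p :
  1 <= x -> 1 + p%:R ^+ 2 * (x - 1) <= chebT x p.
Proof.
move=> x1.
suff: 1 + p%:R ^+ 2 * (x - 1) <= chebT x p /\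
      (2 * p%:R + 1) * (x - 1) <= chebT x p.+1 - chebT x p by case.
elim: p => [|p [IH0 IH1]]; first by rewrite /=; split; lra.
have E : chebT x p.+1 >= 1 + p.+1%:R ^+ 2 * (x - 1) by rewrite -natr1; lra.
split=> //; rewrite chebTSS -natr1.
have : 1 <= chebT x p.+1.
  by apply: le_trans E; rewrite lerDl mulr_ge0 ?sqr_ge0// subr_ge0.
by move: (chebT x p.+1) (chebT x p) IH1 => u v IH1 u1; nra.
Qed.

(* The induction needs the four bounds of [H] together: quadratic ones on
   [1 - T_p] and linear ones on the increments. *)
Lemma chebT_near1 {F : realFieldType} (w : F) p : 0 <= w ->
  4 * p%:R ^+ 2 * w <= 1 -> w * p%:R ^+ 2 <= 1 - chebT (1 - 2 * w) p.
Proof.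
move=> w0; set x := 1 - 2 * w.
have H : 4 * p%:R ^+ 2 * w <= 1 -> w * p%:R ^+ 2 <= 1 - chebT x p /\
      1 - chebT x p <= 2 * w * p%:R ^+ 2 /\
      w * (2 * p%:R + 1) <= chebT x p - chebT x p.+1 /\
      chebT x p - chebT x p.+1 <= 2 * w * (2 * p%:R + 1).
  elim: p => [|p IH] P; first by rewrite /= /x; lra.
  have p0 : 0 <= p%:R :> F by [].
  have := P; rewrite -[p.+1%:R]natr1 => P'.
  case: IH => [|IH0 [IH1 [IH2 IH3]]].
    by apply: le_trans P'; rewrite ler_wpM2r//; lra.
  have A0 : w * (p%:R + 1) ^+ 2 <= 1 - chebT x p.+1 by lra.
  have A1 : 1 - chebT x p.+1 <= 2 * w * (p%:R + 1) ^+ 2 by lra.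
  have A2 : 0 <= w * (p%:R + 1) ^+ 2 by rewrite mulr_ge0// sqr_ge0.
  do 2! [split => //].
  rewrite chebTSS /x.
  move: (chebT x p.+1) (chebT x p) A0 A1 IH2 IH3 => u v A0 A1 IH2 IH3.
  have u1 : u <= 1 by lra.
  have u2 : 1 / 2 <= u by lra.
  by split; nra.
by move=> /H[].
Qed.

(** The identity T_p(cosh t) = cosh(pt) with e in place of exp t. *)
Lemma chebT_joukowski {F : fieldType} (e : F) p : (2 : F) != 0 -> e != 0 ->
  chebT ((e + e^-1) / 2) p = (e ^+ p + e ^- p) / 2.
Proof.
move=> two0 e0; elim/nat_ind2: p => [||p IH0 IH1].
- by rewrite /= expr0 invr1; field.
- by rewrite /= expr1.
by rewrite chebTSS IH0 IH1 !exprS; field; rewrite expf_neq0// e0 two0.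
Qed.

(** Twice the coefficient of (-4v)^j in T_q(1 - 2v). As a natural number built from binomials it
    obeys a recurrence by Pascal's rule, which the quotient of factorials hides; the doubling avoids
    halves. *)
Definition cheb_weight (q j : nat) : nat := ('C(q + j, 2 * j) + 'C(q + j - 1, 2 * j))%N.

Lemma cheb_weight0 q : cheb_weight q 0 = 2%N.
Proof. by rewrite /cheb_weight !bin0. Qed.

Lemma cheb_weight_small q j : (q < j)%N -> cheb_weight q j = 0%N.
Proof. by move=> qj; rewrite /cheb_weight !bin_small//; lia. Qed.

(* The recurrence of T_q (1 - 2 v) in v, coefficientwise and without signs. *)
Lemma cheb_weight_rec q j :
  (cheb_weight q.+2 j.+1 + cheb_weight q j.+1 =
   2 * cheb_weight q.+1 j.+1 + cheb_weight q.+1 j)%N.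
Proof.
have B m l : ('C(m.+2, l.+2) + 'C(m, l.+2) = 2 * 'C(m.+1, l.+2) + 'C(m, l))%N.
  by rewrite !binS; lia.
rewrite /cheb_weight !mulnS !addnS !addSn !subn1 /=.
have := B (q + j)%N.+1 (2 * j)%N; have := B (q + j)%N (2 * j)%N.
by rewrite !add0n; lia.
Qed.

(** The two binomials are (q + j) and (q - j) times the same quotient (q+j-1)! / ((2j)! (q-j)!), and
    these factors add up to 2q. For j = q the second binomial vanishes. *)
Lemma cheb_coefE (R : realType) q j : (0 < q)%N -> (j <= q)%N ->
  cheb_coef R q j = (-4) ^+ j * ((cheb_weight q j)%:R / 2).
Proof.
move=> q0 jq; rewrite /cheb_coef -!mulrA; congr (_ * _).
have predfact m : (0 < m -> m * (m - 1)`! = m`!)%N by case: m => // m; rewrite subn1 factS.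
have qE : (q + j - (2 * j) = q - j)%N by lia.
have e1 : ('C(q + j, 2 * j) * ((2 * j)`! * (q - j)`!) = (q + j) * (q + j - 1)`!)%N.
  by rewrite -qE bin_fact ?predfact//; lia.
have e2 : ('C(q + j - 1, 2 * j) * ((2 * j)`! * (q - j)`!) = (q - j) * (q + j - 1)`!)%N.
  have [->|jq'] := eqVneq j q; first by rewrite subnn bin_small ?mul0n//; lia.
  have jltq : (j < q)%N by lia.
  have -> : (q - j = (q - j - 1).+1)%N by lia.
  rewrite factS -(@bin_fact (q + j - 1) (2 * j))%N; last lia.
  have -> : (q + j - 1 - 2 * j = q - j - 1)%N by lia.
  by lia.
have e : (cheb_weight q j * ((2 * j)`! * (q - j)`!) = 2 * (q * (q + j - 1)`!))%N.
  by rewrite /cheb_weight mulnDl e1 e2 -mulnDl mulnA; congr (_ * _)%N; lia.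
have := congr1 (fun m : nat => m%:R : R) e; rewrite !natrM => {}e.
have f1 : ((2 * j)`!)%:R != 0 :> R by rewrite pnatr_eq0 -lt0n fact_gt0.
have f2 : ((q - j)`!)%:R != 0 :> R by rewrite pnatr_eq0 -lt0n fact_gt0.
by field: e; rewrite f1 f2.
Qed.

(** The length [m] is free beyond q, the extra weights being zero; so the sums for three consecutive
    degrees can be aligned in the induction. *)
Lemma cheb_weight_chebT {F : numFieldType} (v : F) q m : (q < m)%N ->
  \sum_(0 <= j < m) (-4) ^+ j * ((cheb_weight q j)%:R / 2) * v ^+ j =
  chebT (1 - 2 * v) q.
Proof.
elim/nat_ind2: q m => [[//|m] _|[//|[//|m]] _|q IH0 IH1 [//|m] qm].
- rewrite big_nat_recl// big_nat_cond big1 => [|i _]; last first.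
    by rewrite cheb_weight_small// mul0r mulr0 mul0r.
  by rewrite cheb_weight0 /= expr0; field.
- rewrite !big_nat_recl// big_nat_cond big1 => [|i _]; last first.
    by rewrite cheb_weight_small// mul0r mulr0 mul0r.
  by rewrite cheb_weight0 (_ : cheb_weight 1 1 = 1%N)//= !expr0 !expr1; field.
have rec j : (-4) ^+ j.+1 * ((cheb_weight q.+2 j.+1)%:R / 2) * v ^+ j.+1 =
    2 * ((-4) ^+ j.+1 * ((cheb_weight q.+1 j.+1)%:R / 2) * v ^+ j.+1) -
    4 * v * ((-4) ^+ j * ((cheb_weight q.+1 j)%:R / 2) * v ^+ j) -
    (-4) ^+ j.+1 * ((cheb_weight q j.+1)%:R / 2) * v ^+ j.+1.
  have := congr1 (fun m : nat => m%:R : F) (cheb_weight_rec q j).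
  rewrite natrD [in RHS]natrD natrM => /(canRL (addrK _)) ->.
  by rewrite !exprS; field.
rewrite chebTSS -(IH0 m.+1)//; last lia.
rewrite (_ : 2 * (1 - 2 * v) * _ = 2 * chebT (1 - 2 * v) q.+1 -
  4 * v * chebT (1 - 2 * v) q.+1); last by ring.
rewrite -{1}(IH1 m.+1); last lia.
rewrite -(IH1 m); last lia.
rewrite ![in RHS]big_nat_recl// big_nat_recl// !cheb_weight0.
under eq_bigr do rewrite rec.
by rewrite !sumrB -!mulr_sumr expr0; field.
Qed.

Lemma cheb_coef_chebT (R : realType) q (v : R) : (0 < q)%N ->
  \sum_(j < q.+1) cheb_coef R q j * v ^+ j = chebT (1 - 2 * v) q.
Proof.
move=> q0; rewrite -(@cheb_weight_chebT _ v q q.+1)// big_mkord.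
by apply: eq_bigr => j _; rewrite cheb_coefE// -ltnS.
Qed.

Lemma cheb_coef_chebT_even (R : realType) q (v : R) : (0 < q)%N -> ~~ odd q ->
  \sum_(j < q.+1) cheb_coef R q j * v ^+ j = chebT (2 * v - 1) q.
Proof.
move=> q0 qe; rewrite cheb_coef_chebT// -opprB chebTN.
by rewrite -signr_odd (negbTE qe) mul1r.
Qed.

(** The signs alternate, so the absolute values are summed by evaluating at v = -1, where 1 - 2v =
    3. *)
Lemma sum_norm_cheb_coef (R : realType) q : (0 < q)%N ->
  \sum_(j < q.+1) `|cheb_coef R q j| = chebT 3 q.
Proof.
move=> q0; rewrite (_ : 3 = 1 - 2 * (-1)); last by ring.
rewrite -cheb_coef_chebT//; apply: eq_bigr => j _.
rewrite cheb_coefE; [|by []|by rewrite -ltnS].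
have w0 : 0 <= (cheb_weight q j)%:R / 2 :> R by rewrite divr_ge0.
rewrite normrM (ger0_norm w0) normrX normrN (ger0_norm (_ : 0 <= 4))//.
by rewrite mulrAC -exprMn; congr (_ ^+ _ * _); ring.
Qed.

(** 3 + 2 sqrt 2 is the root above 1 of e + 1/e = 6. *)
Lemma chebT3_le (R : realType) q : chebT (3 : R) q <= (3 + 2 * Num.sqrt 2) ^+ q.
Proof.
have s2 : Num.sqrt 2 ^+ 2 = 2 :> R by rewrite sqr_sqrtr.
have s0 : 0 <= Num.sqrt 2 :> R by rewrite sqrtr_ge0.
set e := 3 + 2 * Num.sqrt 2.
have e1 : 1 <= e by rewrite /e; lra.
have e0 : e != 0 by rewrite gt_eqF//; lra.
have -> : 3 = (e + e^-1) / 2.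
  suff -> : e^-1 = 3 - 2 * Num.sqrt 2 by rewrite /e; field.
  by apply: (mulfI e0); rewrite divff// /e; move: s2; nra.
rewrite chebT_joukowski//.
have : 1 <= e ^+ q by rewrite exprn_ege1.
have : (e ^+ q)^-1 <= 1 by rewrite invf_le1 ?exprn_ege1// exprn_gt0//; lra.
by lra.
Qed.

(** * Pathwise analysis of the estimator *)

(** This is [eta_hat t] at [theta] minus its mean: the Gaussian exponential is normalised to mean 1,
    and the weights e^{-t mu_i} are at most 1. Moving the point by z multiplies it by e^{tz}. *)
Definition noise {R : realType} {n : nat} (t : R) (mu x : 'I_n -> R) : R :=
  n%:R^-1 * \sum_(i < n) expR (- t * mu i) * (expR (- t * x i - t ^+ 2 / 2) - 1).

Definition noise_norm {R : realType} {n : nat} (q : nat) (lam : R)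
    (mu x : 'I_n -> R) : R :=
  \sum_(j < q.+1) `|cheb_coef R q j| * `|noise (j%:R * lam) mu x|.

Definition psi_mean {R : realType} {n : nat} (q : nat) (lam : R)
    (mu : 'I_n -> R) (z : R) : R :=
  n%:R^-1 * \sum_(i < n) chebT (2 * expR (lam * (z - mu i)) - 1) q.

Section deterministic.
Context {R : realType} {n : nat}.
Variables (q : nat) (lam theta : R) (mu x : 'I_n -> R).
Hypotheses (n0 : (0 < n)%N) (q0 : (0 < q)%N) (qe : ~~ odd q) (lam0 : 0 < lam).
Hypothesis mu0 : forall i, 0 <= mu i.

Let y i := theta + mu i + x i.
Let N := noise_norm q lam mu x.

Lemma noise_norm_ge0 : 0 <= N.
Proof. by apply: sumr_ge0 => j _; rewrite mulr_ge0. Qed.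

Lemma noise0 : noise 0 mu x = 0.
Proof.
rewrite /noise big1 ?mulr0// => i _.
by rewrite oppr0 !mul0r expr0n mul0r subr0 expR0 subrr mulr0.
Qed.

Lemma psi_hat_decomp (z : R) : psi_hat q lam y (theta + z) =
  psi_mean q lam mu z +
  \sum_(j < q.+1) cheb_coef R q j * (expR (j%:R * lam * z) * noise (j%:R * lam) mu x).
Proof.
rewrite /psi_mean.
under eq_bigr do rewrite -cheb_coef_chebT_even//.
rewrite exchange_big /= mulr_sumr -big_split /=; apply: eq_bigr => j _.
rewrite -mulr_sumr [X in _ = X + _]mulrCA -mulrDr; congr (_ * _).
rewrite /eta_hat /noise [X in _ = _ + X]mulrCA -mulrDr; congr (_ * _).
rewrite mulr_sumr -big_split; apply: eq_bigr => i _ /=.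
rewrite -expRM_natl [X in _ = _ + X]mulrA -expRD [X in _ = _ + X]mulrBr mulr1 -expRD.
have -> : j%:R * lam * z + - (j%:R * lam) * mu i = j%:R * (lam * (z - mu i)) by ring.
by rewrite [RHS]addrC subrK; congr expR; rewrite /y; ring.
Qed.

(** The term j = 0, whose factor would be 1, carries no noise, so the largest factor left is e^{lam
    z}. This decay is what later bounds the distance of a crossing below [theta]. *)
Lemma psi_hat_dev_le0 (z : R) : z <= 0 ->
  `|psi_hat q lam y (theta + z) - psi_mean q lam mu z| <= expR (lam * z) * N.
Proof.
move=> z0; rewrite psi_hat_decomp addrAC subrr add0r.
apply: le_trans (ler_norm_sum _ _ _) _; rewrite mulr_sumr; apply: ler_sum => j _.
rewrite normrM (normrM (expR _)) (ger0_norm (expR_ge0 _)) [leRHS]mulrCA ler_wpM2l//.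
have [->|j0] := posnP j; first by rewrite mulr0n !mul0r noise0 normr0 !mulr0.
rewrite ler_wpM2r// ler_expR -mulrA.
by rewrite ler_neMl ?ler1n// mulr_ge0_le0// ltW.
Qed.

Lemma psi_hat_dev_ge0 (z : R) : 0 <= z ->
  `|psi_hat q lam y (theta + z) - psi_mean q lam mu z| <= expR (q%:R * lam * z) * N.
Proof.
move=> z0; rewrite psi_hat_decomp addrAC subrr add0r.
apply: le_trans (ler_norm_sum _ _ _) _; rewrite mulr_sumr; apply: ler_sum => j _.
rewrite normrM (normrM (expR _)) (ger0_norm (expR_ge0 _)) [leRHS]mulrCA ler_wpM2l//.
by rewrite ler_wpM2r// ler_expR !ler_wpM2r ?(ltW lam0)// ler_nat -ltnS.
Qed.

Lemma chebT_exp_le1 (z : R) : z <= 0 -> chebT (2 * expR (lam * z) - 1) q <= 1.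
Proof.
move=> z0; apply: le_trans (ler_norm _) _; apply: chebT_le1.
have : expR (lam * z) <= 1 by rewrite -expR0 ler_expR mulr_ge0_le0// ltW.
by have := expR_ge0 (lam * z); rewrite ler_norml; lra.
Qed.

Lemma chebT_exp_ge1 (z : R) : 0 <= z -> 1 <= chebT (2 * expR (lam * z) - 1) q.
Proof.
move=> z0; have E : 1 <= expR (lam * z) by rewrite -expR0 ler_expR mulr_ge0// ltW.
apply: le_trans (chebT_ge _ _); last lra.
by rewrite lerDl mulr_ge0 ?sqr_ge0//; lra.
Qed.

Lemma chebT_exp_geN1 (z : R) : -1 <= chebT (2 * expR (lam * z) - 1) q.
Proof.
have [z0|/ltW z0] := lerP 0 z.
  by apply: le_trans (chebT_exp_ge1 z0); lra.
have : `|chebT (2 * expR (lam * z) - 1) q| <= 1.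
  apply: chebT_le1.
  have : expR (lam * z) <= 1 by rewrite -expR0 ler_expR mulr_ge0_le0// ltW.
  by have := expR_ge0 (lam * z); rewrite ler_norml; lra.
by rewrite ler_norml => /andP[].
Qed.

Lemma psi_mean_le1 (z : R) : z <= 0 -> psi_mean q lam mu z <= 1.
Proof.
move=> z0; rewrite /psi_mean mulrC ler_pdivrMr ?ltr0n// mul1r.
rewrite -[leRHS]mulr1 -[n in leRHS]card_ord mulr_natl -sumr_const.
apply: ler_sum => i _; apply: chebT_exp_le1.
by have := mu0 i; lra.
Qed.

Variable k : nat.
Hypothesis muk : (#|[pred i | mu i != 0%R]| <= k)%N.

Let sum_neq0 : \sum_(i < n) (mu i != 0)%:R <= k%:R :> R.
Proof.
rewrite -natr_sum ler_nat (leq_trans _ muk)//.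
by rewrite -sum1_card [leqRHS]big_mkcond leq_sum.
Qed.

(** Each contaminated coordinate contributes at most 1 instead of T. The correction is written with
    the nonnegative factor 1 - T, so that an upper bound on the number of such coordinates
    suffices. *)
Lemma psi_mean_le (z : R) : z <= 0 -> psi_mean q lam mu z <=
  (1 - k%:R / n%:R) * chebT (2 * expR (lam * z) - 1) q + k%:R / n%:R.
Proof.
move=> z0; set T := chebT _ _.
have T1 : T <= 1 := chebT_exp_le1 z0.
rewrite /psi_mean mulrC ler_pdivrMr ?ltr0n//.
apply: (@le_trans _ _ (\sum_(i < n) (T + (1 - T) * (mu i != 0)%:R))).
  apply: ler_sum => i _; have [->|_] := eqVneq (mu i) 0.
    by rewrite subr0 mulr0 addr0.
  rewrite mulr1 (_ : T + _ = 1); last by ring.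
  apply: chebT_exp_le1.
  by have := mu0 i; lra.
rewrite big_split /= sumr_const card_ord -mulr_sumr -[T *+ n]mulr_natl.
have -> : ((1 - k%:R / n%:R) * T + k%:R / n%:R) * n%:R = n%:R * T + (1 - T) * k%:R.
  by field; rewrite pnatr_eq0 -lt0n.
by rewrite lerD2l ler_wpM2l// subr_ge0.
Qed.

Lemma psi_mean_ge (z : R) : 0 <= z ->
  (1 - k%:R / n%:R) * chebT (2 * expR (lam * z) - 1) q - k%:R / n%:R <=
  psi_mean q lam mu z.
Proof.
move=> z0; set T := chebT _ _.
have T1 : 1 <= T := chebT_exp_ge1 z0.
rewrite /psi_mean [leRHS]mulrC ler_pdivlMr ?ltr0n//.
apply: (@le_trans _ _ (\sum_(i < n) (T - (1 + T) * (mu i != 0)%:R))); last first.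
  apply: ler_sum => i _; have [->|_] := eqVneq (mu i) 0.
    by rewrite subr0 mulr0 subr0.
  rewrite mulr1 (_ : T - _ = -1); last by ring.
  exact: chebT_exp_geN1.
rewrite sumrB sumr_const card_ord -mulr_sumr -[T *+ n]mulr_natl.
have -> : ((1 - k%:R / n%:R) * T - k%:R / n%:R) * n%:R = n%:R * T - (1 + T) * k%:R.
  by field; rewrite pnatr_eq0 -lt0n.
by rewrite lerD2l lerN2 ler_wpM2l//; lra.
Qed.

End deterministic.

(** * Order statistics and the upper rough estimator *)

Lemma order_stat_le {R : realType} {n : nat} (y : 'I_n -> R) (j : nat) (t : R) :
  (0 < j <= n)%N ->
  (order_stat y j <= t) = (j <= #|[pred i | (y i <= t)%R]|)%N.
Proof.
case: j => // j /= jn.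
have -> : #|[pred i | (y i <= t)%R]| = count (<= t) (sort <=%R (codom y)).
  by rewrite (permP (permEl (perm_sort _ _))) /codom count_map cardE size_filter enumT.
have ss : sorted <=%R (sort <=%R (codom y)) by exact: sort_le_sorted.
rewrite /order_stat /=; apply/idP/idP => [h|h]; last exact: nth_count_le.
rewrite ltnNge; apply/negP => cj.
have : t < nth 0 (sort <=%R (codom y)) j.
  by apply: nth_count_gt => //; rewrite cj size_sort size_codom card_ord.
by rewrite ltNge h.
Qed.

Lemma order_stat1_le {R : realType} {n : nat} (y : 'I_n -> R) i :
  order_stat y 1 <= y i.
Proof.
have n0 : (0 < n)%N by case: n i {y} => // -[].
by rewrite order_stat_le ?n0//; apply/card_gt0P; exists i; rewrite inE.
Qed.

Lemma order_stat1_ex {R : realType} {n : nat} (y : 'I_n -> R) : (0 < n)%N ->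
  exists i, y i <= order_stat y 1.
Proof.
move=> n0; have := lexx (order_stat y 1).
by rewrite {1}order_stat_le ?n0// => /card_gt0P[i]; rewrite inE; exists i.
Qed.

Section deterministic_up.
Context {R : realType} {n : nat}.
Variables (theta : R) (mu x : 'I_n -> R).
Hypotheses (n0 : (0 < n)%N) (mu0 : forall i, 0 <= mu i).
Let y i := theta + mu i + x i.
Let b : R := 2 * Num.sqrt (ln n%:R).

(** An exponential tilt at level -b: a single sum dominates both the event that some noise falls
    below -b and the amount by which it does. Its Gaussian mean is n e^{-b^2/2}, that is 1/n for b =
    2 sqrt(log n). *)
Definition lower_excess (b : R) (x : 'I_n -> R) : R :=
  \sum_(i < n) expR (- b * x i - b ^+ 2).

Lemma lower_excess_ge (i : 'I_n) : 1 <= b ->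
  b * (- x i - b) + 1 <= lower_excess b x.
Proof.
move=> b1; rewrite /lower_excess (bigD1 i)//= -[leLHS]addr0 lerD//.
  by apply: le_trans (expR_ge1Dx _); rewrite addrC lerD2l; lra.
by apply: sumr_ge0 => ? _; exact: expR_ge0.
Qed.

Lemma theta_up_lt : 1 <= b -> theta_up y < theta -> 1 <= lower_excess b x.
Proof.
move=> b1; rewrite /theta_up -/b => ub.
have [i yi] := order_stat1_ex y n0.
apply: le_trans (lower_excess_ge i b1); rewrite lerDr mulr_ge0//; first lra.
by move: yi; rewrite /y; have := mu0 i; lra.
Qed.

Lemma theta_up_ge : 1 <= b -> theta - lower_excess b x <= theta_up y.
Proof.
move=> b1; have [/ltW ub|ub] := ltP theta (theta_up y).
  apply: le_trans ub; rewrite gerBl.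
  by apply: sumr_ge0 => ? _; exact: expR_ge0.
move: ub; rewrite /theta_up -/b => ub.
have [i yi] := order_stat1_ex y n0.
set o := order_stat y 1 in ub yi *.
have W := lower_excess_ge i b1; have mui := mu0 i; rewrite /y in yi.
have H1 : 0 <= (b - 1) * (theta - o - b) by rewrite mulr_ge0//; lra.
have H2 : 0 <= b * ((- x i - b) - (theta - o - b)) by rewrite mulr_ge0//; lra.
lra.
Qed.

Lemma theta_up_le (i : 'I_n) : mu i = 0 -> theta_up y <= theta + b + x i.
Proof.
move=> mui; rewrite /theta_up -/b.
by have := order_stat1_le y i; rewrite /y mui; lra.
Qed.

(** [theta_up] exceeds theta + b only if every uncontaminated noise is positive. On that very rare
    event the excess is at most the one noise [x i0], which is separated from the indicator by AM-GM
    on e^x. *)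
Lemma theta_up_le_indic (i0 : 'I_n) (eps I : R) : mu i0 = 0 -> 0 < eps -> 0 <= I ->
  ((forall i, mu i = 0 -> 0 < x i) -> 1 <= I) ->
  theta_up y - theta <= b + eps * expR (2 * x i0) + eps^-1 * I.
Proof.
move=> mui0 eps0 I0 HI.
have e0 : 0 <= eps * expR (2 * x i0) by rewrite mulr_ge0 ?expR_ge0// ltW.
have ei : 0 < eps^-1 by rewrite invr_gt0.
have [/HI I1|] := pselect (forall i, mu i = 0 -> 0 < x i).
  have := theta_up_le mui0.
  suff : x i0 <= eps * expR (2 * x i0) + eps^-1 * I by lra.
  apply: (@le_trans _ _ (eps * expR (2 * x i0) + eps^-1)); last first.
    by rewrite lerD2l ler_peMr// ltW.
  apply: (le_trans (_ : _ <= expR (x i0))).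
    by apply: le_trans (expR_ge1Dx _); lra.
  rewrite expRM_natl; have := expR_ge0 (x i0); set E := expR _ => E0.
  have -> : eps * E ^+ 2 + eps^-1 = eps^-1 * ((eps * E) ^+ 2 + 1).
    by field; rewrite gt_eqF.
  rewrite [leLHS](_ : E = eps^-1 * (eps * E)); last by field; rewrite gt_eqF.
  by rewrite ler_wpM2l ?(ltW ei)//; have := sqr_ge0 (eps * E - 1 / 2); nra.
move=> /existsNP[i /not_implyP[mui /negP]]; rewrite -leNgt => xi0.
have := theta_up_le mui.
have : 0 <= eps^-1 * I by rewrite mulr_ge0// ltW.
by lra.
Qed.
End deterministic_up.

Section estimator.
Context {R : realType} {n : nat}.
Variables (q : nat) (y : 'I_n -> R).
Hypothesis lbC : has_lbound (crossing q y).

Lemma theta_hat_le_up : theta_hat q y <= theta_up y.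
Proof.
rewrite /theta_hat; case: asboolP => // -[u Cu].
by apply: le_trans (ge_inf lbC Cu) _; case: Cu.
Qed.

Lemma theta_hat_le (u : R) : crossing q y u -> theta_hat q y <= u.
Proof.
move=> Cu; rewrite /theta_hat; case: asboolP => [_|[]]; last by exists u.
exact: ge_inf.
Qed.
End estimator.

Lemma theta_hat_ge {R : realType} {n : nat} (q : nat) (y : 'I_n -> R) (l : R) :
  lbound (crossing q y) l -> l <= theta_up y -> l <= theta_hat q y.
Proof.
move=> lC lu; rewrite /theta_hat; case: asboolP => // C0; exact: lb_le_inf.
Qed.

Definition slack {R : realType} (n q : nat) : R :=
  expR (aconst R * q%:R) / Num.sqrt n%:R.

Section deterministic_crossing.
Context {R : realType} {n : nat}.
Variables (q : nat) (theta : R) (mu x : 'I_n -> R).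
Hypotheses (n0 : (0 < n)%N) (q0 : (0 < q)%N) (qe : ~~ odd q).
Hypothesis mu0 : forall i, 0 <= mu i.
Let y i := theta + mu i + x i.
Let lam := lambdaq R q.
Let N := noise_norm q lam mu x.
Let B : R := slack n q.

Lemma lambdaq_gt0 : 0 < lam.
Proof. by rewrite /lam /lambdaq sqrtr_gt0 divr_gt0// ltr0n. Qed.

Lemma slack_gt0 : 0 < B.
Proof. by rewrite divr_gt0 ?expR_gt0// sqrtr_gt0 ltr0n. Qed.

Lemma crossing_le (u : R) : crossing q y u -> u <= theta -> B * expR (lam * (theta - u)) <= N.
Proof.
move=> [_ _ cu] ut.
have z0 : u - theta <= 0 by rewrite subr_le0.
have := psi_hat_dev_le0 theta mu x q0 qe lambdaq_gt0 z0.
have := psi_mean_le1 q n0 lambdaq_gt0 mu0 z0.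
rewrite (_ : theta + (u - theta) = u); last by ring.
rewrite -(opprB theta u) mulrN expRN => le1 /(le_trans (ler_norm _)) dev.
rewrite -ler_pdivlMr ?expR_gt0// [leRHS]mulrC; apply: le_trans dev.
by move: cu; rewrite -/lam -/(slack n q) -/B; lra.
Qed.

Lemma crossing_dist (u : R) : crossing q y u -> lam * (theta - u) <= N / B.
Proof.
have N0 : 0 <= N / B by rewrite divr_ge0 ?noise_norm_ge0// ltW// slack_gt0.
move=> Cu; have [ut|/ltW tu] := lerP u theta; last first.
  by apply: le_trans N0; rewrite mulr_ge0_le0 ?subr_le0// ltW// lambdaq_gt0.
rewrite ler_pdivlMr ?slack_gt0//.
apply: le_trans (crossing_le Cu ut); rewrite mulrC ler_wpM2l ?(ltW slack_gt0)//.
by apply: le_trans (expR_ge1Dx _); lra.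
Qed.

(** Covers the case [theta_low] = -oo: on every sample path the infimum is a genuine one and not a
    default value. *)
Lemma has_lbound_crossing : has_lbound (crossing q y).
Proof.
exists (theta - N / B / lam) => u /crossing_dist.
rewrite mulrC -ler_pdivlMr ?lambdaq_gt0//; lra.
Qed.

Lemma crossing_noise (u : R) : crossing q y u -> u <= theta -> B <= N.
Proof.
move=> Cu ut; apply: le_trans (crossing_le Cu ut).
rewrite ler_peMr ?(ltW slack_gt0)// -expR0 ler_expR mulr_ge0 ?(ltW lambdaq_gt0)//.
by rewrite subr_ge0.
Qed.
End deterministic_crossing.

(** * Hyperbolic cosine estimates *)

Section elementary.
Context {R : realType}.
Implicit Types x h t L : R.

Let ch x : R := (expR x + expR (- x)) / 2.

Lemma cosh_double x : ch (2 * x) = 2 * ch x ^+ 2 - 1.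
Proof.
rewrite /ch -mulrN !expRM_natl expRN; field.
by rewrite gt_eqF// expR_gt0.
Qed.

Lemma cosh_double_le x : ch (2 * x) <= ch x ^+ 4.
Proof. by rewrite cosh_double; have := sqr_ge0 (ch x ^+ 2 - 1); nra. Qed.

(** cosh x - 1 = (e^x - 1)^2 / (2 e^x), and e^x - 1 <= x e^x restates e^{-x} >= 1 - x. *)
Lemma cosh_le_taylor x : 0 <= x -> ch x <= 1 + x ^+ 2 * expR x / 2.
Proof.
move=> x0; have E0 := expR_gt0 x.
have E1 : expR x - 1 <= x * expR x.
  have := expR_ge1Dx (- x); rewrite expRN => H.
  suff : (1 - x) * expR x <= 1 by lra.
  by rewrite -ler_pdivlMr// div1r.
have E2 : 0 <= expR x - 1 by rewrite subr_ge0 -expR0 ler_expR.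
rewrite /ch expRN -subr_ge0.
have -> : 1 + x ^+ 2 * expR x / 2 - (expR x + (expR x)^-1) / 2 =
  ((x * expR x) ^+ 2 - (expR x - 1) ^+ 2) / (2 * expR x).
  by field; rewrite gt_eqF.
rewrite divr_ge0//.
by rewrite subr_ge0 lerXn2r// nnegrE; lra.
Qed.

(** Two uses of cosh(2x) <= cosh(x)^4 reduce h to h/4 <= 3/16, and the exponent scales alike since
    16 (h/4)^2 = h^2. There e^x <= 5/4 in the Taylor bound gives the constant 5/8. *)
Lemma cosh_le_expR h : 0 <= h <= 3 / 4 -> ch h <= expR (5 / 8 * h ^+ 2).
Proof.
move=> /andP[h0 h1]; set x := h / 4.
have x0 : 0 <= x by rewrite /x; lra.
have x1 : x <= 3 / 16 by rewrite /x; lra.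
have chp u : 0 <= ch u by rewrite /ch divr_ge0// addr_ge0// expR_ge0.
have -> : h = 2 * (2 * x) by rewrite /x; field.
apply: le_trans (cosh_double_le _) _.
apply: (@le_trans _ _ ((ch x ^+ 4) ^+ 4)); first by rewrite lerXn2r ?nnegrE ?exprn_ge0// cosh_double_le.
have E : expR x <= 5 / 4.
  have := expR_ge1Dx (- x); rewrite expRN => H.
  suff : (1 - x) * expR x <= 1 by have := expR_gt0 x; nra.
  by rewrite -ler_pdivlMr ?expR_gt0// div1r.
have C : ch x <= expR (5 / 8 * x ^+ 2).
  apply: le_trans (cosh_le_taylor x0) _; apply: le_trans (expR_ge1Dx _).
  by rewrite lerD2l; have := sqr_ge0 x; nra.
apply: (@le_trans _ _ ((expR (5 / 8 * x ^+ 2) ^+ 4) ^+ 4)).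
  by rewrite -!exprM lerXn2r ?nnegrE ?expR_ge0.
by rewrite -!expRM_natl ler_expR; lra.
Qed.

Lemma chebT_cosh h q : chebT (2 * ch h ^+ 2 - 1) q =
  (expR (2 * h) ^+ q + expR (2 * h) ^- q) / 2.
Proof.
by rewrite -cosh_double /ch expRN chebT_joukowski// gt_eqF// expR_gt0.
Qed.
End elementary.

Section deterministic_bounds.
Context {R : realType} {n : nat}.
Variables (q k : nat) (theta : R) (mu x : 'I_n -> R).
Hypotheses (n0 : (0 < n)%N) (q0 : (1 < q)%N) (qe : ~~ odd q).
Hypotheses (mu0 : forall i, 0 <= mu i).
Hypothesis muk : (#|[pred i | mu i != 0%R]| <= k)%N.
Let y i := theta + mu i + x i.
Let lam := lambdaq R q.
Let N := noise_norm q lam mu x.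
Let B : R := slack n q.
Let kap : R := k%:R / n%:R.

Let q1 : (0 < q)%N. Proof. exact: ltnW. Qed.
Let lam0 : 0 < lam. Proof. exact: lambdaq_gt0. Qed.
Let B0 : 0 < B. Proof. exact: slack_gt0. Qed.
Let N0 : 0 <= N. Proof. exact: noise_norm_ge0. Qed.
Let kap0 : 0 <= kap. Proof. by rewrite divr_ge0. Qed.

(** With d = lam (theta - u), the mean is below 1 by at least q^2 d/4, because T_q has slope q^2 at
    1 and at least half the sample is clean. A crossing thus forces q^2 d/4 <= N - B, and N - B <=
    N^2/(4B) by AM-GM. *)
Lemma crossing_near (u : R) : kap <= 1 / 2 -> crossing q y u -> u <= theta ->
  4 * q%:R ^+ 2 * (lam * (theta - u)) <= 1 ->
  q%:R ^+ 2 * (lam * (theta - u)) <= N ^+ 2 / B.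
Proof.
move=> kap2 [_ _ cu] ut; set d := lam * (theta - u) => d1.
have d0 : 0 <= d by rewrite mulr_ge0 ?(ltW lam0)// subr_ge0.
have z0 : u - theta <= 0 by rewrite subr_le0.
have := psi_hat_dev_le0 theta mu x q1 qe lam0 z0.
have := psi_mean_le q n0 lam0 mu0 muk z0.
rewrite (_ : theta + (u - theta) = u); last by ring.
rewrite -(opprB theta u) mulrN -/d expRN -/kap -/y -/N => le1 /(le_trans (ler_norm _)) dev.
have ed : 1 + d <= expR d := expR_ge1Dx d.
have q2 : 4 <= q%:R ^+ 2 :> R by rewrite -natrX ler_nat (@leq_sqr 2).
have dd : d <= 1 by nra.
pose w := 1 - (expR d)^-1.
have w1 : w <= d.
  rewrite /w; have := expR_ge1Dx (- d); rewrite expRN; lra.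
have w2 : d / 2 <= w.
  suff : (expR d)^-1 <= 1 - d / 2 by rewrite /w; lra.
  have p1 : 0 < 1 + d by lra.
  apply: (@le_trans _ _ (1 + d)^-1); first by rewrite lef_pV2 ?posrE// expR_gt0.
  by rewrite -div1r ler_pdivrMr//; nra.
have w0 : 0 <= w by lra.
have := @chebT_near1 _ w q w0.
have -> : 1 - 2 * w = 2 * (expR d)^-1 - 1 by rewrite /w; ring.
set T := chebT _ _ in le1 * => /(_ ltac:(nra)) HT.
have e1 : (expR d)^-1 * N <= N.
  by rewrite ler_piMl// invf_le1 ?expR_gt0//; lra.
have main : q%:R ^+ 2 * d / 4 <= N - B.
  move: cu; rewrite -/lam -/(slack n q) -/B => cu.
  have T2 : q%:R ^+ 2 * d / 2 <= 1 - T.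
    apply: le_trans HT; rewrite (_ : _ / 2 = d / 2 * q%:R ^+ 2); last by ring.
    by rewrite ler_wpM2r ?sqr_ge0.
  have T0 : 0 <= q%:R ^+ 2 * d by rewrite mulr_ge0 ?sqr_ge0.
  have : (1 - T) / 2 <= (1 - kap) * (1 - T) by rewrite mulrC ler_wpM2r//; lra.
  by move: (psi_hat _ _ _ _) (psi_mean _ _ _ _) cu dev le1 => P M; lra.
have : N - B <= N ^+ 2 / B / 4.
  have -> : N ^+ 2 / B / 4 = N - B + (N / 2 - B) ^+ 2 / B by field; rewrite gt_eqF.
  by rewrite lerDl divr_ge0 ?sqr_ge0// ltW.
by lra.
Qed.

(** A point of the search interval to the left of the estimator is not a crossing, so [psi_hat] is
    at most 1 + B there; it lies below [theta_up] because the estimator does. *)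
Lemma theta_hat_above (z : R) : 0 <= z -> theta + z < theta_hat q y ->
  (theta_low q y <= (theta + z)%:E)%E ->
  (1 - kap) * (chebT (2 * expR (lam * z) - 1) q - 1) <=
  2 * kap + B + expR (q%:R * lam * z) * N.
Proof.
move=> z0 hz lowz.
have lb : has_lbound (crossing q y) by exact: has_lbound_crossing.
have := psi_hat_dev_ge0 theta mu x q1 qe lam0 z0.
have := psi_mean_ge q n0 lam0 muk z0.
rewrite -/kap -/y -/N; set T := chebT _ _; set P := psi_hat _ _ _ _.
set M := psi_mean _ _ _ _.
rewrite distrC => HM /(le_trans (ler_norm _)) dev.
have psi1 : P <= 1 + B.
  rewrite leNgt; apply/negP => cu.
  have : crossing q y (theta + z).
    by split => //; apply: le_trans (ltW hz) _; exact: theta_hat_le_up.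
  by move=> /(theta_hat_le lb); rewrite leNgt hz.
lra.
Qed.

Hypothesis Bkap : B <= kap.

(** For small contamination T_q may be replaced by its tangent at 1, while the noise factor stays
    below 4 as long as q lam z <= 1. If the estimator lies further out, z = 1/(q lam) forces q <= 3
    kap + 4N, hence N >= 1/8 from q >= 2 and kap <= 1/2. *)
Lemma theta_hat_above_linear : kap <= 1 / 2 -> (theta_low q y <= theta%:E)%E ->
  q%:R ^+ 2 * lam * (theta_hat q y - theta) <= 3 * kap + 4 * N \/ 1 / 8 <= N.
Proof.
move=> kap2 low; have [N0' kap0' Bkap'] := And3 N0 kap0 Bkap.
have qR : 2 <= q%:R :> R by rewrite (ler_nat _ 2).
have q2l : 0 < q%:R ^+ 2 * lam by rewrite mulr_gt0// exprn_gt0//; lra.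
have H (z : R) : 0 <= z -> q%:R * lam * z <= 1 -> theta + z < theta_hat q y ->
    q%:R ^+ 2 * lam * z <= 3 * kap + 4 * N.
  move=> z0 qz hz.
  have lowz : (theta_low q y <= (theta + z)%:E)%E.
    by apply: le_trans low _; rewrite lee_fin; lra.
  have := theta_hat_above z0 hz lowz.
  have lz : 1 + lam * z <= expR (lam * z) := expR_ge1Dx _.
  have lz0 : 0 <= lam * z by rewrite mulr_ge0 ?(ltW lam0).
  have : 1 + q%:R ^+ 2 * ((2 * expR (lam * z) - 1) - 1) <= chebT (2 * expR (lam * z) - 1) q.
    by apply: chebT_ge; lra.
  set T := chebT _ _ => HT.
  have e3 : expR (q%:R * lam * z) <= 4.
    apply: (@le_trans _ _ (expR 1)); first by rewrite ler_expR.
    rewrite [X in expR X](_ : 1 = 2 * (1 / 2)); last by field.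
    rewrite expRM_natl (_ : 4 = 2 ^+ 2); last by ring.
    rewrite lerXn2r ?nnegrE ?expR_ge0//.
    have := expR_ge1Dx (- (1 / 2) : R); rewrite expRN => H2.
    have H3 : (2^-1 : R) <= (expR (1 / 2))^-1 by lra.
    by rewrite -lef_pV2 ?posrE ?expR_gt0.
  have : expR (q%:R * lam * z) * N <= 4 * N by rewrite ler_wpM2r.
  have : 2 * (q%:R ^+ 2 * (lam * z)) <= T - 1.
    apply: (@le_trans _ _ (q%:R ^+ 2 * ((2 * expR (lam * z) - 1) - 1))); last lra.
    by rewrite mulrCA ler_wpM2l ?sqr_ge0//; lra.
  have : 0 <= q%:R ^+ 2 * (lam * z) by rewrite mulr_ge0 ?sqr_ge0.
  set X := q%:R ^+ 2 * (lam * z) => X0 XT E3 M.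
  have : (1 - kap) * (2 * X) <= (1 - kap) * (T - 1) by rewrite ler_wpM2l//; lra.
  have : X <= (1 - kap) * (2 * X) by nra.
  by rewrite -mulrA -/X; lra.
have [hi|hi] := leP (q%:R * lam * (theta_hat q y - theta)) 1.
  left; rewrite leNgt; apply/negP => lt.
  set m := 3 * kap + 4 * N in lt H.
  have m0 : 0 <= m by rewrite /m; lra.
  (* [H] requires a point strictly below the estimator; the midpoint between the claimed bound and
     the estimator is one, and still violates the bound. *)
  pose z := (m / (q%:R ^+ 2 * lam) + (theta_hat q y - theta)) / 2.
  have mz : m / (q%:R ^+ 2 * lam) < theta_hat q y - theta.
    by rewrite ltr_pdivrMr// mulrC.
  have mz0 : 0 <= m / (q%:R ^+ 2 * lam) by rewrite divr_ge0// ltW.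
  have ql0 : 0 < q%:R * lam by rewrite mulr_gt0//; lra.
  have zlt : z < theta_hat q y - theta by rewrite /z; lra.
  have : q%:R ^+ 2 * lam * z <= m.
    apply: H; [rewrite /z; lra| |lra].
    by apply: le_trans hi; rewrite ler_wpM2l ?ltW.
  rewrite leNgt => /negP; apply.
  by rewrite mulrC -ltr_pdivrMr// /z; lra.
right.
have ql0 : 0 < q%:R * lam by rewrite mulr_gt0//; lra.
have : q%:R <= 3 * kap + 4 * N.
  have -> : q%:R = q%:R ^+ 2 * lam * (q%:R * lam)^-1 :> R by field; rewrite !gt_eqF//; lra.
  apply: H; [by rewrite invr_ge0 ltW|by rewrite mulfV// gt_eqF|].
  have : (q%:R * lam)^-1 < theta_hat q y - theta by rewrite -div1r ltr_pdivrMr// mulrC.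
  by lra.
by lra.
Qed.

Hypothesis kn : (0 < k < n)%N.

(* With h = 2L/q and e^{lam z} = cosh(h)^2 the argument of T_q is cosh(2h), so that
   T_q = cosh(4L) is explicit in t = e^L, while k/(n-k) = (t-1)^2. *)
Lemma theta_hat_above_log (L : R) : expR L = 1 + Num.sqrt (k%:R / (n%:R - k%:R)) ->
  L <= 3 / 8 * q%:R -> N <= B / 8 ->
  (theta_low q y <= (theta)%:E)%E ->
  theta_hat q y <= theta + 5 * L ^+ 2 / (q%:R ^+ 2 * lam).
Proof.
move=> eL Lq NB low; have [N0' kap0' Bkap'] := And3 N0 kap0 Bkap.
have qR : 2 <= q%:R :> R by rewrite (ler_nat _ 2).
case/andP: kn => kp kltn.
have nk : 0 < n%:R - k%:R :> R by rewrite subr_gt0 ltr_nat.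
have kR : 0 < k%:R :> R by rewrite ltr0n.
set rho := k%:R / (n%:R - k%:R) in eL.
have rho0 : 0 < rho by rewrite divr_gt0.
have sr : 0 < Num.sqrt rho by rewrite sqrtr_gt0.
have L0 : 0 < L by rewrite -expR_gt1 eL; lra.
pose h := 2 * L / q%:R.
have hb : 0 <= h <= 3 / 4.
  rewrite /h divr_ge0 ?ler_pdivrMr//=; lra.
pose c := (expR h + expR (- h)) / 2.
have c1 : 1 <= c.
  rewrite /c expRN; have := expR_gt0 h; set E := expR h => Ep.
  have -> : (E + E^-1) / 2 = 1 + (E - 1) ^+ 2 / (2 * E) by field; rewrite gt_eqF.
  by rewrite lerDl divr_ge0 ?sqr_ge0// mulr_ge0// ltW.
have cp : 0 < c by lra.
pose z := ln (c ^+ 2) / lam.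
have lz : lam * z = ln (c ^+ 2) by rewrite /z mulrC divfK// gt_eqF.
have elz : expR (lam * z) = c ^+ 2 by rewrite lz lnK// posrE exprn_gt0.
have lzb : lam * z <= 5 / 4 * h ^+ 2.
  rewrite -ler_expR elz.
  have -> : 5 / 4 * h ^+ 2 = 2 * (5 / 8 * h ^+ 2) by field.
  rewrite expRM_natl lerXn2r ?nnegrE ?expR_ge0 ?(ltW cp)//.
  exact: cosh_le_expR.
have lz0 : 0 <= lam * z by rewrite lz ln_ge0// expr_ge1//; lra.
have z0 : 0 <= z by move: lz0; rewrite pmulr_rge0.
have zb : z <= 5 * L ^+ 2 / (q%:R ^+ 2 * lam).
  rewrite ler_pdivlMr; last by rewrite mulr_gt0// exprn_gt0//; lra.
  have -> : z * (q%:R ^+ 2 * lam) = (lam * z) * q%:R ^+ 2 by ring.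
  rewrite -ler_pdivlMr; last by rewrite exprn_gt0//; lra.
  apply: le_trans lzb _; rewrite /h.
  suff -> : 5 / 4 * (2 * L / q%:R) ^+ 2 = 5 * L ^+ 2 / q%:R ^+ 2 by [].
  by field; rewrite gt_eqF//; lra.
apply: (@le_trans _ _ (theta + z)); last by rewrite lerD2l.
rewrite leNgt; apply/negP => hz.
have lowz : (theta_low q y <= (theta + z)%:E)%E.
  by apply: le_trans low _; rewrite lee_fin lerDl.
have := theta_hat_above z0 hz lowz.
rewrite elz chebT_cosh.
set t := expR L in eL.
have t1 : 1 < t by rewrite eL; lra.
have -> : expR (2 * h) ^+ q = t ^+ 4.
  rewrite -!expRM_natl /h; congr expR; field.
  by rewrite gt_eqF//; lra.
(* 5 L^2/q <= 2L because 5 * 3/8 < 2; the same factor 3/8 gave h <= 3/4 above. *)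
have Et : expR (q%:R * lam * z) <= t ^+ 2.
  rewrite -expRM_natl ler_expR -mulrA.
  apply: (@le_trans _ _ (q%:R * (5 / 4 * h ^+ 2))); first by rewrite ler_wpM2l//; lra.
  have -> : q%:R * (5 / 4 * h ^+ 2) = 5 * L ^+ 2 / q%:R.
    by rewrite /h; field; rewrite gt_eqF//; lra.
  by rewrite ler_pdivrMr; nra.
have rhoE : rho = (t - 1) ^+ 2 by rewrite eL addrAC subrr add0r sqr_sqrtr// ltW.
have kapE : kap = (1 - kap) * rho.
  by rewrite /kap /rho; field; rewrite pnatr_eq0 -lt0n n0 gt_eqF.
have kap1 : 0 < 1 - kap by rewrite subr_gt0 /kap ltr_pdivrMr ?ltr0n// mul1r ltr_nat.
have EN : expR (q%:R * lam * z) * N <= t ^+ 2 * (kap / 8).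
  by apply: ler_pM; [exact: expR_ge0|exact: N0|exact: Et|lra].
set U := (t ^+ 4 + _) / 2 => H.
have : (1 - kap) * (U - 1) <= (1 - kap) * (rho * (3 + t ^+ 2 / 8)).
  rewrite [leRHS]mulrA -kapE; lra.
rewrite ler_pM2l// rhoE leNgt => /negP; apply.
(* cosh(4L) - 1 = 2 sinh^2(2L) is divisible by (t - 1)^2 = rho. After cancelling rho a polynomial
   inequality in t > 1 remains. *)
have -> : U - 1 = (t - 1) ^+ 2 * ((t + 1) ^+ 2 * (t ^+ 2 + 1) ^+ 2 / (2 * t ^+ 4)).
  by rewrite /U; field; rewrite gt_eqF//; lra.
rewrite ltr_pM2l; last by rewrite exprn_gt0//; lra.
rewrite ltr_pdivlMr; last by rewrite mulr_gt0// exprn_gt0//; lra.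
rewrite -subr_gt0.
have -> : (t + 1) ^+ 2 * (t ^+ 2 + 1) ^+ 2 - (3 + t ^+ 2 / 8) * (2 * t ^+ 4) =
  3 / 4 * t ^+ 6 + t ^+ 3 * (2 * (t - 1) ^+ 2 + t + 2) + 3 * t ^+ 2 + 2 * t + 1 by field.
have tp m : 0 <= t ^+ m by rewrite exprn_ge0//; lra.
have : 0 <= t ^+ 3 * (2 * (t - 1) ^+ 2 + t + 2).
  by rewrite mulr_ge0//; have := sqr_ge0 (t - 1); lra.
by have := tp 6%N; have := tp 2%N; lra.
Qed.

End deterministic_bounds.

(** * Gaussian moments *)

(** The Radon-Nikodym derivative is determined only almost everywhere; it agrees there with
    [normal_pdf] since both have the same integral over each measurable set. *)
Lemma integral_normal_prob {R : realType} (m s : R) (f : R -> \bar R) :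
  (forall x, 0 <= f x)%E -> measurable_fun [set: R] f ->
  (\int[normal_prob m s]_x f x =
   \int[lebesgue_measure]_x (f x * (normal_pdf m s x)%:E))%E.
Proof.
move=> f0 mf.
have dom := normal_prob_dominates m s.
rewrite -(Radon_Nikodym_SigmaFinite.change_of_variables dom f0 measurableT mf).
have g0 := Radon_Nikodym_SigmaFinite.f_ge0 dom.
have gi := Radon_Nikodym_SigmaFinite.f_integrable dom.
have gE := Radon_Nikodym_SigmaFinite.f_integral dom.
have mp : measurable_fun [set: R] (fun x => (normal_pdf m s x)%:E).
  by apply/measurable_EFinP; exact: measurable_normal_pdf.
apply: ae_eq_integral => //.
- by apply: emeasurable_funM => //; exact: (measurable_int lebesgue_measure).
- exact: emeasurable_funM.
- apply: ae_eqe_mul2l.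
  apply: integral_ae_eq => //.
  by move=> E _ mE; rewrite -gE.
Qed.

(** Completing the square: the weight e^{tx} turns the density of N(0,1) into e^{t^2/2} times that
    of N(t,1). *)
Lemma integral_normal_prob_expR {R : realType} (t : R) :
  (\int[normal_prob 0 1]_x (expR (t * x))%:E = (expR (t ^+ 2 / 2))%:E)%E.
Proof.
rewrite integral_normal_prob//; last by apply/measurable_EFinP; exact: measurableT_comp.
transitivity (\int[lebesgue_measure]_x ((expR (t ^+ 2 / 2))%:E * (normal_pdf t 1 x)%:E))%E.
  apply: eq_integral => x _; rewrite -!EFinM !normal_pdfE ?oner_eq0//; congr EFin.
  rewrite mulrCA [RHS]mulrCA; congr (_ * _).
  by rewrite /normal_fun -!expRD; congr expR; field.
rewrite ge0_integralZl//.
- by rewrite integral_normal_pdf mule1.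
- by apply/measurable_EFinP; exact: measurable_normal_pdf.
- by move=> x _; rewrite lee_fin normal_pdf_ge0.
Qed.

Section gaussian_noise.
Context {d : measure_display} {T : measurableType d} {R : realType}.
Variable P : probability T R.

Lemma integral_standard_normal (X : {RV P >-> R}) (f : R -> \bar R) :
  standard_normal X -> (forall x, 0 <= f x)%E -> measurable_fun [set: R] f ->
  (\int[P]_w f (X w) = \int[normal_prob 0 1]_x f x)%E.
Proof.
move=> nX f0 mf.
rewrite -(@ge0_integral_distribution _ _ _ _ _ P X f)//.
(* [normal_prob] is a measure on [measurableTypeR R], a different [measurableType]
   from [R] with its Borel sets; the pushforward by the identity transports it. *)
pose toR : measurableTypeR R -> R := idfun.
have mtoR : measurable_fun [set: measurableTypeR R] toR by exact: measurable_id.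
pose nu : {measure set R -> \bar R} := pushforward (normal_prob 0 1) toR.
transitivity (\int[nu mtoR]_x f x)%E.
  by apply: eq_measure_integral => A mA _; exact: nX.
by rewrite /nu ge0_integral_pushforward//.
Qed.

Lemma integral_expR_standard_normal (X : {RV P >-> R}) (t : R) :
  standard_normal X ->
  (\int[P]_w (expR (t * X w))%:E = (expR (t ^+ 2 / 2))%:E)%E.
Proof.
move=> nX; rewrite -integral_normal_prob_expR.
rewrite (@integral_standard_normal _ (fun x => (expR (t * x))%:E))//.
by apply/measurable_EFinP; exact: measurableT_comp.
Qed.

(** Independence on the pair {i, j} says that the joint law and the product of the two laws agree on
    rectangles, hence everywhere; Tonelli's theorem then splits the integral. *)
Lemma integral_mul_independent {I : finType} (X : I -> {RV P >-> R})
    (i j : I) (f g : R -> \bar R) :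
  mutually_independent X -> i != j ->
  (forall x, 0 <= f x)%E -> (forall x, 0 <= g x)%E ->
  measurable_fun [set: R] f -> measurable_fun [set: R] g ->
  (\int[P]_w (f (X i w) * g (X j w)) =
   (\int[P]_w f (X i w)) * (\int[P]_w g (X j w)))%E.
Proof.
move=> indX ij f0 g0 mf mg.
pose XY (w : T) : R * R := (X i w, X j w).
have mXY : measurable_fun [set: T] XY by exact: measurable_fun_pair.
pose m' : {measure set (R * R) -> \bar R} := pushforward P XY.
pose mi := distribution P (X i); pose mj := distribution P (X j).
have rect A B : measurable A -> measurable B ->
    (m' mXY (A `*` B) = mi A * mj B)%E.
  move=> mA mB.
  have := indX [set i; j]%SET (fun l => if l == i then A else B).
  have mAB l : l \in [set i; j]%SET -> measurable (if l == i then A else B) by case: ifP.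
  move=> /(_ mAB); rewrite big_setU1 ?inE// big_set1 eqxx eq_sym (negbTE ij) => <-.
  rewrite /m' /= /pushforward; congr (P _); apply/seteqP; split => [w [/= wA wB] l|w H].
    rewrite /= !inE => /orP[|] /eqP ->; first by rewrite eqxx.
    by rewrite eq_sym (negbTE ij).
  split; first by have := H i; rewrite /= !inE eqxx; apply.
  by have := H j; rewrite /= !inE eqxx orbT eq_sym (negbTE ij); apply.
have mE := @product_measure_unique _ _ _ _ _ mi mj (m' mXY) rect.
pose h (z : R * R) := (f z.1 * g z.2)%E.
have mh : measurable_fun [set: R * R] h.
  by apply: emeasurable_funM; apply: measurableT_comp.
have h0 z : (0 <= h z)%E by rewrite mule_ge0.
transitivity (\int[m' mXY]_z h z)%E.
  by rewrite ge0_integral_pushforward.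
transitivity (\int[(mi \x mj)%E]_z h z)%E.
  by apply: eq_measure_integral => A mA _; exact/esym/mE.
rewrite fubini_tonelli1// /fubini_F /h /=.
under eq_integral do rewrite ge0_integralZl//.
rewrite ge0_integralZr//; last exact: integral_ge0.
by rewrite !ge0_integral_distribution.
Qed.

End gaussian_noise.

(** Measurability, nonnegativity and the bound travel together, so that a pointwise domination by
    sums of such variables yields a bound on the mean without integrability conditions. *)
Definition mean_le {d : measure_display} {T : measurableType d} {R : realType}
    (P : probability T R) (X : T -> R) (c : R) : Prop :=
  [/\ measurable_fun [set: T] X, forall w, 0 <= X w &
    (\int[P]_w (X w)%:E <= c%:E)%E].

(** Exact means are what survives a subtraction, as in the second moment of the centred noise. *)
Definition mean_eq {d : measure_display} {T : measurableType d} {R : realType}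
    (P : probability T R) (X : T -> R) (c : R) : Prop :=
  [/\ measurable_fun [set: T] X, forall w, 0 <= X w &
    (\int[P]_w (X w)%:E = c%:E)%E].

Section mean.
Context {d : measure_display} {T : measurableType d} {R : realType}.
Variable P : probability T R.
Implicit Types (X Y : T -> R) (c k : R).

Lemma mean_eq_le X c : mean_eq P X c -> mean_le P X c.
Proof. by move=> [mX X0 XE]; split => //; rewrite XE. Qed.

Lemma mean_eq_cst c : 0 <= c -> mean_eq P (fun=> c) c.
Proof.
move=> c0; split => //.
by rewrite integral_cst//= probability_setT mule1.
Qed.

Lemma mean_eqD X Y c1 c2 : mean_eq P X c1 -> mean_eq P Y c2 ->
  mean_eq P (fun w => X w + Y w) (c1 + c2).
Proof.
move=> [mX X0 XE] [mY Y0 YE]; split.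
- exact: measurable_funD.
- by move=> w; rewrite addr_ge0.
under eq_integral do rewrite EFinD.
rewrite ge0_integralD//.
- by rewrite XE YE.
- by move=> w _; rewrite lee_fin.
- exact/measurable_EFinP.
- by move=> w _; rewrite lee_fin.
- exact/measurable_EFinP.
Qed.

Lemma mean_eqZ X c k : 0 <= k -> mean_eq P X c ->
  mean_eq P (fun w => k * X w) (k * c).
Proof.
move=> k0 [mX X0 XE]; split.
- exact: measurable_funM.
- by move=> w; rewrite mulr_ge0.
under eq_integral do rewrite EFinM.
rewrite ge0_integralZl//.
- by rewrite XE.
- exact/measurable_EFinP.
- by move=> w _; rewrite lee_fin.
Qed.

Lemma mean_eq_sum (I : Type) (r : seq I) (X : I -> T -> R) (c : I -> R) :
  (forall i, mean_eq P (X i) (c i)) ->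
  mean_eq P (fun w => \sum_(i <- r) X i w) (\sum_(i <- r) c i).
Proof.
move=> H; elim: r => [|i r IH].
  rewrite big_nil (_ : (fun w => _) = fun=> 0); last first.
    by apply/funext => w; rewrite big_nil.
  exact: mean_eq_cst.
rewrite big_cons (_ : (fun w => _) = fun w => X i w + \sum_(i <- r) X i w).
  exact: mean_eqD.
by apply/funext => w; rewrite big_cons.
Qed.

Lemma mean_le_mono X Y c : measurable_fun [set: T] X -> (forall w, 0 <= X w) ->
  (forall w, X w <= Y w) -> mean_le P Y c -> mean_le P X c.
Proof.
move=> mX X0 XY [mY Y0 Yc]; split=> //; apply: le_trans Yc.
apply: ge0_le_integral => //.
- by move=> w _; rewrite lee_fin.
- exact/measurable_EFinP.
- exact/measurable_EFinP.
- by move=> w _; rewrite lee_fin.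
Qed.

Lemma mean_le_weaken X c1 c2 : c1 <= c2 -> mean_le P X c1 -> mean_le P X c2.
Proof.
by move=> c12 [mX X0 Xc]; split => //; apply: le_trans Xc _; rewrite lee_fin.
Qed.

Lemma mean_le_cst c : 0 <= c -> mean_le P (fun=> c) c.
Proof. by move=> c0; apply: mean_eq_le; exact: mean_eq_cst. Qed.

Lemma mean_leD X Y c1 c2 : mean_le P X c1 -> mean_le P Y c2 ->
  mean_le P (fun w => X w + Y w) (c1 + c2).
Proof.
move=> [mX X0 Xc] [mY Y0 Yc]; split.
- exact: measurable_funD.
- by move=> w; rewrite addr_ge0.
under eq_integral do rewrite EFinD.
rewrite ge0_integralD//.
- by rewrite EFinD leeD.
- by move=> w _; rewrite lee_fin.
- exact/measurable_EFinP.
- by move=> w _; rewrite lee_fin.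
- exact/measurable_EFinP.
Qed.

Lemma mean_leZ X c k : 0 <= k -> mean_le P X c ->
  mean_le P (fun w => k * X w) (k * c).
Proof.
move=> k0 [mX X0 Xc]; split.
- exact: measurable_funM.
- by move=> w; rewrite mulr_ge0.
under eq_integral do rewrite EFinM.
rewrite ge0_integralZl//.
- by rewrite EFinM lee_wpmul2l.
- exact/measurable_EFinP.
- by move=> w _; rewrite lee_fin.
Qed.

Lemma mean_le_sum (I : Type) (r : seq I) (X : I -> T -> R) (c : I -> R) :
  (forall i, mean_le P (X i) (c i)) ->
  mean_le P (fun w => \sum_(i <- r) X i w) (\sum_(i <- r) c i).
Proof.
move=> H; elim: r => [|i r IH].
  rewrite big_nil (_ : (fun w => _) = fun=> 0); last first.
    by apply/funext => w; rewrite big_nil.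
  exact: mean_le_cst.
rewrite big_cons (_ : (fun w => _) = fun w => X i w + \sum_(i <- r) X i w).
  exact: mean_leD.
by apply/funext => w; rewrite big_cons.
Qed.

Lemma mean_le_indic (A : set T) c : measurable A -> (P A <= c%:E)%E ->
  mean_le P \1_A c.
Proof.
move=> mA PA; split => //.
by rewrite integral_indic// setIT.
Qed.

Lemma mean_le_markov X c t : mean_le P X c -> 0 < t ->
  (P [set w | t <= X w]%R <= (c / t)%:E)%E.
Proof.
move=> HX t0; have [mX X0 Xc] := HX.
have mA : measurable [set w | t <= X w].
  by rewrite -[X in measurable X]setTI; apply: (measurable_fun_le (f := cst t)).
have : mean_le P \1_[set w | t <= X w]%R (t^-1 * c).
  apply: (@mean_le_mono _ (fun w => t^-1 * X w)).
  - by [].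
  - by move=> w; rewrite indicE.
  - move=> w; rewrite indicE mulrC ler_pdivlMr//.
    by case: (boolP (w \in _)) => [|_]; rewrite ?inE/= ?mul1r// mul0r.
  - by apply: mean_leZ => //; rewrite invr_ge0 ltW.
by move=> [_ _]; rewrite integral_indic// setIT mulrC.
Qed.

End mean.

(** * Second moment of the noise *)

Section noise_moments.
Context {d : measure_display} {T : measurableType d} {R : realType}.
Variables (P : probability T R) (n : nat) (xi : 'I_n -> {RV P >-> R}).
Hypothesis iid : iid_standard_normal xi.

Lemma mean_expR i (t : R) : mean_eq P (fun w => expR (t * xi i w)) (expR (t ^+ 2 / 2)).
Proof.
split; last by rewrite (integral_expR_standard_normal t (iid.2 i)).
- by apply: measurableT_comp => //; exact: measurable_funM.
- by move=> w; exact: expR_ge0.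
Qed.

Lemma mean_expR_mul i j (t : R) : mean_eq P
  (fun w => expR (- t * xi i w - t ^+ 2 / 2) * expR (- t * xi j w - t ^+ 2 / 2))
  (if i == j then expR (t ^+ 2) else 1).
Proof.
have [<-{j}|ij] := eqVneq i j.
  rewrite (_ : (fun w => _) = fun w => expR (- t ^+ 2) * expR (- (2 * t) * xi i w)).
    rewrite (_ : expR (t ^+ 2) = expR (- t ^+ 2) * expR ((- (2 * t)) ^+ 2 / 2)).
      by apply: mean_eqZ; [exact: expR_ge0|exact: mean_expR].
    by rewrite -expRD; congr expR; field.
  by apply/funext => w; rewrite -!expRD; congr expR; field.
rewrite (_ : (fun w => _) = fun w => expR (- t ^+ 2) * (expR (- t * xi i w) * expR (- t * xi j w))).
  rewrite [X in mean_eq _ _ X](_ : 1 = expR (- t ^+ 2) * (expR ((- t) ^+ 2 / 2) * expR ((- t) ^+ 2 / 2))).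
    apply: mean_eqZ; first exact: expR_ge0.
    have [mi i0 iE] := mean_expR i (- t); have [mj j0 jE] := mean_expR j (- t).
    split; [exact: measurable_funM|by move=> w; rewrite mulr_ge0|].
    under eq_integral do rewrite EFinM.
    rewrite EFinM -{1}iE -jE.
    apply: (@integral_mul_independent _ _ _ P _ xi i j (fun x => (expR (- t * x))%:E)
      (fun x => (expR (- t * x))%:E)) => //; first exact: iid.1.
      by apply/measurable_EFinP; exact: measurableT_comp.
    by apply/measurable_EFinP; exact: measurableT_comp.
  by rewrite -!expRD -[LHS]expR0; congr expR; field.
by apply/funext => w; rewrite -!expRD; congr expR; field.
Qed.

Hypothesis n0 : (0 < n)%N.
Variable mu : 'I_n -> R.
Hypothesis mu0 : forall i, 0 <= mu i.

(** In E S^2 the cross terms are c_i c_j by independence and sum to at most C^2; each of the n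
    diagonal terms is at most e^{t^2}, since c_i <= 1. *)
Lemma mean_noise_sqr (t : R) : 0 <= t ->
  mean_le P (fun w => noise t mu (xi^~ w) ^+ 2) (expR (t ^+ 2) / n%:R).
Proof.
move=> t0.
pose e i w := expR (- t * xi i w - t ^+ 2 / 2).
pose c i := expR (- t * mu i).
have c0 i : 0 <= c i by exact: expR_ge0.
have c1 i : c i <= 1 by rewrite /c -[leRHS]expR0 ler_expR mulNr oppr_le0 mulr_ge0.
pose C := \sum_(i < n) c i.
have C0 : 0 <= C by exact: sumr_ge0.
pose S w := \sum_(i < n) c i * e i w.
have mS1 : mean_eq P S C.
  apply: mean_eq_sum => i; rewrite -[X in mean_eq _ _ X]mulr1; apply: mean_eqZ => //.
  rewrite (_ : e i = fun w => expR (- (t ^+ 2 / 2)) * expR (- t * xi i w)).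
    rewrite [X in mean_eq _ _ X](_ : 1 = expR (- (t ^+ 2 / 2)) * expR ((- t) ^+ 2 / 2)).
      by apply: mean_eqZ; [exact: expR_ge0|exact: mean_expR].
    by rewrite -expRD -[LHS]expR0; congr expR; field.
  by apply/funext => w; rewrite /e -expRD addrC.
pose V := \sum_(i < n) \sum_(j < n) (c i * c j) * (if i == j then expR (t ^+ 2) else 1).
have mS2 : mean_eq P (fun w => S w ^+ 2) V.
  rewrite (_ : (fun w => _) = fun w => \sum_(i < n) \sum_(j < n) (c i * c j) * (e i w * e j w)).
    apply: mean_eq_sum => i; apply: mean_eq_sum => j.
    by apply: mean_eqZ; [exact: mulr_ge0|exact: mean_expR_mul].
  apply/funext => w; rewrite expr2 /S mulr_suml; apply: eq_bigr => i _.
  by rewrite mulr_sumr; apply: eq_bigr => j _; rewrite mulrACA.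
have VE : V <= C ^+ 2 + n%:R * expR (t ^+ 2).
  rewrite expr2 {1}/C mulr_suml -[n in n%:R]card_ord mulr_natl -sumr_const -big_split /=.
  apply: ler_sum => i _; rewrite (bigD1 i)//= eqxx [in leRHS]/C [in leRHS](bigD1 i)//=.
  have -> : \sum_(j < n | j != i) c i * c j * (if i == j then expR (t ^+ 2) else 1) =
     c i * \sum_(j < n | j != i) c j.
    rewrite mulr_sumr; apply: eq_bigr => j ji.
    by rewrite eq_sym (negbTE ji) mulr1.
  have E0 := expR_ge0 (t ^+ 2).
  have cc : c i * c i * expR (t ^+ 2) <= 1 * expR (t ^+ 2).
    by rewrite ler_wpM2r// mulr_ile1.
  have := mulr_ge0 (c0 i) (c0 i); rewrite mulrDr; lra.
have nE w : n%:R * noise t mu (xi^~ w) = S w - C.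
  rewrite /noise mulrA mulfV ?mul1r; last by rewrite pnatr_eq0 -lt0n.
  rewrite /S /C -sumrB; apply: eq_bigr => i _.
  by rewrite mulrBr mulr1.
have mN : measurable_fun [set: T] (fun w => noise t mu (xi^~ w)).
  rewrite (_ : (fun w => _) = fun w => n%:R^-1 * (S w - C)).
    by apply: measurable_funM => //; apply: measurable_funB => //; case: mS1.
  by apply/funext => w; rewrite -nE mulrA mulVf ?mul1r// pnatr_eq0 -lt0n.
have mN2 : measurable_fun [set: T] (fun w => noise t mu (xi^~ w) ^+ 2).
  exact: measurable_funX.
split => //; first by move=> w; exact: sqr_ge0.
have nn : 0 < n%:R :> R by rewrite ltr0n.
(* (nZ)^2 = (S - C)^2, arranged so that all integrands are nonnegative and no
   integrability has to be known. *)
have id w : n%:R ^+ 2 * noise t mu (xi^~ w) ^+ 2 + (2 * C) * S w = S w ^+ 2 + C ^+ 2.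
  by rewrite -exprMn nE; ring.
have [mA A0 AE] := mean_eqD mS2 (mean_eq_cst P (sqr_ge0 C)).
have [mB B0 BE] := @mean_eqZ _ _ _ P S C (2 * C) (ltac:(by rewrite mulr_ge0)) mS1.
have : (\int[P]_w (n%:R ^+ 2 * noise t mu (xi^~ w) ^+ 2)%:E + (2 * C * C)%:E =
   (V + C ^+ 2)%:E)%E.
  rewrite -AE -BE -ge0_integralD//.
  - by apply: eq_integral => w _; rewrite -EFinD id.
  - by move=> w _; rewrite lee_fin mulr_ge0 ?sqr_ge0.
  - by apply/measurable_EFinP; exact: measurable_funM.
  - by move=> w _; rewrite lee_fin.
  - exact/measurable_EFinP.
under eq_integral do rewrite EFinM.
rewrite ge0_integralZl//; last 2 first.
- exact/measurable_EFinP.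
- by move=> w _; rewrite lee_fin sqr_ge0.
have : (0 <= \int[P]_w (noise t mu (xi^~ w) ^+ 2)%:E)%E.
  by apply: integral_ge0 => w _; rewrite lee_fin sqr_ge0.
(* Finiteness of the integral is not known beforehand; the identity just obtained excludes the
   infinite value. *)
case: (\int[P]_w _)%E => [r| |]//.
- rewrite -EFinM -EFinD => r0 [] H; rewrite lee_fin ler_pdivlMr//.
  rewrite -(ler_pM2l nn); lra.
- by move=> _; rewrite mulry gtr0_sg ?mul1e// exprn_gt0.
Qed.

End noise_moments.

(** Lagrange's identity: the gap is the sum of a_i a_j (z_i - z_j)^2 over pairs, and each induction
    step adds the pairs containing the new index. *)
Lemma cauchy_schwarz_weighted {R : realFieldType} (I : Type) (r : seq I) (a z : I -> R) :
  (forall i, 0 <= a i) ->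
  (\sum_(i <- r) a i * z i) ^+ 2 <=
  (\sum_(i <- r) a i) * (\sum_(i <- r) a i * z i ^+ 2).
Proof.
move=> a0; elim: r => [|i r IH]; first by rewrite !big_nil expr0n mul0r.
rewrite !big_cons.
have : 0 <= \sum_(j <- r) a i * a j * (z i - z j) ^+ 2.
  by apply: sumr_ge0 => j _; rewrite mulr_ge0 ?sqr_ge0// mulr_ge0.
have -> : \sum_(j <- r) a i * a j * (z i - z j) ^+ 2 =
  a i * (z i ^+ 2 * \sum_(j <- r) a j - 2 * z i * \sum_(j <- r) a j * z j +
    \sum_(j <- r) a j * z j ^+ 2).
  rewrite !mulr_sumr -sumrB -big_split/= mulr_sumr; apply: eq_bigr => j _; ring.
move: IH; set A := \sum_(j <- r) a j; set S := \sum_(j <- r) _ * z j.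
set Q := \sum_(j <- r) _ * _ ^+ 2.
by lra.
Qed.

Section noise_norm_moments.
Context {d : measure_display} {T : measurableType d} {R : realType}.
Variables (P : probability T R) (n : nat) (xi : 'I_n -> {RV P >-> R}).
Hypothesis iid : iid_standard_normal xi.
Hypothesis n0 : (0 < n)%N.
Variable mu : 'I_n -> R.
Hypothesis mu0 : forall i, 0 <= mu i.

Lemma measurable_noise (t : R) : measurable_fun [set: T] (fun w => noise t mu (xi^~ w)).
Proof.
apply: measurable_funM => //; apply: measurable_sum => i.
apply: measurable_funM => //; apply: measurable_funB => //.
apply: measurableT_comp => //; apply: measurable_funB => //.
exact: measurable_funM.
Qed.

Lemma measurable_noise_norm q (lam : R) :
  measurable_fun [set: T] (fun w => noise_norm q lam mu (xi^~ w)).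
Proof.
apply: measurable_sum => j; apply: measurable_funM => //.
by apply: measurableT_comp => //; exact: measurable_noise.
Qed.

Lemma expR_aconst (q : nat) : expR (aconst R * q%:R / 3) =
  (3 + 2 * Num.sqrt 2) ^+ q * expR (q%:R : R).
Proof.
have s0 : 0 <= Num.sqrt 2 :> R by rewrite sqrtr_ge0.
have -> : aconst R * q%:R / 3 = q%:R * ln (3 + 2 * Num.sqrt 2) + q%:R.
  by rewrite /aconst; field.
by rewrite expRD expRM_natl lnK// posrE; lra.
Qed.

Lemma mean_noise_norm_sqr q : (0 < q)%N ->
  mean_le P (fun w => noise_norm q (lambdaq R q) mu (xi^~ w) ^+ 2)
    (expR (aconst R * q%:R / 3) ^+ 2 / n%:R).
Proof.
move=> q0; set lam := lambdaq R q.
have lam0 : 0 < lam by exact: lambdaq_gt0.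
pose A := \sum_(j < q.+1) `|cheb_coef R q j|.
have A0 : 0 <= A by exact: sumr_ge0.
have AE : A <= (3 + 2 * Num.sqrt 2) ^+ q.
  by rewrite /A sum_norm_cheb_coef//; exact: chebT3_le.
have qR : 0 < q%:R :> R by rewrite ltr0n.
have nn : 0 < n%:R :> R by rewrite ltr0n.
apply: (@mean_le_mono _ _ _ _ _ (fun w => A * \sum_(j < q.+1) `|cheb_coef R q j| * noise (j%:R * lam) mu (xi^~ w) ^+ 2)).
- exact/measurable_funX/measurable_noise_norm.
- by move=> w; exact: sqr_ge0.
- move=> w; rewrite /noise_norm.
  pose z (j : 'I_q.+1) := noise (j%:R * lam) mu (xi^~ w).
  rewrite [leRHS](_ : _ = A * \sum_(j < q.+1) `|cheb_coef R q j| * `|z j| ^+ 2).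
    exact: (cauchy_schwarz_weighted (index_enum _) (fun j => `|z j|) (fun j : 'I_q.+1 => normr_ge0 (cheb_coef R q j))).
  by congr (_ * _); apply: eq_bigr => j _; rewrite real_normK ?num_real.
apply: (@mean_le_weaken _ _ _ _ _ (A * (\sum_(j < q.+1) `|cheb_coef R q j| * (expR q%:R ^+ 2 / n%:R)))).
  rewrite -mulr_suml -/A expR_aconst exprMn mulrA -expr2 -[leRHS]mulrA.
  rewrite ler_wpM2r ?divr_ge0 ?sqr_ge0 ?(ltW nn)//.
  by rewrite lerXn2r// nnegrE (le_trans A0).
apply: mean_leZ => //; apply: mean_le_sum => j; apply: mean_leZ => //.
apply: (@mean_le_weaken _ _ _ _ _ (expR ((j%:R * lam) ^+ 2) / n%:R)); last first.
  by apply: mean_noise_sqr => //; rewrite mulr_ge0// ltW.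
rewrite ler_wpM2r ?invr_ge0 ?(ltW nn)// -expRM_natl ler_expR exprMn sqr_sqrtr; last first.
  by rewrite divr_ge0// ltW.
rewrite mulrCA mulrA ler_pdivrMr// -mulrA ler_wpM2l// expr2.
by apply: ler_pM => //; rewrite ler_nat -ltnS.
Qed.

Lemma mean_lower_excess : mean_le P
  (fun w => lower_excess (2 * Num.sqrt (ln n%:R)) (xi^~ w)) n%:R^-1.
Proof.
set b := 2 * _.
have l0 : 0 <= ln n%:R :> R by rewrite ln_ge0// ler1n.
have b2 : b ^+ 2 / 2 = 2 * ln n%:R by rewrite /b exprMn sqr_sqrtr//; field.
have nn : 0 < n%:R :> R by rewrite ltr0n.
apply: (@mean_le_weaken _ _ _ _ _ (\sum_(i < n) expR (- b ^+ 2) * expR ((- b) ^+ 2 / 2))).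
  rewrite sumr_const card_ord -[_ *+ n]mulr_natl -expRD sqrrN.
  have -> : - b ^+ 2 + b ^+ 2 / 2 = - (2 * ln n%:R) by rewrite -b2; field.
  rewrite expRN expRM_natl lnK ?posrE//.
  suff -> : n%:R * (n%:R ^+ 2)^-1 = n%:R^-1 :> R by [].
  by field; rewrite gt_eqF.
apply: mean_eq_le; rewrite /lower_excess.
rewrite (_ : (fun w => _) = fun w => \sum_(i < n) expR (- b ^+ 2) * expR (- b * xi i w)).
  by apply: mean_eq_sum => i; apply: mean_eqZ; [exact: expR_ge0|exact: mean_expR].
by apply/funext => w; apply: eq_bigr => i _; rewrite -expRD addrC.
Qed.
End noise_norm_moments.

(** * The median *)

Section normal_tail.
Context {R : realType}.

Lemma normal_prob_opp (A : set (measurableTypeR R)) : measurable A ->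
  normal_prob 0 1 (-%R @^-1` A) = normal_prob 0 1 A :> \bar R.
Proof.
move=> mA; rewrite /normal_prob.
transitivity (\int[pushforward lebesgue_measure (-%R : _ -> measurableTypeR R)]_(x in A) (normal_pdf 0 1 x)%:E)%E.
  rewrite ge0_integral_pushforward//=.
  - apply: eq_integral => x _; congr (_%:E).
    by rewrite !normal_pdfE ?oner_eq0// /normal_fun !subr0 sqrrN.
  - by apply/measurable_EFinP/measurable_funTS; exact: measurable_normal_pdf.
  - by move=> x _; rewrite lee_fin normal_pdf_ge0.
by apply: eq_measure_integral => B mB _; exact: lebesgue_measureN.
Qed.

Lemma normal_peak1_ge : 1 / 3 <= normal_peak (1 : R).
Proof.
have pi0 : 0 < pi :> R := pi_gt0 R.
have pi4 : pi <= 4 :> R by have := pihalf_lt2 R; lra.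
have pi2 : 0 < pi *+ 2 :> R by rewrite mulrn_wgt0.
rewrite /normal_peak expr1n div1r mul1r lef_pV2 ?posrE// ?sqrtr_gt0//.
rewrite -(@ler_pXn2r _ 2)// ?nnegrE// sqr_sqrtr ?(ltW pi2)//.
by rewrite mulr2n; lra.
Qed.

(** On [-1, 1] the density is at least 1/3 * 1/2, from its peak and from e^{-x^2/2} >= 1 - x^2/2;
    the interval has length 2v. *)
Lemma normal_prob_center (v : R) : 0 <= v <= 1 ->
  ((v / 3)%:E <= normal_prob 0 1 [set` `](- v)%R, v[%R])%E.
Proof.
move=> /andP[v0 v1].
apply: (@le_trans _ _ (\int[lebesgue_measure]_(x in [set` `](- v)%R, v[%R]) (1 / 6)%:E)%E).
  rewrite integral_cst//= lebesgue_measure_itv/= lte_fin.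
  case: ifP => [_|/negbT]; first by rewrite -EFinB -EFinM lee_fin; lra.
  by rewrite -leNgt => h; rewrite mule0 lee_fin; lra.
apply: ge0_le_integral => //=.
- by apply/measurable_EFinP/measurable_funTS; exact: measurable_normal_pdf.
move=> x; rewrite in_itv/= => /andP[x1 x2]; rewrite lee_fin normal_pdfE ?oner_eq0//.
have H1 : 1 / 2 <= normal_fun 0 1 x.
  rewrite /normal_fun; apply: le_trans (expR_ge1Dx _).
  by rewrite subr0 expr1n; nra.
have := normal_peak1_ge; nra.
Qed.

(** The tails have equal mass by symmetry and together miss the central v/3. A common p lets both
    median events share one bound. *)
Lemma normal_prob_tail (v : R) : 0 <= v <= 1 -> exists p : R,
  [/\ 0 <= p <= 1 / 2 - v / 6, normal_prob 0 1 `]v, +oo[%classic = p%:E &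
   normal_prob 0 1 `]-oo, - v[%classic = p%:E].
Proof.
move=> v01; have /andP[v0 v1] := v01.
pose N : probability (measurableTypeR R) R := normal_prob 0 1.
pose A : set (measurableTypeR R) := `]v, +oo[%classic.
pose B : set (measurableTypeR R) := `]-oo, - v[%classic.
pose C : set (measurableTypeR R) := `]- v, v[%classic.
have mA : measurable A by exact: measurable_itv.
have mB : measurable B by exact: measurable_itv.
have mC : measurable C by exact: measurable_itv.
have BE : B = -%R @^-1` A.
  by apply/seteqP; split => x /=; rewrite /A /B /= !in_itv/= andbT; lra.
have NB : N B = N A by rewrite BE; exact: normal_prob_opp.
have dAB : A `&` B = set0.
  by apply/seteqP; split=> // x [] /=; rewrite /A /B /= !in_itv/= andbT; lra.
have dABC : (A `|` B) `&` C = set0.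
  by apply/seteqP; split=> // x [] /=; rewrite /A /B /C /= !in_itv/= andbT => -[] ? /andP[]; lra.
have sum1 : (N A + N B + N C <= 1)%E.
  have mAB : measurable (A `|` B) by exact: measurableU.
  rewrite -measureU// -measureU//; apply: probability_le1; exact: measurableU.
have fA : N A \is a fin_num by exact: fin_num_measure.
have fC : N C \is a fin_num by exact: fin_num_measure.
have NC : ((v / 3)%:E <= N C)%E by exact: normal_prob_center.
exists (fine (N A)); rewrite -/(N A) -/(N B) NB fineK//; split => //.
rewrite fine_ge0//=.
move: sum1 NC; rewrite NB -(fineK fA) -(fineK fC) -!EFinD !lee_fin /=.
by lra.
Qed.
End normal_tail.

(** * Binomial tails by counting *)

Section counting.
Context {d : measure_display} {T : measurableType d} {R : realType}.
Variables (P : probability T R) (n : nat) (xi : 'I_n -> {RV P >-> R}).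
Hypothesis iid : iid_standard_normal xi.

Lemma standard_normal_preimage i (S : set R) : measurable S ->
  P (xi i @^-1` S) = normal_prob 0 1 S.
Proof. by move=> mS; rewrite -(iid.2 i). Qed.

Lemma mean_all_in (S : set R) (p : R) (J : {set 'I_n}) : measurable S ->
  normal_prob 0 1 S = p%:E ->
  mean_le P \1_(\bigcap_(i in [set` J]) (xi i @^-1` S)) (p ^+ #|J|).
Proof.
move=> mS pE.
apply: mean_le_indic; last first.
  rewrite (iid.1 J (fun=> S))//.
  rewrite (eq_bigr (fun=> p%:E)) => [|i _]; last by rewrite standard_normal_preimage.
  by rewrite prodEFin prodr_const.
apply: fin_bigcap_measurable => // i _.
by rewrite -[X in measurable X]setTI; exact: measurable_funP.
Qed.

Lemma mean_exact_in (S : set R) (p : R) (J : {set 'I_n}) : measurable S ->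
  normal_prob 0 1 S = p%:E ->
  mean_le P \1_(\bigcap_i (xi i @^-1` (if i \in J then S else ~` S)))
    (p ^+ #|J| * (1 - p) ^+ (n - #|J|)).
Proof.
move=> mS pE.
have mSJ i : measurable (if i \in J then S else ~` S).
  by case: ifP => // _; exact: measurableC.
apply: mean_le_indic.
  apply: fin_bigcap_measurable => // i _.
  by rewrite -[X in measurable X]setTI; exact: measurable_funP.
have := iid.1 [set: 'I_n]%SET (fun i => if i \in J then S else ~` S) (fun i _ => mSJ i).
have -> : [set` [set: 'I_n]%SET] = [set: 'I_n].
  by apply/seteqP; split => i //= _; rewrite inE.
move=> ->.
rewrite (eq_bigr (fun i => (if i \in J then p else 1 - p)%:E)) => [|i _]; last first.
  case: ifP => _; first by rewrite standard_normal_preimage.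
  rewrite preimage_setC probability_setC; last first.
    by rewrite -[X in measurable X]setTI; exact: measurable_funP.
  by rewrite standard_normal_preimage// pE.
rewrite prodEFin lee_fin (bigID (mem J))/=.
rewrite (eq_bigr (fun=> p)) => [|i /andP[_ ->]//].
rewrite [X in _ * X](eq_bigr (fun=> 1 - p)) => [|i /andP[_ /negbTE ->]//].
rewrite !prodr_const le_eqVlt; apply/orP; left; apply/eqP; congr (_ ^+ _ * _ ^+ _).
  by apply: eq_card => i; rewrite unfold_in !inE.
rewrite -[X in (X - _)%N]card_ord -(cardsC J) addKn.
by apply: eq_card => i; rewrite unfold_in !inE.
Qed.

(* Union bound over the 2^n possible sets of indices falling in [S]; each has
   probability at most (p (1 - p))^r. *)
Lemma mean_count_ge (S : set R) (p eps : R) (r : nat) : measurable S ->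
  normal_prob 0 1 S = p%:E -> 0 <= p <= 1 / 2 - eps -> 0 <= eps ->
  (2 * r <= n)%N -> exists X : T -> R,
  mean_le P X (2 ^+ n * (1 / 4 - eps ^+ 2) ^+ r) /\
  forall w, (r <= #|[pred i | `[< S (xi i w) >]]|)%N -> 1 <= X w.
Proof.
move=> mS pE /andP[p0 pe] e0 rn.
pose E (J : {set 'I_n}) := \bigcap_i (xi i @^-1` (if i \in J then S else ~` S)).
exists (fun w => \sum_(J : {set 'I_n}) (if (r <= #|J|)%N then \1_(E J) w else 0)).
split.
  rewrite (_ : 2 ^+ n = #|{set 'I_n}|%:R); last first.
    by rewrite -cardsT -powersetT card_powerset cardsT card_ord natrX.
  rewrite mulr_natl -sumr_const.
  apply: mean_le_sum => J.
  have c0 : 0 <= 1 / 4 - eps ^+ 2 by nra.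
  have [rJ|/negbTE rJ] := boolP (r <= #|J|)%N; last first.
    by apply: mean_le_weaken (mean_le_cst _ _) => //; exact: exprn_ge0.
  apply: mean_le_weaken (mean_exact_in J mS pE).
  have Jn : (#|J| <= n)%N by rewrite -[n in leqRHS]card_ord max_card.
  have q0 : 0 <= 1 - p by lra.
  rewrite -(subnKC rJ) exprD.
  (* As p <= 1 - p, the factors p beyond the first r are raised to 1 - p. Of the n - r factors 1 -
     p, r are paired with the remaining p and n - 2r are bounded by 1; finally p (1 - p) <= 1/4 -
     eps^2. *)
  apply: (@le_trans _ _ (p ^+ r * (1 - p) ^+ (#|J| - r) * (1 - p) ^+ (n - (r + (#|J| - r))))).
    rewrite ler_wpM2r ?exprn_ge0// ler_wpM2l ?exprn_ge0// lerXn2r ?nnegrE//; lra.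
  rewrite -mulrA -exprD.
  have -> : (#|J| - r + (n - (r + (#|J| - r))) = r + (n - 2 * r))%N by lia.
  rewrite exprD mulrA -exprMn.
  apply: (@le_trans _ _ ((p * (1 - p)) ^+ r)).
    by rewrite ler_piMr ?exprn_ge0 ?mulr_ge0// exprn_ile1//; lra.
  by rewrite lerXn2r ?nnegrE ?mulr_ge0//; nra.
move=> w rw.
pose J := [set i | `[< S (xi i w) >]]%SET.
have rJ : (r <= #|J|)%N by rewrite (leq_trans rw)// subset_leq_card//; apply/fintype.subsetP => i; rewrite !inE.
rewrite (bigD1 J)//= rJ indicE mem_set.
  by rewrite lerDl sumr_ge0// => K _; case: ifP; rewrite // indicE.
move=> i _ /=; rewrite inE; case: asboolP => //.
Qed.
End counting.

(** * Measurability *)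

Section measurability.
Context {d : measure_display} {T : measurableType d} {R : realType}.

Lemma measurable_le_set (f g : T -> R) : measurable_fun [set: T] f ->
  measurable_fun [set: T] g -> measurable [set w | f w <= g w].
Proof.
by move=> mf mg; rewrite -[X in measurable X]setTI; exact: measurable_fun_le.
Qed.

Lemma measurable_lt_set (f g : T -> R) : measurable_fun [set: T] f ->
  measurable_fun [set: T] g -> measurable [set w | f w < g w].
Proof.
move=> mf mg; rewrite (_ : [set w | _] = ~` [set w | g w <= f w]).
  exact/measurableC/measurable_le_set.
by apply/seteqP; split=> w /=; rewrite ltNge => /negP.
Qed.

Lemma measurable_fun_sublevel_le (f : T -> R) :
  (forall t, measurable [set w | f w <= t]) -> measurable_fun [set: T] f.
Proof.
move=> mf; apply: (measurability _ (RGenOInfty.measurableE R)) => //.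
move=> _ [_ [t ->] <-]; rewrite setTI.
rewrite (_ : _ @^-1` _ = ~` [set w | f w <= t]); first exact: measurableC.
by apply/seteqP; split => w /=; rewrite in_itv/= andbT ltNge => /negP.
Qed.

Lemma measurable_fun_sublevel_lt (f : T -> R) :
  (forall t, measurable [set w | f w < t]) -> measurable_fun [set: T] f.
Proof.
move=> mf; apply: (measurability _ (RGenCInfty.measurableE R)) => //.
move=> _ [_ [t ->] <-]; rewrite setTI.
rewrite (_ : _ @^-1` _ = ~` [set w | f w < t]); first exact: measurableC.
by apply/seteqP; split => w /=; rewrite in_itv/= andbT leNgt => /negP.
Qed.

Context {n : nat} (Y : T -> 'I_n -> R).
Hypothesis mY : forall i, measurable_fun [set: T] (fun w => Y w i).

Lemma measurable_order_stat (j : nat) : (0 < j <= n)%N ->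
  measurable_fun [set: T] (fun w => order_stat (Y w) j).
Proof.
move=> jn; apply: measurable_fun_sublevel_le => t.
rewrite (_ : [set w | _] = \bigcup_(J in [set J : {set 'I_n} | (j <= #|J|)%N])
   \bigcap_(i in [set` J]) [set w | Y w i <= t]).
  apply: fin_bigcup_measurable => // J _; apply: fin_bigcap_measurable => // i _.
  exact: measurable_le_set.
apply/seteqP; split => w /=; rewrite order_stat_le//.
  move=> h; exists [set i | Y w i <= t]%SET; rewrite /= ?cardsE//.
  by move=> i; rewrite /= inE.
move=> [J /= jJ H]; apply: leq_trans jJ _; apply: subset_leq_card.
by apply/fintype.subsetP => i iJ; rewrite inE; exact: H.
Qed.

Lemma measurable_psi_hat q lam (u : T -> R) : measurable_fun [set: T] u ->
  measurable_fun [set: T] (fun w => psi_hat q lam (Y w) (u w)).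
Proof.
move=> mu; apply: measurable_sum => j; apply: measurable_funM => //.
apply: measurable_funM => //; apply: measurable_sum => i.
apply: measurableT_comp => //; apply: measurable_funB => //.
by apply: measurable_funM => //; exact: measurable_funB.
Qed.

Lemma continuous_psi_hat q lam (y : 'I_n -> R) : continuous (psi_hat q lam y).
Proof.
rewrite (_ : psi_hat q lam y = fun u => \sum_(j < q.+1) cheb_coef R q j * eta_hat (j%:R * lam) y u)//.
apply: continuous_big => //= [|j _]; first exact: add_continuous.
move=> u; apply: cvgMr; apply: cvgMr.
move: u; apply: continuous_big => //= [|i _]; first exact: add_continuous.
move=> u; apply: continuous_comp; last exact: continuous_expR.
by apply: cvgB; [apply: cvgMr; apply: cvgB; [exact: cvg_id|exact: cvg_cst]|exact: cvg_cst].
Qed.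

Hypothesis n0 : (0 < n)%N.

(** A genuine infimum is below t exactly when some crossing is. So the matter reduces to the events
    [D t] and to [E], the existence of a crossing. *)
Lemma measurable_theta_hat q : (forall w, has_lbound (crossing q (Y w))) ->
  measurable_fun [set: T] (fun w => theta_hat q (Y w)).
Proof.
move=> lb.
have mup : measurable_fun [set: T] (fun w => theta_up (Y w)).
  by apply: measurable_funD => //; apply: measurable_order_stat; rewrite n0.
have mmed : measurable_fun [set: T] (fun w => theta_med (Y w) - vbar R n).
  apply: measurable_funB => //; apply: measurable_order_stat.
  by rewrite uphalf_gt0 n0 uphalf_half; lia.
pose c : R := 1 + expR (aconst R * q%:R) / Num.sqrt n%:R.
pose psi w u := psi_hat q (lambdaq R q) (Y w) u.
pose fin : bool := q%:R <= 3 / (10 * aconst R) * ln n%:R.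
pose D t := [set w | exists2 u, crossing q (Y w) u & u < t].
(* By continuity of psi, a crossing below t may be taken rational, or equal to the
   left end of the search interval, around which there may be no rational crossing. *)
have mD t : measurable (D t).
  pose Q (r : rat) := [set w | [/\ (fin -> theta_med (Y w) - vbar R n <= ratr r),
    ratr r <= theta_up (Y w), ratr r < t & c < psi w (ratr r)]].
  pose L := [set w | [/\ fin, theta_med (Y w) - vbar R n <= theta_up (Y w),
    theta_med (Y w) - vbar R n < t & c < psi w (theta_med (Y w) - vbar R n)]].
  have DE : D t = \bigcup_(r : rat) Q r `|` L.
    apply/seteqP; split => w.
      move=> [u [lowu uup cu] ut].
      have lowu' : fin -> theta_med (Y w) - vbar R n <= u.
        by move=> f; move: lowu; rewrite /theta_low -/fin f lee_fin.
      have [fu|nfu] := pselect (fin /\ theta_med (Y w) - vbar R n = u).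
        by right; case: fu => f <- in uup cu ut *; split.
      left.
      have [e /= e0 He] := cvgr_gt _ (@continuous_psi_hat q (lambdaq R q) (Y w) u) _ cu.
      pose l := if fin then Num.max (theta_med (Y w) - vbar R n) (u - e) else u - e.
      have lu : l < u.
        rewrite /l; case: ifP => f; last lra.
        rewrite gt_max; apply/andP; split; last lra.
        rewrite lt_neqAle lowu'// andbT; apply/eqP => E; exact: nfu.
      have [r] := rat_in_itvoo lu; rewrite in_itv/= => /andP[lr ru].
      have er : u - e < ratr r.
        apply: le_lt_trans lr; rewrite /l; case: ifP => // _.
        by rewrite le_max lexx orbT.
      exists r => //; split.
      - move=> f; apply/ltW/(le_lt_trans _ lr).
        by rewrite /l f le_max lexx.
      - by apply: le_trans uup; exact: ltW.
      - exact: lt_trans ut.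
      - by apply: He; rewrite /= ltr_norml; lra.
    move=> [[r _ [lr rup rt cr]]|[f lup lt cl]].
      exists (ratr r) => //; split => //.
      by rewrite /theta_low; case: ifP => [f|_]; rewrite ?leNye// lee_fin; exact: lr.
    exists (theta_med (Y w) - vbar R n) => //; split => //.
    by rewrite /theta_low ifT.
  rewrite DE; apply: measurableU.
    apply: bigcupT_measurable_rat => r.
    rewrite (_ : Q r = [set w | fin -> theta_med (Y w) - vbar R n <= ratr r] `&`
      [set w | ratr r <= theta_up (Y w)] `&` [set w | ratr r < t] `&` [set w | c < psi w (ratr r)]).
      apply: measurableI; last by apply: measurable_lt_set => //; exact: measurable_psi_hat.
      apply: measurableI; last exact: measurable_lt_set.
      apply: measurableI; last exact: measurable_le_set.
      have [f|nf] := boolP fin.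
        rewrite (_ : [set w | _] = [set w | theta_med (Y w) - vbar R n <= ratr r]).
          exact: measurable_le_set.
        by apply/seteqP; split => w /= H; [exact: H|].
      rewrite (_ : [set w | _] = setT)//.
      by apply/seteqP; split => w.
    by apply/seteqP; split => [w [? ? ? ?]|w [[[? ?] ?] ?]].
  have [f|nf] := boolP fin; last first.
    rewrite (_ : L = set0)//.
    by apply/seteqP; split => // w [f]; rewrite f in nf.
  rewrite (_ : L = [set w | theta_med (Y w) - vbar R n <= theta_up (Y w)] `&`
    [set w | theta_med (Y w) - vbar R n < t] `&` [set w | c < psi w (theta_med (Y w) - vbar R n)]).
    apply: measurableI; last by apply: measurable_lt_set => //; exact: measurable_psi_hat.
    by apply: measurableI; [exact: measurable_le_set|exact: measurable_lt_set].
  by apply/seteqP; split => [w [? ? ? ?]|w [[? ?] ?]].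
pose E := [set w | crossing q (Y w) !=set0].
have mE : measurable E.
  rewrite (_ : E = \bigcup_k D k%:R); first exact: bigcupT_measurable.
  apply/seteqP; split => [w [u Cu]|w [k _ [u Cu _]]]; last by exists u.
  exists (Num.trunc `|u|).+1 => //; exists u => //.
  by apply: le_lt_trans (ler_norm _) _; exact: truncnS_gt.
apply: measurable_fun_sublevel_lt => t.
rewrite (_ : [set w | _] = D t `|` (~` E `&` [set w | theta_up (Y w) < t])).
  apply: measurableU => //; apply: measurableI; first exact: measurableC.
  exact: measurable_lt_set.
apply/seteqP; split => w /=; rewrite /theta_hat.
  case: asboolP => [C0 /(inf_lt C0)[u Cu ut]|nC]; first by left; exists u.
  by right.
move=> [[u Cu ut]|[nE ut]].
  rewrite asboolT; last by exists u.
  by apply: le_lt_trans ut; exact: ge_inf.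
by rewrite asboolF.
Qed.
End measurability.

(** * Deviation of the sample median *)

Section median.
Context {R : realType} {n : nat}.
Variables (theta v : R) (mu x : 'I_n -> R).
Hypotheses (n0 : (0 < n)%N) (mu0 : forall i, 0 <= mu i).
Let y i := theta + mu i + x i.

(** Contamination only raises observations, so all those at or below the median, at least half, have
    noise below -v. *)
Lemma theta_med_low : theta_med y < theta - v ->
  (n./2 <= #|[pred i | `[< `]-oo, - v[%classic (x i) >]]|)%N.
Proof.
move=> med; have := lexx (theta_med y).
rewrite {1}/theta_med order_stat_le; last first.
  by rewrite uphalf_gt0 n0 uphalf_half; lia.
move=> h; apply: leq_trans (_ : uphalf n <= _)%N.
  by rewrite uphalf_half; lia.
apply: leq_trans h _; apply: subset_leq_card; apply/fintype.subsetP => i.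
rewrite !inE => yi; rewrite /= in_itv/=.
have yi' : theta + mu i + x i <= theta_med y := yi.
by have := mu0 i; lra.
Qed.

Variable k : nat.
Hypothesis muk : (#|[pred i | mu i != 0%R]| <= k)%N.

(** At least half of the observations exceed theta + v and at most k of them are contaminated; the
    others have noise above v. *)
Lemma theta_med_high : theta + v < theta_med y ->
  (n./2 - k <= #|[pred i | `[< `]v, +oo[%classic (x i) >]]|)%N.
Proof.
rewrite ltNge {1}/theta_med order_stat_le; last first.
  by rewrite uphalf_gt0 n0 uphalf_half; lia.
rewrite -ltnNge => h.
set A := [pred i | (y i <= theta + v)%R] in h.
have h2 := muk; set B := [pred i | mu i != 0%R] in h2.
set C := [pred i | `[< _ >]].
have : (n <= #|A| + #|B| + #|C|)%N.
  rewrite -[n in leqLHS]card_ord -addnA.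
  apply: leq_trans (_ : #|[predU A & [predU B & C]]| <= _)%N.
    apply: subset_leq_card; apply/fintype.subsetP => i _; rewrite !inE /=.
    have [//|yi] := leP (y i) (theta + v).
    have [mi|//] := eqVneq (mu i) 0.
    rewrite /= in_itv/= andbT; apply/asboolP.
    by move: yi; rewrite /y mi; lra.
  apply: leq_trans (leq_addr #|[predI A & [predU B & C]]| _) _.
  rewrite cardUI leq_add2l.
  apply: leq_trans (leq_addr #|[predI B & C]| _) _.
  by rewrite cardUI.
by have := uphalf_half n; have := odd_double_half n; lia.
Qed.
End median.

(* In this section [I], [Xhi], [Xlo] stand for dominants of the indicators of: all
   uncontaminated noises are positive, the median is too high, it is too low. *)
Section pathwise.
Context {R : realType} {n : nat}.
Variables (q k : nat) (theta : R) (mu x : 'I_n -> R).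
Hypotheses (n0 : (0 < n)%N) (q0 : (1 < q)%N) (qe : ~~ odd q).
Hypotheses (mu0 : forall i, 0 <= mu i).
Hypothesis muk : (#|[pred i | mu i != 0%R]| <= k)%N.
Hypothesis kn : (0 < k < n)%N.
Let y i := theta + mu i + x i.
Let lam := lambdaq R q.
Let N := noise_norm q lam mu x.
Let B : R := slack n q.
Let kap : R := k%:R / n%:R.
Let b : R := 2 * Num.sqrt (ln n%:R).
Let W := lower_excess b x.
Let V := N ^+ 2 / B ^+ 2.
Hypotheses (Bkap : B <= kap) (b1 : 1 <= b).

Variables (i0 : 'I_n) (eps I Xhi Xlo eta L : R).
Hypotheses (mui0 : mu i0 = 0) (eps0 : 0 < eps) (I0 : 0 <= I).
Hypothesis HI : (forall i, mu i = 0 -> 0 < x i) -> 1 <= I.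
Hypotheses (Xhi0 : 0 <= Xhi) (Xlo0 : 0 <= Xlo) (eta0 : 0 < eta).
Hypothesis low_or_Xhi : (theta_low q y <= theta%:E)%E \/ 1 <= Xhi.
Hypothesis eL : expR L = 1 + Num.sqrt (k%:R / (n%:R - k%:R)).
Hypothesis Lq : L <= 3 / 8 * q%:R.

Let q1 : (0 < q)%N. Proof. exact: ltnW. Qed.
Let lam0 : 0 < lam. Proof. exact: lambdaq_gt0. Qed.
Let B0 : 0 < B. Proof. exact: slack_gt0. Qed.
Let N0 : 0 <= N. Proof. exact: noise_norm_ge0. Qed.
Let V0 : 0 <= V. Proof. by rewrite divr_ge0 ?sqr_ge0. Qed.
Let W0 : 0 <= W. Proof. by apply: sumr_ge0 => ? _; exact: expR_ge0. Qed.
Let lb : has_lbound (crossing q y). Proof. exact: has_lbound_crossing. Qed.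

(** Chebyshev's inequality before taking means: the indicator of N >= B/c is at most c^2 V. *)
Let VN (c : R) : 0 < c -> B / c <= N -> 1 <= c ^+ 2 * V.
Proof.
move=> c0 BN; have B0' := B0.
rewrite /V mulrA -exprMn -expr_div_n -[leLHS](expr1n _ 2).
by rewrite lerXn2r ?nnegrE ?divr_ge0 ?mulr_ge0 ?(ltW B0) ?(ltW c0)// ler_pdivlMr// mul1r mulrC -ler_pdivrMr.
Qed.

Let up_le : theta_hat q y - theta <= b + eps * expR (2 * x i0) + eps^-1 * I.
Proof.
apply: le_trans (theta_up_le_indic theta mui0 eps0 I0 HI).
by rewrite lerD2r; exact: theta_hat_le_up.
Qed.

(** An exit on the left means that [theta_up] is below [theta], paid by W, or that some crossing is,
    paid by V. An exit on the right requires N > B/8, paid by 64 V, or a search interval starting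
    beyond [theta], paid by [Xhi]. *)
Lemma theta_hat_outside :
  theta_hat q y < theta \/ theta + 5 * L ^+ 2 / (q%:R ^+ 2 * lam) < theta_hat q y ->
  1 <= 64 * V + W + Xhi.
Proof.
have [V0' W0' Xhi0'] := And3 V0 W0 Xhi0.
move=> [lt|gt].
  have [ut|tu] := ltP (theta_up y) theta.
    by have : 1 <= W := theta_up_lt n0 mu0 b1 ut; lra.
  suff : 1 <= 1 ^+ 2 * V by lra.
  apply: VN => //; rewrite divr1.
  have [[u [Cu ut]]|nex] := pselect (exists u, crossing q y u /\ u <= theta).
    exact: crossing_noise Cu ut.
  exfalso; move: lt; apply/negP; rewrite -leNgt; apply: theta_hat_ge => // u Cu.
  by rewrite leNgt; apply/negP => /ltW ut; apply: nex; exists u.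
case: low_or_Xhi => [low|]; last lra.
suff : 1 <= 8 ^+ 2 * V by lra.
apply: VN => //; rewrite leNgt; apply/negP => /ltW NB; move: gt; apply/negP.
rewrite -leNgt; apply: (theta_hat_above_log _ _ _ _ muk _ _ _ Lq NB low) => //.
Qed.

Lemma theta_hat_dist_free : theta_low q y = -oo%E ->
  `|theta_hat q y - theta| <=
  5 * L ^+ 2 / (q%:R ^+ 2 * lam) + b * (64 * V) + eps * expR (2 * x i0) +
  eps^-1 * I + V / (2 * lam) + W.
Proof.
move=> low; have [V0' W0' b1'] := And3 V0 W0 b1.
set z := 5 * L ^+ 2 / _.
have z0 : 0 <= z.
  rewrite /z divr_ge0//; first by rewrite mulr_ge0// sqr_ge0.
  by rewrite mulr_ge0 ?sqr_ge0 ?(ltW lam0).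
have e0 : 0 <= eps * expR (2 * x i0) by rewrite mulr_ge0 ?expR_ge0 ?ltW.
have i00 : 0 <= eps^-1 * I by rewrite mulr_ge0// invr_ge0 ltW.
have bV : 0 <= b * (64 * V) by rewrite mulr_ge0//; lra.
have Vl : 0 <= V / (2 * lam) by rewrite divr_ge0// mulr_ge0 ?(ltW lam0).
rewrite ler_norml; apply/andP; split; last first.
  have [NB|NB] := leP N (B / 8).
    have : theta_hat q y <= theta + z.
      by apply: (theta_hat_above_log _ _ _ _ muk _ _ _ Lq NB _) => //; rewrite low leNye.
    lra.
  have V1 : 1 <= 8 ^+ 2 * V by apply: VN => //; exact: ltW.
  have : b <= b * (64 * V) by rewrite ler_peMr//; lra.
  by have := up_le; lra.
suff : theta - (V / (2 * lam) + W) <= theta_hat q y by lra.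
apply: theta_hat_ge.
  move=> u Cu; have [ut|/ltW] := leP u theta; last lra.
  suff : theta - u <= V / (2 * lam) by lra.
  have := crossing_le n0 q1 qe mu0 Cu ut; rewrite -/lam -/N -/B => H.
  rewrite ler_pdivlMr ?mulr_gt0//.
  have -> : (theta - u) * (2 * lam) = 2 * (lam * (theta - u)) by ring.
  (* Squaring e^{lam (theta - u)} <= N/B before linearising replaces N/B, of mean at most
     e^{-2aq/3}, by its square, of mean at most e^{-4aq/3}. *)
  apply: (@le_trans _ _ (expR (2 * (lam * (theta - u))))).
    by apply: le_trans (expR_ge1Dx _); rewrite lerDr.
  rewrite expRM_natl /V -expr_div_n lerXn2r ?nnegrE ?expR_ge0 ?divr_ge0 ?(ltW B0)//.
  by rewrite ler_pdivlMr// mulrC.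
by have := theta_up_ge theta x n0 mu0 b1; rewrite -/y -/b -/W; lra.
Qed.

Variable v : R.
Hypothesis v0 : 0 <= v.
Hypothesis lowE : theta_low q y = (theta_med y - v)%:E.
Hypothesis Hlo : theta_med y < theta - v / 4 -> 1 <= Xlo.
Hypothesis Hhi : theta + v / 4 < theta_med y -> 1 <= Xhi.
Hypothesis vq : 5 * q%:R ^+ 2 * lam * v <= 1.
Hypothesis kap2 : kap <= 1 / 2.

(** Here k/n may be far below the mean of V, so V may occur only with a small factor. On the right
    the bad event is N >= 1/8 rather than N >= B/8, which costs 64 N^2. On the left [crossing_near]
    applies once the median is good; otherwise V appears times eta, against eta^-1 [Xlo]. *)
Lemma theta_hat_dist_med :
  `|theta_hat q y - theta| <=
  (3 * kap + 4 * N) / (q%:R ^+ 2 * lam) + b * (64 * N ^+ 2 + Xhi) +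
  eps * expR (2 * x i0) + eps^-1 * I + N ^+ 2 / B / (q%:R ^+ 2 * lam) +
  (eta * V + eta^-1 * Xlo) / lam + W.
Proof.
have [V0' W0' b1'] := And3 V0 W0 b1; have [N0' Xhi0' Xlo0'] := And3 N0 Xhi0 Xlo0.
have [v0' kap2'] := conj v0 kap2.
have kap0 : 0 <= kap by rewrite divr_ge0.
have q2l : 0 < q%:R ^+ 2 * lam by rewrite mulr_gt0// exprn_gt0// ltr0n.
set z := (3 * kap + 4 * N) / _.
have z0 : 0 <= z by rewrite /z divr_ge0 ?(ltW q2l)//; lra.
have e0 : 0 <= eps * expR (2 * x i0) by rewrite mulr_ge0 ?expR_ge0 ?ltW.
have i00 : 0 <= eps^-1 * I by rewrite mulr_ge0// invr_ge0 ltW.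
have N2 := sqr_ge0 N.
have bV : 0 <= b * (64 * N ^+ 2 + Xhi) by rewrite mulr_ge0//; lra.
have NB0 : 0 <= N ^+ 2 / B / (q%:R ^+ 2 * lam) by rewrite !divr_ge0 ?(ltW q2l) ?(ltW B0).
have ei : 0 <= eta^-1 * Xlo by rewrite mulr_ge0// invr_ge0 ltW.
have eV : 0 <= eta * V by rewrite mulr_ge0 ?V0 ?(ltW eta0).
have Vl : 0 <= (eta * V + eta^-1 * Xlo) / lam by rewrite divr_ge0 ?(ltW lam0)// addr_ge0.
rewrite ler_norml; apply/andP; split; last first.
  have : theta_hat q y - theta <= z \/ 1 <= 64 * N ^+ 2 + Xhi.
    have [/Hhi X1|med] := ltP (theta + v / 4) (theta_med y); first by right; lra.
    have low : (theta_low q y <= theta%:E)%E by rewrite lowE lee_fin; lra.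
    have [h|h] := theta_hat_above_linear n0 q0 qe mu0 muk Bkap kap2 low.
      by left; rewrite /z ler_pdivlMr// mulrC.
    by right; rewrite -/lam -/N in h; nra.
  move=> [h|h]; first lra.
  have : b <= b * (64 * N ^+ 2 + Xhi) by rewrite ler_peMr//; lra.
  by have := up_le; lra.
suff : theta - (N ^+ 2 / B / (q%:R ^+ 2 * lam) + (eta * V + eta^-1 * Xlo) / lam + W) <=
  theta_hat q y by lra.
apply: theta_hat_ge; last first.
  by have := theta_up_ge theta x n0 mu0 b1; rewrite -/y -/b -/W; lra.
move=> u Cu; have [ut|/ltW] := leP u theta; last lra.
have [/Hlo X1|med] := ltP (theta_med y) (theta - v / 4).
  suff : theta - u <= (eta * V + eta^-1 * Xlo) / lam by lra.
  rewrite ler_pdivlMr// mulrC.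
  apply: le_trans (crossing_dist n0 q1 qe mu0 Cu) _; rewrite -/lam -/N -/B.
  apply: (@le_trans _ _ (eta * V + eta^-1)).
    rewrite /V -expr_div_n; set r := N / B.
    have -> : eta * r ^+ 2 + eta^-1 = eta^-1 * ((eta * r) ^+ 2 + 1) by field; rewrite gt_eqF.
    rewrite [leLHS](_ : r = eta^-1 * (eta * r)); last by field; rewrite gt_eqF.
    by rewrite ler_wpM2l ?invr_ge0 ?ltW//; have := sqr_ge0 (eta * r - 1 / 2); nra.
  by rewrite lerD2l ler_peMr// invr_ge0 ltW.
suff : theta - u <= N ^+ 2 / B / (q%:R ^+ 2 * lam) by lra.
rewrite ler_pdivlMr// mulrC -mulrA.
apply: (crossing_near n0 q0 qe mu0 muk) => //; rewrite -/lam.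
(* theta - u is at most v + v/4, hence 4 (theta - u) <= 5v; this is the 5 in [vq]. *)
apply: le_trans vq.
have [lowu _ _] := Cu; move: lowu; rewrite lowE lee_fin => lowu.
have -> : 4 * q%:R ^+ 2 * (lam * (theta - u)) = q%:R ^+ 2 * lam * (4 * (theta - u)) by ring.
have -> : 5 * q%:R ^+ 2 * lam * v = q%:R ^+ 2 * lam * (5 * v) by ring.
by rewrite ler_wpM2l ?(ltW q2l)//; lra.
Qed.

End pathwise.

Lemma le2_mul2z (f : int) : (2 <= 2 * f) = (1 <= f).
Proof. by lia. Qed.

Lemma absz_gt1 (f : int) : 2 <= f -> (1 < `|f|)%N /\ 0 <= f.
Proof. by lia. Qed.

(** * Asymptotics *)

Section numerics.
Context {R : realType}.
Local Notation a := (aconst R).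

Lemma poly_le_expR (A s : R) (p : nat) : 0 < s ->
  exists l0 : R, forall l, l0 <= l -> A * l ^+ p <= expR (s * l).
Proof.
move=> s0; pose t := s / p.+1%:R.
have t0 : 0 < t by rewrite divr_gt0// ltr0n.
exists (Num.max 0 (A / t ^+ p.+1)) => l; rewrite ge_max => /andP[l0 Al].
have tl : 0 <= t * l by rewrite mulr_ge0// ltW.
apply: (@le_trans _ _ ((t * l) ^+ p.+1)).
  have -> : (t * l) ^+ p.+1 = (t ^+ p.+1 * l) * l ^+ p.
    by rewrite exprMn [l ^+ p.+1]exprS mulrA.
  rewrite ler_wpM2r ?exprn_ge0//.
  by rewrite mulrC -ler_pdivrMr// exprn_gt0.
have -> : s * l = p.+1%:R * (t * l) by rewrite /t mulrA [p.+1%:R * _]mulrC divfK ?pnatr_eq0.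
rewrite expRM_natl lerXn2r ?nnegrE ?expR_ge0//.
by apply: le_trans (expR_ge1Dx _); rewrite lerDr.
Qed.

Lemma aconst_ge6 : 6 <= a.
Proof.
have s0 : 0 <= Num.sqrt 2 :> R by rewrite sqrtr_ge0.
have s1 : 1 <= Num.sqrt 2 :> R by rewrite -[leLHS]sqrtr1 ler_wsqrtr// ler1n.
suff : 1 <= ln (3 + 2 * Num.sqrt 2) :> R by rewrite /aconst; lra.
have p3 : 0 < 3 + 2 * Num.sqrt 2 :> R by lra.
rewrite -[leLHS]expRK ler_ln ?posrE ?expR_gt0//.
apply: (@le_trans _ _ 4); last lra.
rewrite [X in expR X](_ : 1 = 2 * (1 / 2)); last by field.
rewrite expRM_natl (_ : 4 = 2 ^+ 2); last by ring.
rewrite lerXn2r ?nnegrE ?expR_ge0//.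
have := expR_ge1Dx (- (1 / 2) : R); rewrite expRN => H2.
have H3 : (2^-1 : R) <= (expR (1 / 2))^-1 by lra.
by rewrite -lef_pV2 ?posrE ?expR_gt0.
Qed.

Lemma floor_even_le (x : R) : (floor_even x)%:~R <= x.
Proof.
have := ge_floor (x / 2); rewrite /floor_even intrM /=.
by rewrite (_ : 2%:~R = 2 :> R)//; lra.
Qed.

Lemma floor_even_gt (x : R) : x - 2 < (floor_even x)%:~R.
Proof.
have := lt_succ_floor (x / 2); rewrite /floor_even intrM intrD /=.
by rewrite (_ : 2%:~R = 2 :> R)//; lra.
Qed.

(** Turns the integer definitions into real inequalities. The bounds on ell and l keep both
    candidates at least 2, so the absolute value is harmless. The loss 4 for [qmax] is 2 from even
    rounding and 2 from its definition. *)
Lemma qsel_spec (n k : nat) (l ell : R) : l = ln n%:R ->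
  ell = ln (k%:R / Num.sqrt n%:R) -> 2 * a <= ell -> 24 * a <= l ->
  exists q : nat, [/\ `|qsel R n k|%N = q, (1 < q)%N, ~~ odd q,
    a * q%:R <= ell & [/\ q%:R <= (qmax R n)%:~R :> R,
      (qmax R n)%:~R <= l / (2 * a), l / (2 * a) - 4 < (qmax R n)%:~R &
      ell / a - 2 < q%:R \/ q%:R = (qmax R n)%:~R :> R]].
Proof.
move=> lE ellE ell2 l24.
have a6 := aconst_ge6.
have a0 : 0 < a by lra.
set Q := qmax R n.
have QE : Q%:~R = (floor_even (l / (2 * a)))%:~R - 2 :> R.
  by rewrite /Q /qmax -lE intrD rmorphN.
have fl := floor_even_le (l / (2 * a)); have fg := floor_even_gt (l / (2 * a)).
have el := floor_even_le (ell / a); have eg := floor_even_gt (ell / a).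
have la : 12 <= l / (2 * a) by rewrite ler_pdivlMr; lra.
have ea : 2 <= ell / a by rewrite ler_pdivlMr.
have ev1 : exists z : int, qsel R n k = 2 * z.
  rewrite /qsel; case: leP => _; first by exists (Num.floor (ln (k%:R / Num.sqrt n%:R) / a / 2)).
  exists (Num.floor (ln n%:R / (2 * a) / 2) - 1).
  by rewrite /qmax /floor_even mulrBr.
have [z zE] := ev1.
have spec : (qsel R n k)%:~R <= ell / a /\ (qsel R n k)%:~R <= Q%:~R :> R /\
   (ell / a - 2 < (qsel R n k)%:~R \/ (qsel R n k)%:~R = Q%:~R :> R).
  rewrite /qsel -ellE -/Q; case: (leP (floor_even (ell / a)) Q) => h.
    by split => //; split; [rewrite ler_int|left].
  split; last by split => //; right.
  by apply: le_trans el; rewrite ler_int ltW.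
have fe : 2 <= floor_even (ell / a).
  rewrite /floor_even le2_mul2z floor_ge_int /= (_ : 1%:~R = 1 :> R)//.
  by rewrite ler_pdivlMr; lra.
have Q2 : 2 <= Q.
  by rewrite -(ler_int R) QE; lra.
have qs2 : 2 <= qsel R n k by rewrite /qsel -ellE -/Q; case: (leP (floor_even (ell / a)) Q).
have [qs1 qs0] := absz_gt1 qs2.
have qN : (`|qsel R n k|%N)%:R = (qsel R n k)%:~R :> R.
  by rewrite -[LHS]/((`|qsel R n k|%N : int)%:~R) gez0_abs.
exists `|qsel R n k|%N; rewrite qN; case: spec => [s1 [s2 s3]].
split => //.
- by rewrite zE abszM oddM.
- by rewrite mulrC -ler_pdivlMr.
split => //; rewrite QE; lra.
Qed.
End numerics.

(** * Logarithmic scales of n, k and the slack *)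

Section scale.
Context {R : realType} (n k : nat).
Hypotheses (n0 : (0 < n)%N) (k0 : (0 < k)%N).
Local Notation a := (aconst R).
Let l : R := ln n%:R.
Let ell : R := ln (k%:R / Num.sqrt n%:R).

Lemma natr_expR : n%:R = expR l.
Proof. by rewrite lnK// posrE ltr0n. Qed.

Lemma sqrt_natr_expR : Num.sqrt n%:R = expR (l / 2).
Proof.
rewrite natr_expR (_ : l = 2 * (l / 2)); last by field.
rewrite expRM_natl sqrtr_sqr ger0_norm ?expR_ge0//.
by congr expR; field.
Qed.

Lemma sparsity_expR : k%:R = expR (ell + l / 2).
Proof.
rewrite expRD -sqrt_natr_expR lnK ?divfK//.
  by rewrite gt_eqF// sqrtr_gt0 ltr0n.
by rewrite posrE divr_gt0// ?sqrtr_gt0 ltr0n.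
Qed.

Lemma ratio_expR : k%:R / n%:R = expR (ell - l / 2).
Proof.
by rewrite sparsity_expR [X in _ / X]natr_expR -expRB; congr expR; lra.
Qed.

Lemma slack_expR q : slack n q = expR (a * q%:R - l / 2).
Proof. by rewrite /slack sqrt_natr_expR -expRN -expRD. Qed.

Lemma powR_expR s : n%:R `^ s = expR (s * l).
Proof. by rewrite /powR gt_eqF// ltr0n. Qed.

(** If rho <= 1, the logarithm is at most log 2 <= 3/4. Otherwise the upper limit on k gives 64 rho
    <= n^{1/(4a)}, so the logarithm is at most u = l/(8a); moreover k >= n/2, so ell is close to l/2
    and q is at least 4u - 4. *)
Lemma ln_ratio_bound q (Q : R) : (k < n)%N ->
  k%:R < n%:R - 64 * (n%:R `^ (1 - 1 / (4 * a))) -> 24 * a <= l -> (1 < q)%N ->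
  l / (2 * a) - 4 < Q -> ell / a - 2 < q%:R \/ q%:R = Q ->
  ln (1 + Num.sqrt (k%:R / (n%:R - k%:R))) <= 3 / 8 * q%:R :> R.
Proof.
move=> kn kbig l24 q1 Ql qQ.
have a6 := aconst_ge6 (R := R).
have a0 : 0 < a by lra.
have qR : 2 <= q%:R :> R by rewrite (ler_nat _ 2).
have kR : 0 < k%:R :> R by rewrite ltr0n.
have nk : 0 < n%:R - k%:R :> R by rewrite subr_gt0 ltr_nat.
set rho := k%:R / (n%:R - k%:R).
have rho0 : 0 < rho by rewrite divr_gt0.
have sr0 : 0 < Num.sqrt rho by rewrite sqrtr_gt0.
have e34 : 2 <= expR (3 / 4) :> R.
  rewrite (_ : 3 / 4 = 8 * (3 / 32)); last by field.
  rewrite expRM_natl; apply: (@le_trans _ _ ((1 + 3 / 32) ^+ 8)); first lra.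
  by rewrite lerXn2r ?nnegrE ?expR_ge0 ?expR_ge1Dx//; lra.
rewrite -ler_expR lnK ?posrE; last lra.
have [rho1|rho1] := leP rho 1.
  apply: (@le_trans _ _ (expR (3 / 4))); last by rewrite ler_expR; lra.
  apply: le_trans e34.
  have : Num.sqrt rho <= 1 by rewrite -[leRHS]sqrtr1 ler_wsqrtr.
  lra.
have lhs : 1 + Num.sqrt rho <= expR (l / (8 * a)).
  have rhob : 64 * rho <= expR (l / (4 * a)).
    rewrite /rho mulrA ler_pdivrMr// mulrC.
    move: kbig; rewrite powR_expR => kbig.
    have e : expR (l / (4 * a)) * expR ((1 - 1 / (4 * a)) * l) = n%:R.
      rewrite -expRD natr_expR; congr expR; field; lra.
    apply: (@le_trans _ _ (expR (l / (4 * a)) * (64 * expR ((1 - 1 / (4 * a)) * l)))).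
      rewrite mulrCA e mulrC ler_wpM2l// ler_nat ltnW//.
    by rewrite ler_wpM2l ?expR_ge0//; lra.
  have : Num.sqrt (64 * rho) <= expR (l / (8 * a)).
    rewrite -(@ler_pXn2r _ 2)// ?nnegrE ?expR_ge0 ?sqrtr_ge0//.
    rewrite sqr_sqrtr; last by rewrite mulr_ge0// ltW.
    rewrite -expRM_natl; suff -> : 2 * (l / (8 * a)) = l / (4 * a) by [].
    by field; lra.
  rewrite sqrtrM// (_ : Num.sqrt 64 = 8); last first.
    by rewrite (_ : 64 = 8 ^+ 2) ?sqrtr_sqr ?ger0_norm//; ring.
  have : 1 <= Num.sqrt rho by rewrite -[leLHS]sqrtr1 ler_wsqrtr// ltW.
  lra.
apply: le_trans lhs _; rewrite ler_expR.
have ellb : l / 2 - 1 <= ell.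
  have k2 : n%:R <= 2 * k%:R :> R.
    by move: rho1; rewrite /rho ltr_pdivlMr//; lra.
  have e1 : 2 <= expR 1 :> R by have := expR_ge1Dx (1 : R); lra.
  have : expR (l / 2 - 1 + l / 2) <= expR (ell + l / 2).
    rewrite -sparsity_expR (_ : l / 2 - 1 + l / 2 = l - 1); last by field.
    rewrite expRB -natr_expR ler_pdivrMr ?expR_gt0// (le_trans k2)// mulrC.
    by rewrite ler_wpM2l// ltW.
  by rewrite ler_expR; lra.
have ea : l / (2 * a) - 1 / a <= ell / a.
  have -> : l / (2 * a) - 1 / a = (l / 2 - 1) / a by field; lra.
  by rewrite ler_pM2r ?invr_gt0.
have ia : 1 / a <= 1 by rewrite ler_pdivrMr; lra.
have qb : l / (2 * a) - 4 <= q%:R by case: qQ => [h|->]; lra.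
set u := l / (8 * a).
have uE : l / (2 * a) = 4 * u by rewrite /u; field; lra.
(* 3/8 (4u - 4) >= u holds exactly for u >= 3, which is the origin of 24 a <= l. *)
have u3 : 3 <= u by rewrite /u ler_pdivlMr; lra.
rewrite uE in qb; lra.
Qed.
End scale.

Lemma double_half_sub_le (n k : nat) : (2 * (n./2 - k) <= n)%N.
Proof. by have := odd_double_half n; lia. Qed.

Lemma normal_prob_pos {R : realType} : exists p : R,
  0 <= p <= 1 / 2 /\ normal_prob 0 1 `]0, +oo[%classic = p%:E.
Proof.
have [p [/andP[p0 p1] pE _]] := @normal_prob_tail R 0 ltac:(lra).
by exists p; split => //; apply/andP; split => //; lra.
Qed.

(** * Probability and risk bounds *)

Section risk.
Context {d : measure_display} {T : measurableType d} {R : realType}.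
Variables (P : probability T R) (n k q : nat) (xi : 'I_n -> {RV P >-> R}).
Variables (theta : R) (mu : 'I_n -> R).
Hypothesis iid : iid_standard_normal xi.
Hypotheses (mu0 : forall i, 0 <= mu i).
Hypothesis muk : (#|[pred i | mu i != 0%R]| <= k)%N.
Hypothesis kn : (0 < k < n)%N.
Hypotheses (q0 : (1 < q)%N) (qe : ~~ odd q).
Let lam : R := lambdaq R q.
Let B : R := slack n q.
Let kap : R := k%:R / n%:R.
Let b : R := 2 * Num.sqrt (ln n%:R).
Let L : R := ln (1 + Num.sqrt (k%:R / (n%:R - k%:R))).
Let z := 5 * L ^+ 2 / (q%:R ^+ 2 * lam).
(** [vr] bounds the mean of (N/B)^2, and [sig2] that of N^2. *)
Let vr : R := expR (- (4 / 3) * (aconst R * q%:R)).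
Let sig2 : R := expR (2 / 3 * (aconst R * q%:R)) / n%:R.
Let est w := theta_hat q (sample theta mu xi w).
Hypotheses (Bkap : B <= kap) (b1 : 1 <= b) (Lq : L <= 3 / 8 * q%:R).

Let n0 : (0 < n)%N. Proof. by case/andP: kn => _; exact: leq_trans. Qed.
Let q1 : (0 < q)%N. Proof. exact: ltnW. Qed.
Let nn : 0 < n%:R :> R. Proof. by rewrite ltr0n. Qed.
Let B0 : 0 < B. Proof. exact: slack_gt0. Qed.
Let lam0 : 0 < lam. Proof. exact: lambdaq_gt0. Qed.

Let eL : expR L = 1 + Num.sqrt (k%:R / (n%:R - k%:R)).
Proof.
rewrite lnK// posrE; have := sqrtr_ge0 (k%:R / (n%:R - k%:R) : R); lra.
Qed.

Let N w := noise_norm q lam mu (xi^~ w).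

Let mean_N2 : mean_le P (fun w => N w ^+ 2) sig2.
Proof.
apply: mean_le_weaken (mean_noise_norm_sqr iid n0 mu0 q1).
rewrite /sig2 -expRM_natl le_eqVlt; apply/orP; left; apply/eqP.
by congr (expR _ / _); field.
Qed.

Let mean_V : mean_le P (fun w => N w ^+ 2 / B ^+ 2) vr.
Proof.
rewrite (_ : (fun w => _) = fun w => (B ^+ 2)^-1 * N w ^+ 2); last first.
  by apply/funext => w; rewrite mulrC.
apply: (@mean_le_weaken _ _ _ _ _ ((B ^+ 2)^-1 * sig2)); last first.
  by apply: mean_leZ => //; rewrite invr_ge0 sqr_ge0.
rewrite /B (slack_expR n0) /sig2 {2}(natr_expR n0) -expRB -expRM_natl -expRN -expRD.
by rewrite ler_expR le_eqVlt; apply/orP; left; apply/eqP; field.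
Qed.

Let J : {set 'I_n} := [set i | mu i == 0]%SET.

Let cardJ : (n - k <= #|J|)%N.
Proof.
have c := cardsC J; rewrite card_ord in c.
have : (#|~: J|%SET <= k)%N.
  apply: leq_trans muk; rewrite cardE cardE; apply: eq_leq; congr size.
  by apply: eq_enum => i; rewrite !inE.
by lia.
Qed.

Let I w := \1_(\bigcap_(i in [set` J]) (xi i @^-1` `]0, +oo[%classic)) w : R.

Let mean_I : mean_le P I (2 ^- (n - k)).
Proof.
have [p [/andP[p0 p1] pE]] := @normal_prob_pos R.
apply: mean_le_weaken (mean_all_in iid J (measurable_itv _) pE).
apply: (@le_trans _ _ ((1 / 2) ^+ #|J|)).
  by rewrite lerXn2r ?nnegrE//; lra.
rewrite div1r -exprVn -(subnKC cardJ) exprD ler_piMr ?exprn_ge0//.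
by rewrite exprn_ile1//; lra.
Qed.

Let I0 w : 0 <= I w. Proof. by rewrite /I indicE. Qed.
Let HI w : (forall i, mu i = 0 -> 0 < xi i w) -> 1 <= I w.
Proof.
move=> H; rewrite /I indicE mem_set// => i /=; rewrite inE => /eqP mi.
by rewrite in_itv/= andbT; exact: H.
Qed.

Let exi0 : exists i, mu i = 0.
Proof.
have : (0 < #|J|)%N by move: cardJ; case/andP: kn; lia.
by rewrite card_gt0 => /set0Pn[i]; rewrite inE => /eqP; exists i.
Qed.

Let mean_W : mean_le P (fun w => lower_excess b (xi^~ w)) n%:R^-1.
Proof. exact: mean_lower_excess. Qed.

Let mean_e2 i : mean_le P (fun w => expR (2 * xi i w)) 16.
Proof.
apply: mean_le_weaken (mean_eq_le (mean_expR iid i 2)).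
rewrite (_ : 2 ^+ 2 / 2 = 4 * (1 / 2)); last by field.
rewrite expRM_natl (_ : 16 = 2 ^+ 4); last by ring.
rewrite lerXn2r ?nnegrE ?expR_ge0//.
have := expR_ge1Dx (- (1 / 2) : R); rewrite expRN => H2.
have H3 : (2^-1 : R) <= (expR (1 / 2))^-1 by lra.
by rewrite -lef_pV2 ?posrE ?expR_gt0.
Qed.

Lemma measurable_est : measurable_fun [set: T] est.
Proof.
apply: measurable_theta_hat => // [i|w].
  by rewrite /sample; exact: measurable_funD.
exact: (has_lbound_crossing theta (xi^~ w) n0 q1 qe mu0).
Qed.

Let mabs : measurable_fun [set: T] (fun w => `|est w - theta|).
Proof.
apply: measurableT_comp => //; apply: measurable_funB => //.
exact: measurable_est.
Qed.

Lemma prob_outside (c r : R) (F : T -> R) : mean_le P F r ->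
  (forall w, est w < theta \/ theta + c < est w -> 1 <= F w) ->
  (P [set w | est w \notin `[theta, (theta + c)%R]%R] <= r%:E)%E.
Proof.
move=> HF H.
have mest := measurable_est.
have mA : measurable [set w | est w \notin `[theta, (theta + c)%R]].
  rewrite (_ : [set w | _] = [set w | est w < theta] `|` [set w | theta + c < est w]).
    by apply: measurableU; exact: measurable_lt_set.
  apply/seteqP; split => w /=; rewrite in_itv/= negb_and -!ltNge.
    by move=> /orP.
  by move=> ?; apply/orP.
have := mean_le_markov HF (@ltr01 R); rewrite divr1; apply: le_trans.
have [mF _ _] := HF.
apply: le_measure; rewrite ?inE//; first exact: measurable_le_set.
move=> w /=; rewrite in_itv/= negb_and -!ltNge => /orP h; exact: H.
Qed.

(** * Large degree: search interval unbounded below *)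

Section free.
Hypothesis big_q : ~~ (q%:R <= 3 / (10 * aconst R) * ln n%:R).

Let lowE w : theta_low q (sample theta mu xi w) = -oo%E.
Proof. by rewrite /theta_low ifN. Qed.

Lemma prob_free c : z <= c -> (P [set w | est w \notin `[theta, (theta + c)%R]%R] <=
  (64 * vr + n%:R^-1)%:E)%E.
Proof.
move=> zc; apply: (@prob_outside _ _ (fun w => 64 * (N w ^+ 2 / B ^+ 2) + lower_excess b (xi^~ w))).
  by apply: mean_leD => //; exact: mean_leZ.
move=> w h; rewrite -[leRHS]addr0.
have {}h : est w < theta \/ theta + z < est w.
  by case: h => h; [left|right; apply: le_lt_trans h; rewrite lerD2l].
apply: (theta_hat_outside n0 q0 qe mu0 muk kn Bkap b1 _ _ eL Lq h) => //.
by left; rewrite lowE leNye.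
Qed.

Lemma mean_free : mean_le P (fun w => `|est w - theta|)
  (z + b * (64 * vr) + n%:R^-1 * 16 + n%:R * 2 ^- (n - k) + vr / (2 * lam) + n%:R^-1).
Proof.
have [i0 mui0] := exi0.
apply: (@mean_le_mono _ _ _ _ _ (fun w => z + b * (64 * (N w ^+ 2 / B ^+ 2)) +
  n%:R^-1 * expR (2 * xi i0 w) + n%:R * I w + (2 * lam)^-1 * (N w ^+ 2 / B ^+ 2) +
  lower_excess b (xi^~ w))) => //.
  (* The choice eps = 1/n: the two halves of the split have means at most 16/n and n 2^{-(n-k)}. *)
  move=> w; rewrite -[X in _ + X * I w]invrK [(2 * lam)^-1 * _]mulrC.
  have ni : 0 < n%:R^-1 :> R by rewrite invr_gt0.
  exact: (theta_hat_dist_free n0 q0 qe mu0 muk kn Bkap b1 mui0 ni (I0 w) (@HI w) eL Lq (lowE w)).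
have z0 : 0 <= z.
  rewrite /z divr_ge0//; first by rewrite mulr_ge0// sqr_ge0.
  by rewrite mulr_ge0 ?sqr_ge0 ?(ltW lam0).
have b0 : 0 <= b by apply: le_trans b1.
have l0 : 0 <= (2 * lam)^-1 by rewrite invr_ge0 mulr_ge0// ltW.
rewrite [vr / _]mulrC.
have ni : 0 <= n%:R^-1 :> R by rewrite invr_ge0 ltW.
apply: mean_leD mean_W; apply: mean_leD (mean_leZ l0 mean_V).
apply: mean_leD (mean_leZ (ltW nn) mean_I).
apply: mean_leD (mean_leZ ni (mean_e2 i0)).
by apply: mean_leD (mean_le_cst _ z0) (mean_leZ b0 (mean_leZ _ mean_V)).
Qed.
End free.

(** * Small degree: search interval bounded below by the median *)

Section med.
Hypothesis small_q : q%:R <= 3 / (10 * aconst R) * ln n%:R.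
Let v := vbar R n.
Hypothesis v01 : 0 <= v <= 1.
Hypothesis vq : 5 * q%:R ^+ 2 * lam * v <= 1.
Hypothesis kap2 : kap <= 1 / 2.
Let delta : R := 2 ^+ n * (1 / 4 - (v / 24) ^+ 2) ^+ (n./2 - k).

Let lowE w : theta_low q (sample theta mu xi w) = (theta_med (sample theta mu xi w) - v)%:E.
Proof. by rewrite /theta_low ifT. Qed.

Let med_events : exists Xlo Xhi : T -> R, [/\ mean_le P Xlo delta, mean_le P Xhi delta,
  forall w, theta_med (sample theta mu xi w) < theta - v / 4 -> 1 <= Xlo w &
  forall w, theta + v / 4 < theta_med (sample theta mu xi w) -> 1 <= Xhi w].
Proof.
have /andP[v0 v1] := v01.
(* The tail beyond v/4 is at most 1/2 - v/24, whence the 24 in [delta]. The low event has count n/2,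
   which is relaxed to n/2 - k to share the bound. *)
have [p [p01 pE pE']] := @normal_prob_tail R (v / 4) ltac:(lra).
have rn := double_half_sub_le n k.
have e0 : 0 <= v / 24 by lra.
have p01' : 0 <= p <= 1 / 2 - v / 24 by lra.
have [Xhi [mhi Hhi]] := mean_count_ge iid (measurable_itv _) pE p01' e0 rn.
have [Xlo [mlo Hlo]] := mean_count_ge iid (measurable_itv _) pE' p01' e0 rn.
exists Xlo, Xhi; split => // w med.
  apply: Hlo; apply: leq_trans (leq_subr _ _) _.
  exact: (theta_med_low n0 mu0 med).
by apply: Hhi; exact: (theta_med_high n0 muk med).
Qed.

Lemma prob_med c : z <= c -> (P [set w | est w \notin `[theta, (theta + c)%R]%R] <=
  (64 * vr + n%:R^-1 + delta)%:E)%E.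
Proof.
move=> zc; have [Xlo [Xhi [mlo mhi Hlo Hhi]]] := med_events.
apply: (@prob_outside _ _ (fun w => 64 * (N w ^+ 2 / B ^+ 2) + lower_excess b (xi^~ w) + Xhi w)).
  by apply: mean_leD => //; apply: mean_leD => //; exact: mean_leZ.
move=> w h; have [_ Xhi0 _] := mhi.
have {}h : est w < theta \/ theta + z < est w.
  by case: h => h; [left|right; apply: le_lt_trans h; rewrite lerD2l].
apply: (theta_hat_outside n0 q0 qe mu0 muk kn Bkap b1 (Xhi0 w) _ eL Lq h) => //.
have [/Hhi|med] := ltP (theta + v / 4) (theta_med (sample theta mu xi w)); first by right.
left; rewrite lowE lee_fin; have /andP[v0 v1] := v01; lra.
Qed.

Lemma mean_med : mean_le P (fun w => `|est w - theta|)
  ((3 * kap + 2 * (kap + sig2 / kap)) / (q%:R ^+ 2 * lam) + b * (64 * sig2 + delta) +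
   n%:R^-1 * 16 + n%:R * 2 ^- (n - k) + sig2 / B / (q%:R ^+ 2 * lam) +
   (n%:R^-1 * vr + n%:R * delta) / lam + n%:R^-1).
Proof.
have [i0 mui0] := exi0.
have [Xlo [Xhi [mlo mhi Hlo Hhi]]] := med_events.
have ni : 0 < n%:R^-1 :> R by rewrite invr_gt0.
have /andP[v0 v1] := v01.
have q2l : 0 < q%:R ^+ 2 * lam by rewrite mulr_gt0// exprn_gt0// ltr0n.
have kap0 : 0 < kap by apply: lt_le_trans Bkap.
have b0 : 0 <= b by apply: le_trans b1.
(* Only second moments of N are available; AM-GM with weight [kap] gives a bound on the same scale
   as k/n. *)
have mN : mean_le P N ((kap + sig2 / kap) / 2).
  apply: (@mean_le_mono _ _ _ _ _ (fun w => (2^-1) * (kap + kap^-1 * N w ^+ 2))).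
  - exact: measurable_noise_norm.
  - by move=> w; exact: noise_norm_ge0.
  - move=> w; set x := N w.
    have -> : 2^-1 * (kap + kap^-1 * x ^+ 2) = x + (x - kap) ^+ 2 / (2 * kap).
      by field; rewrite gt_eqF.
    by rewrite lerDl divr_ge0 ?sqr_ge0// mulr_ge0// ltW.
  - rewrite mulrC [sig2 / _]mulrC; apply: mean_leZ => //.
    apply: mean_leD; first by apply: mean_le_cst; exact: ltW.
    by apply: mean_leZ => //; rewrite invr_ge0 ltW.
apply: (@mean_le_mono _ _ _ _ _ (fun w => (q%:R ^+ 2 * lam)^-1 * (3 * kap + 4 * N w) +
  b * (64 * N w ^+ 2 + Xhi w) +
  n%:R^-1 * expR (2 * xi i0 w) + n%:R * I w +
  (B * (q%:R ^+ 2 * lam))^-1 * N w ^+ 2 +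
  lam^-1 * (n%:R^-1 * (N w ^+ 2 / B ^+ 2) + n%:R * Xlo w) +
  lower_excess b (xi^~ w))) => //.
  move=> w; have [_ Xhi0 _] := mhi; have [_ Xlo0 _] := mlo.
  have := theta_hat_dist_med n0 q0 qe mu0 muk Bkap b1 mui0 ni (I0 w) (@HI w)
    (Xhi0 w) (Xlo0 w) ni v0 (lowE w) (@Hlo w) (@Hhi w) vq kap2.
  rewrite invrK => /le_trans; apply.
  rewrite -/lam -/kap -/B -/(N w) le_eqVlt; apply/orP; left; apply/eqP.
  rewrite [_^-1 * (3 * kap + _)]mulrC [lam^-1 * _]mulrC; congr (_ + _ + _ + _).
  by rewrite [in RHS](invfM B) [RHS]mulrC mulrA.
have -> : (3 * kap + 2 * (kap + sig2 / kap)) / (q%:R ^+ 2 * lam) =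
   (q%:R ^+ 2 * lam)^-1 * (3 * kap + 4 * ((kap + sig2 / kap) / 2)).
  by field; rewrite !gt_eqF// ltr0n.
have -> : sig2 / B / (q%:R ^+ 2 * lam) = (B * (q%:R ^+ 2 * lam))^-1 * sig2.
  by rewrite [in RHS](invfM B) [RHS]mulrC mulrA.
rewrite [_ / lam]mulrC.
have q2li : 0 <= (q%:R ^+ 2 * lam)^-1 by rewrite invr_ge0 ltW.
have l0 : 0 <= lam^-1 by rewrite invr_ge0 ltW.
have Bq : 0 <= (B * (q%:R ^+ 2 * lam))^-1.
  by rewrite invr_ge0 mulr_ge0 ?(ltW B0) ?(ltW q2l).
have k3 : 0 <= 3 * kap by rewrite mulr_ge0// ltW.
apply: mean_leD mean_W.
apply: mean_leD (mean_leZ l0 (mean_leD (mean_leZ (ltW ni) mean_V) (mean_leZ (ltW nn) mlo))).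
apply: mean_leD (mean_leZ Bq mean_N2).
apply: mean_leD (mean_leZ (ltW nn) mean_I).
apply: mean_leD (mean_leZ (ltW ni) (mean_e2 i0)).
apply: mean_leD; last first.
  by apply: (mean_leZ b0); apply: mean_leD mhi; exact: mean_leZ mean_N2.
by apply: (mean_leZ q2li); apply: mean_leD (mean_le_cst _ k3) _; exact: mean_leZ mN.
Qed.
End med.
End risk.

Lemma half_decomp (n k : nat) : (k <= n./2)%N ->
  (n = 2 * k + odd n + 2 * (n./2 - k))%N.
Proof. by have := odd_double_half n; lia. Qed.

(** * Comparison with the rate *)

Section rates.
Context {R : realType}.
Local Notation a := (aconst R).
(** This is (3a)^{3/2}: by ell <= 3aq it converts q^{-3/2} into ell^{-3/2}. *)
Definition rate_const : R := 3 * a * Num.sqrt (3 * a).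

Lemma powR_three_halves (x : R) : 0 < x -> x `^ (3 / 2) = x * Num.sqrt x.
Proof.
move=> x0; rewrite /powR gt_eqF//.
have E : Num.sqrt x = expR (ln x / 2).
  rewrite -[in LHS](lnK (_ : x \is Num.pos)) ?posrE//.
  rewrite [in LHS](_ : ln x = 2 * (ln x / 2)); last by field.
  by rewrite expRM_natl sqrtr_sqr ger0_norm ?expR_ge0.
have xE : x = expR (ln x) by rewrite lnK ?posrE.
by rewrite E [X in _ = X * _]xE -expRD; congr expR; field.
Qed.

Lemma sqr_lambdaq q : (0 < q)%N ->
  q%:R ^+ 2 * lambdaq R q = Num.sqrt 2 * (q%:R * Num.sqrt q%:R).
Proof.
move=> q0; have qR : 0 < q%:R :> R by rewrite ltr0n.
have s0 : 0 < Num.sqrt q%:R :> R by rewrite sqrtr_gt0.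
rewrite /lambdaq sqrtrM// sqrtrV ?(ltW qR)//.
have qE : q%:R = Num.sqrt q%:R ^+ 2 :> R by rewrite sqr_sqrtr// ltW.
set s := Num.sqrt q%:R in s0 qE *; rewrite qE.
by field; rewrite gt_eqF.
Qed.

Lemma sqrt2_bounds : 1 <= (Num.sqrt 2 : R) <= 3 / 2.
Proof.
rewrite -[leLHS]sqrtr1 ler_wsqrtr ?ler1n//=.
by rewrite -(@ler_pXn2r _ 2)// ?nnegrE// sqr_sqrtr//; lra.
Qed.

Lemma inv_sqr_lambdaq_le q (ell : R) : (0 < q)%N -> 0 < ell -> ell <= 3 * a * q%:R ->
  (q%:R ^+ 2 * lambdaq R q)^-1 <= rate_const / (ell * Num.sqrt ell).
Proof.
move=> q0 ell0 ellq; have qR : 0 < q%:R :> R by rewrite ltr0n.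
have a6 := aconst_ge6 (R := R).
have s0 : 0 < Num.sqrt q%:R :> R by rewrite sqrtr_gt0.
have e0 : 0 < Num.sqrt ell :> R by rewrite sqrtr_gt0.
have a0 : 0 < 3 * a by lra.
have qs : 0 < q%:R * Num.sqrt q%:R :> R by rewrite mulr_gt0.
have /andP[t1 _] := sqrt2_bounds.
have d0 : 0 < Num.sqrt 2 * (q%:R * Num.sqrt q%:R) :> R by rewrite mulr_gt0//; lra.
rewrite sqr_lambdaq// ler_pdivlMr ?mulr_gt0// mulrC ler_pdivrMr//.
apply: (@le_trans _ _ (rate_const * (q%:R * Num.sqrt q%:R))).
  rewrite /rate_const mulrACA -sqrtrM ?(ltW a0)//.
  by apply: ler_pM; rewrite ?sqrtr_ge0 ?(ltW ell0)// ler_wsqrtr.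
rewrite ler_wpM2l//; last by rewrite ler_peMl// ltW.
by rewrite /rate_const mulr_ge0 ?sqrtr_ge0 ?(ltW a0).
Qed.

(** log(1 + x) >= x/2 on [0, 1], at x = sqrt kap. It makes k/n, the scale of the remainders,
    comparable with the numerator of the rate. *)
Lemma ln1p_sqrt_ge (kap rho : R) : 0 <= kap <= 1 -> kap <= rho ->
  kap / 4 <= ln (1 + Num.sqrt rho) ^+ 2.
Proof.
move=> /andP[k0 k1] kr; set x := Num.sqrt kap.
have x0 : 0 <= x by exact: sqrtr_ge0.
have x1 : x <= 1 by rewrite /x -[leRHS]sqrtr1 ler_wsqrtr.
have xr : x <= Num.sqrt rho by rewrite ler_wsqrtr.
have -> : kap = x ^+ 2 by rewrite sqr_sqrtr.
have H : x / 2 <= ln (1 + Num.sqrt rho).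
  rewrite -ler_expR lnK ?posrE; last lra.
  apply: (@le_trans _ _ (1 + x)); last by rewrite lerD2l.
  have e := expR_ge1Dx (- (x / 2)); rewrite expRN in e.
  have e0 := expR_gt0 (x / 2).
  have e1 : (1 - x / 2) * expR (x / 2) <= 1 by rewrite -ler_pdivlMr// div1r; lra.
  by nra.
by have := sqr_ge0 (ln (1 + Num.sqrt rho) - x / 2); nra.
Qed.

Lemma rate_ge (n k : nat) (ell : R) : (0 < k < n)%N ->
  ell = ln (k%:R / Num.sqrt n%:R) -> 0 < ell ->
  k%:R / n%:R / (4 * (ell * Num.sqrt ell)) <= rate R n k.
Proof.
move=> /andP[k0 kn] ellE ell0.
have kR : 0 < k%:R :> R by rewrite ltr0n.
have nR : 0 < n%:R :> R by rewrite ltr0n (leq_trans k0)// ltnW.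
have nk : 0 < n%:R - k%:R :> R by rewrite subr_gt0 ltr_nat.
rewrite /rate -ellE powR_three_halves//.
have e0 : 0 < Num.sqrt ell :> R by rewrite sqrtr_gt0.
have ee : 0 <= (ell * Num.sqrt ell)^-1 by rewrite invr_ge0 mulr_ge0 ?(ltW ell0) ?(ltW e0).
rewrite invfM mulrA ler_wpM2r//.
apply: ln1p_sqrt_ge.
  by rewrite divr_ge0 ?(ltW nR) ?(ltW kR)//= ler_pdivrMr// mul1r ler_nat ltnW.
by rewrite ler_wpM2l ?(ltW kR)// lef_pV2 ?posrE//; lra.
Qed.

Lemma rateE (n k : nat) (ell : R) : ell = ln (k%:R / Num.sqrt n%:R) -> 0 < ell ->
  ln (1 + Num.sqrt (k%:R / (n%:R - k%:R))) ^+ 2 / (ell * Num.sqrt ell) = rate R n k.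
Proof. by move=> ellE ell0; rewrite /rate -ellE powR_three_halves. Qed.

Lemma exp2_ge2 : 2 <= expR 1 :> R.
Proof. by have := expR_ge1Dx (1 : R); lra. Qed.

Lemma half_pow_le (l : R) (n k : nat) : 1 <= l -> expR l = n%:R ->
  64 * expR (l / 2) <= (n - k)%:R -> n%:R * 2 ^- (n - k) <= expR (- l).
Proof.
move=> l1 nE m64.
have e := expR_ge1Dx (l / 2).
rewrite -nE -ler_pdivlMl ?expR_gt0// -expRN -expRD -exprVn.
apply: (@le_trans _ _ (expR (- (1 / 2)) ^+ (n - k))).
  rewrite lerXn2r ?nnegrE ?expR_ge0//.
  by apply: le_trans (expR_ge1Dx _); lra.
by rewrite -expRM_natl ler_expR; lra.
Qed.

(** Since q^2 lam = sqrt 2 q^{3/2} and q <= [qmax], the last claim comes down to 5 * 3/2 * 16 <=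
    144, by sqrt 2 <= 3/2 and pi <= 4. The middle one uses pi >= 2 and qmax^{3/2} <= l^2. *)
Lemma vbar_bounds (n : nat) (l : R) : 1 <= (qmax R n)%:~R :> R ->
  (qmax R n)%:~R <= l :> R ->
  [/\ 0 <= vbar R n <= 1, 1 / (36 * l ^+ 2) <= vbar R n &
   forall q : nat, (0 < q)%N -> q%:R <= (qmax R n)%:~R :> R ->
     5 * q%:R ^+ 2 * lambdaq R q * vbar R n <= 1].
Proof.
set Q := (qmax R n)%:~R => Q1 Ql.
have Q0 : 0 < Q by lra.
rewrite /vbar -/Q powR_three_halves//.
have s1 : 1 <= Num.sqrt Q by rewrite -[leLHS]sqrtr1 ler_wsqrtr.
have sQ : Num.sqrt Q <= Q.
  by rewrite -[leRHS]sqr_sqrtr ?(ltW Q0)// expr2 ler_peMl// (le_trans _ s1).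
set D := Q * Num.sqrt Q.
have D1 : 1 <= D by rewrite /D; nra.
have Dl : D <= l ^+ 2 by rewrite /D expr2; apply: ler_pM => //; lra.
have p4 : pi <= 4 :> R by have := pihalf_lt2 R; lra.
have p2 : 2 <= pi :> R := pi_ge2 R.
have pp : pi ^+ 2 <= 16 :> R by nra.
have pp2 : 4 <= pi ^+ 2 :> R by nra.
have d0 : 0 < 144 * D by lra.
split.
- by rewrite divr_ge0/= ?ler_pdivrMr//; lra.
- apply: (@le_trans _ _ (1 / (36 * D))).
    by rewrite !div1r lef_pV2 ?posrE; lra.
  rewrite ler_pdivlMr// (_ : _ * _ = 4)//; field; lra.
move=> q q0 qQ; rewrite -[5 * _ * _]mulrA sqr_lambdaq//.
have /andP[t1 t2] := sqrt2_bounds.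
have qR : 0 < q%:R :> R by rewrite ltr0n.
have qD : q%:R * Num.sqrt q%:R <= D.
  by apply: ler_pM; rewrite ?sqrtr_ge0 ?(ltW qR)// ler_wsqrtr.
rewrite mulrA ler_pdivrMr// mul1r.
have qs : 0 <= q%:R * Num.sqrt q%:R :> R by rewrite mulr_ge0 ?sqrtr_ge0 ?(ltW qR).
apply: (@le_trans _ _ (5 * (3 / 2 * D) * 16)); last lra.
have t0 : 0 <= Num.sqrt 2 :> R by lra.
apply: ler_pM; [|exact: sqr_ge0| |exact: pp].
  by rewrite mulr_ge0// mulr_ge0.
by rewrite ler_wpM2l// ler_pM.
Qed.

(** With r = n/2 - k, the 4^{-r} hidden in the power cancels 2^n up to n - 2r = 2k + (0 or 1)
    factors 2. What remains is e^{-4 e^2 r} <= e^{-e^2 n} with e = v/24 at least of order l^{-2}; so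
    n need only exceed k l^4 by a constant factor, with room for 3l. *)
Lemma delta_le (n k : nat) (l v C : R) : expR l = n%:R -> 0 < C ->
  0 <= v -> 1 / (C * l ^+ 2) <= v / 24 -> v <= 1 -> 3 <= l ->
  8 * k%:R <= n%:R :> R ->
  C ^+ 2 * l ^+ 4 * (1 + 2 * k%:R + 3 * l) <= n%:R ->
  2 ^+ n * (1 / 4 - (v / 24) ^+ 2) ^+ (n./2 - k) <= expR (- (3 * l)).
Proof.
move=> nE C0 v0 vl v1 l2 k8 big.
have n4 : 4 <= n%:R :> R by rewrite -nE; have := expR_ge1Dx l; lra.
set r := (n./2 - k)%N.
have hn : n%:R = (odd n)%:R + 2 * (n./2)%:R :> R.
  by rewrite -[in LHS](odd_double_half n) natrD -mul2n natrM.
have o0 : 0 <= ((odd n)%:R : R) <= 1 by case: (odd n); rewrite /= lexx ler01.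
have /andP[odd0 odd1] := o0.
have kh : (k <= n./2)%N by rewrite -(ler_nat R); lra.
have rE : r%:R = (n./2)%:R - k%:R :> R by rewrite /r natrB.
have r4 : n%:R / 4 <= r%:R :> R by rewrite rE; lra.
have nr := half_decomp kh.
set e := v / 24.
have e0 : 0 <= e by rewrite /e; lra.
have e2 : 1 / (C ^+ 2 * l ^+ 4) <= e ^+ 2.
  have -> : 1 / (C ^+ 2 * l ^+ 4) = (1 / (C * l ^+ 2)) ^+ 2.
    by field; rewrite (gt_eqF C0) gt_eqF//; lra.
  have c0 : 0 <= 1 / (C * l ^+ 2) by rewrite divr_ge0// mulr_ge0 ?(ltW C0)// sqr_ge0.
  by rewrite lerXn2r// nnegrE.
have l4 : 0 < C ^+ 2 * l ^+ 4 by rewrite mulr_gt0// exprn_gt0//; lra.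
have main : 1 + 2 * k%:R + 3 * l <= e ^+ 2 * n%:R.
  apply: (@le_trans _ _ (1 / (C ^+ 2 * l ^+ 4) * n%:R)); last by rewrite ler_wpM2r.
  by rewrite [leRHS]mulrC div1r ler_pdivlMr// mulrC.
rewrite {1}nr exprD exprM -mulrA -exprMn.
have -> : 2 ^+ 2 * (1 / 4 - e ^+ 2) = 1 - 4 * e ^+ 2 :> R by field.
have e1 : 4 * e ^+ 2 <= 1 by rewrite /e; nra.
apply: (@le_trans _ _ (expR (2 * k%:R + (odd n)%:R) * expR (- (4 * e ^+ 2) * r%:R))).
  apply: ler_pM; rewrite ?exprn_ge0//; first by lra.
    apply: (@le_trans _ _ (expR 1 ^+ (2 * k + odd n))).
      by rewrite lerXn2r ?nnegrE ?expR_ge0// exp2_ge2.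
    by rewrite -expRM_natl mulr1 natrD natrM.
  rewrite [- _ * _]mulrC expRM_natl lerXn2r ?nnegrE ?expR_ge0//; first lra.
  exact: expR_ge1Dx.
rewrite -expRD ler_expR.
have : e ^+ 2 * n%:R <= 4 * e ^+ 2 * r%:R.
  rewrite [4 * _]mulrC -[leRHS]mulrA ler_wpM2l ?sqr_ge0//; lra.
lra.
Qed.
End rates.

(** * Remainder terms *)

Section remainders.
Context {R : realType}.
Implicit Types (l ell b e hp lami vr delta : R).

(** 140 l exceeds the total coefficient of the remainders in both regimes, and 560 l^3 is its
    product with 4 l^2. *)
Lemma poly_exp_tradeoff l (X : R) : 1 <= l -> 560 * l ^+ 3 <= expR (l / 5) ->
  0 <= X -> 140 * l * (expR (- (l / 5)) * X) <= X / (4 * l ^+ 2).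
Proof.
move=> l1 big X0; have l0 : 0 < l by lra.
have l2 : 0 < 4 * l ^+ 2 by rewrite mulr_gt0// exprn_gt0.
rewrite ler_pdivlMr//.
have -> : 140 * l * (expR (- (l / 5)) * X) * (4 * l ^+ 2) =
  560 * l ^+ 3 * expR (- (l / 5)) * X by ring.
rewrite -[leRHS]mul1r; apply: (ler_wpM2r X0).
by rewrite expRN ler_pdivrMr ?mul1r; [exact: big|exact: expR_gt0].
Qed.

Lemma rest_free_le l b vr e hp lami : 18 <= l -> 0 <= b <= 2 * l ->
  0 <= vr <= expR (- (2 / 5 * l)) -> e <= expR (- l) -> hp <= expR (- l) ->
  0 <= lami <= l -> 560 * l ^+ 3 <= expR (l / 5) ->
  b * (64 * vr) + e * 16 + hp + vr * lami + e <= expR (- (l / 5)) / (4 * l ^+ 2).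
Proof.
move=> l18 /andP[b0 bl] /andP[v0 vX] eX hX /andP[m0 ml] big.
set X := expR (- (2 / 5 * l)) in vX.
(* One factor absorbs the powers of l; the other is left for the comparison with k/n. *)
have XE : X = expR (- (l / 5)) * expR (- (l / 5)).
  by rewrite /X -expRD; congr expR; field.
have X0 : 0 <= X by exact: expR_ge0.
have lX : expR (- l) <= X by rewrite ler_expR; lra.
apply: (le_trans _ (poly_exp_tradeoff _ big (expR_ge0 _))); last lra.
rewrite -XE.
have h1 : b * (64 * vr) <= (2 * l) * (64 * X).
  by apply: ler_pM => //; [rewrite mulr_ge0//|rewrite ler_wpM2l].
have h2 : vr * lami <= X * l by exact: ler_pM.
have h3 : 18 * X <= l * X by rewrite ler_wpM2r.
have h4 : 0 <= l * X by rewrite mulr_ge0//; lra.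
lra.
Qed.

Lemma rest_med_le l ell b (sig2 : R) delta hp vr lami : 18 <= l -> 0 <= ell ->
  0 <= b <= 2 * l -> 0 <= sig2 <= expR (ell - l) -> 0 <= delta <= expR (- (3 * l)) ->
  hp <= expR (- l) -> 0 <= vr <= 1 ->
  0 <= lami <= l -> 560 * l ^+ 3 <= expR (l / 5) ->
  b * (64 * sig2 + delta) + expR (- l) * 16 + hp +
    (expR (- l) * vr + expR l * delta) * lami + expR (- l)
  <= expR (ell - l / 2) / (4 * l ^+ 2).
Proof.
move=> l18 ell0 /andP[b0 bl] /andP[s0 sX] /andP[d0 dX] hX /andP[v0 v1] /andP[m0 ml] big.
set X := expR (ell - l) in sX.
have X0 : 0 <= X by exact: expR_ge0.
have XE : X <= expR (- (l / 5)) * expR (ell - l / 2).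
  by rewrite /X -expRD ler_expR; lra.
have lX : expR (- l) <= X by rewrite ler_expR; lra.
have d3 : expR (- (3 * l)) <= X by rewrite ler_expR; lra.
apply: (le_trans _ (poly_exp_tradeoff _ big (expR_ge0 _))); last lra.
apply: (@le_trans _ _ (140 * l * X)); last by rewrite ler_wpM2l// mulr_ge0//; lra.
have h1 : b * (64 * sig2 + delta) <= (2 * l) * (65 * X).
  by apply: ler_pM => //; lra.
have nd : expR l * delta <= X.
  apply: (@le_trans _ _ (expR l * expR (- (3 * l)))); first by rewrite ler_wpM2l ?expR_ge0.
  by rewrite -expRD ler_expR; lra.
have ev : expR (- l) * vr <= X.
  by apply: le_trans lX; rewrite ler_piMr ?expR_ge0.
have p0 : 0 <= expR (- l) * vr by rewrite mulr_ge0 ?expR_ge0.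
have p1 : 0 <= expR l * delta by rewrite mulr_ge0 ?expR_ge0.
have h2 : (expR (- l) * vr + expR l * delta) * lami <= (2 * X) * l.
  by apply: ler_pM => //; [rewrite addr_ge0|lra].
have h3 : 18 * X <= l * X by rewrite ler_wpM2r.
lra.
Qed.

Lemma large_n (l0 : R) : exists n0 : nat, (0 < n0)%N /\
  forall n, (n0 <= n)%N -> l0 <= ln n%:R.
Proof.
exists (Num.trunc (expR l0)).+1; split => // n hn.
have e : expR l0 <= n%:R.
  apply: ltW; apply: lt_le_trans (truncnS_gt _) _.
  by rewrite ler_nat.
rewrite -ler_expR lnK// posrE; apply: lt_le_trans e; exact: expR_gt0.
Qed.
End remainders.

(** * Inequalities for the selected degree *)

Section regimes.
Context {R : realType}.
Local Notation a := (aconst R).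
Local Notation K := (@rate_const R).
Variables (n k q : nat) (l ell : R).
Hypotheses (lE : l = ln n%:R) (ellE : ell = ln (k%:R / Num.sqrt n%:R)).
Hypotheses (kn : (0 < k < n)%N) (q1 : (1 < q)%N).
Hypotheses (l144 : 144 <= l) (ell1 : 1 <= ell) (elll : ell <= l / 2).
Hypotheses (aq : a * q%:R <= ell) (qell : ell <= 3 * a * q%:R).
Let lam := lambdaq R q.
Let kap : R := k%:R / n%:R.
Let n0 : (0 < n)%N. Proof. by case/andP: kn => _; exact: leq_trans. Qed.
Let k0 : (0 < k)%N. Proof. by case/andP: kn. Qed.

Lemma sparsity_ratioE : kap = expR (ell - l / 2).
Proof. by rewrite /kap (ratio_expR n0 k0) -lE -ellE. Qed.

Lemma slackE : slack n q = expR (a * q%:R - l / 2).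
Proof. by rewrite (slack_expR n0) -lE. Qed.

Lemma slack_le_ratio : slack n q <= kap.
Proof. by rewrite slackE sparsity_ratioE ler_expR; move: aq; lra. Qed.

Lemma two_sqrt_ln_bounds : 1 <= 2 * Num.sqrt l <= 2 * l.
Proof.
have l1 := l144.
have s1 : 1 <= Num.sqrt l by rewrite -[leLHS]sqrtr1 ler_wsqrtr//; lra.
have s2 : Num.sqrt l <= l.
  have l0 : 0 <= l by lra.
  by rewrite -[leRHS](sqr_sqrtr l0) expr2 ler_peMl// (le_trans _ s1).
lra.
Qed.

Lemma inv_lambdaq_bounds : 0 <= lam^-1 <= l.
Proof.
have qR : 2 <= q%:R :> R by rewrite (ler_nat _ 2).
have a6 := aconst_ge6 (R := R).
have [aq' l1 ell'] := And3 aq l144 elll.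
have ql : q%:R <= l.
  suff : q%:R <= a * q%:R by lra.
  by rewrite ler_peMl//; lra.
have lam0 : 0 < lam by apply: lambdaq_gt0; exact: ltnW.
rewrite invr_ge0 (ltW lam0)/=; apply: le_trans ql.
rewrite -(@ler_pXn2r _ 2)// ?nnegrE ?invr_ge0 ?(ltW lam0)//.
have q2 : 0 <= 2 / q%:R :> R by rewrite divr_ge0.
rewrite exprVn /lam /lambdaq (sqr_sqrtr q2) invf_div.
have q0 : 0 <= q%:R :> R by lra.
rewrite ler_pdivrMr// expr2 -mulrA ler_peMr//; lra.
Qed.

Lemma rate_ge_ratio : kap / (4 * l ^+ 2) <= rate R n k.
Proof.
have [e1 l1 el] := And3 ell1 l144 elll.
have e0 : 0 < ell by lra.
have s0 : 0 < Num.sqrt ell by rewrite sqrtr_gt0.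
apply: le_trans (rate_ge kn ellE e0).
have kp : 0 <= kap by rewrite divr_ge0.
apply: (ler_wpM2l kp).
have se : Num.sqrt ell <= l.
  have e00 : 0 <= ell by lra.
  have s1 : 1 <= Num.sqrt ell by rewrite -[leLHS]sqrtr1 ler_wsqrtr.
  apply: (@le_trans _ _ ell); last lra.
  by rewrite -[leRHS](sqr_sqrtr e00) expr2 ler_peMl// ltW.
have p0 : 0 < ell * Num.sqrt ell by rewrite mulr_gt0.
have ee : ell * Num.sqrt ell <= l ^+ 2.
  by rewrite expr2; apply: ler_pM; rewrite ?sqrtr_ge0//; lra.
rewrite lef_pV2 ?posrE; lra.
Qed.

Lemma rate_const_gt0 : 0 < K.
Proof.
have a6 := aconst_ge6 (R := R).
by rewrite /rate_const mulr_gt0 ?sqrtr_gt0//; lra.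
Qed.

Lemma ratio_rate : kap / (q%:R ^+ 2 * lam) <= 4 * K * rate R n k.
Proof.
have e0 : 0 < ell by have := ell1; lra.
have kp : 0 <= kap by rewrite divr_ge0.
have K0 := rate_const_gt0.
apply: (@le_trans _ _ (kap * (K / (ell * Num.sqrt ell)))).
  apply: (ler_wpM2l kp); apply: inv_sqr_lambdaq_le => //; exact: ltnW.
apply: (@le_trans _ _ (4 * K * (kap / (4 * (ell * Num.sqrt ell))))).
  rewrite le_eqVlt; apply/orP; left; apply/eqP; field.
  by rewrite gt_eqF ?(gt_eqF e0)// sqrtr_gt0.
by apply: ler_wpM2l; [lra|exact: rate_ge].
Qed.

Lemma shift_le_rate :
  5 * ln (1 + Num.sqrt (k%:R / (n%:R - k%:R))) ^+ 2 / (q%:R ^+ 2 * lam) <=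
  5 * K * rate R n k.
Proof.
have e0 : 0 < ell by have := ell1; lra.
rewrite -(rateE ellE e0); set L := ln _ ^+ 2.
have L0 : 0 <= L by exact: sqr_ge0.
have -> : 5 * K * (L / (ell * Num.sqrt ell)) = (5 * L) * (K / (ell * Num.sqrt ell)) by ring.
apply: ler_wpM2l; first by rewrite mulr_ge0.
by apply: inv_sqr_lambdaq_le => //; exact: ltnW.
Qed.

Lemma rate_gt0 : 0 < rate R n k.
Proof.
apply: lt_le_trans rate_ge_ratio; have l1 := l144.
by rewrite sparsity_ratioE divr_gt0 ?expR_gt0// mulr_gt0// exprn_gt0//; lra.
Qed.
End regimes.

(** The rounding loss 4a between ell and aq becomes the factor e^{16a/3}. The summand 2 accounts for
    1/n and [delta], both at most e^{-l} <= e^{-4 ell/3}. *)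
Lemma prob_const_le {R : realType} (l ell aq vr delta : R) (a := aconst R) :
  1 <= ell -> 4 / 3 * ell <= l -> ell <= aq + 4 * a -> vr = expR (- (4 / 3) * aq) ->
  delta <= expR (- l) ->
  64 * vr + expR (- l) + delta <=
  (64 * expR (16 / 3 * a) + 2) * expR (- (4 / 3 * ell)) * ell ^+ 3.
Proof.
move=> e1 el ela -> dl.
set X := expR (- (4 / 3 * ell)).
have X0 : 0 <= X by exact: expR_ge0.
have lX : expR (- l) <= X by rewrite ler_expR; lra.
have vX : expR (- (4 / 3) * aq) <= expR (16 / 3 * a) * X.
  by rewrite -expRD ler_expR; lra.
have e3 : 1 <= ell ^+ 3 by rewrite exprn_ege1.
set D := (64 * expR (16 / 3 * a) + 2) * X.
have D0 : 0 <= D.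
  by rewrite /D mulr_ge0// addr_ge0// mulr_ge0// expR_ge0.
apply: (@le_trans _ _ D); last by rewrite ler_peMr.
by rewrite /D; lra.
Qed.

(** k <= e^{2a} n^{4/5}, and the missing n^{1/5} = e^{l/5} beats every power of l. *)
Lemma sparse_regime {R : realType} (l ell k n : R) (C : R) (a := aconst R) :
  1 <= l -> n = expR l -> k = expR (ell + l / 2) -> ell <= 3 / 10 * l + 2 * a ->
  0 < C -> 8 <= C ^+ 2 -> C ^+ 2 * (4 + 2 * expR (2 * a)) * l ^+ 5 <= expR (l / 5) ->
  8 * k <= n /\ C ^+ 2 * l ^+ 4 * (1 + 2 * k + 3 * l) <= n.
Proof.
move=> l1 nE kE el C0 C8 H.
set e := expR (2 * a) in H.
set y := expR (4 / 5 * l).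
have e1 : 0 < e by exact: expR_gt0.
have y1 : 1 <= y by rewrite /y -[leLHS]expR0 ler_expR; lra.
have ny : n = expR (l / 5) * y by rewrite nE -expRD; congr expR; field.
have ky : k <= e * y by rewrite kE -expRD ler_expR; lra.
have l5 : 1 <= l ^+ 5 by rewrite exprn_ege1.
have l4 : 0 < l ^+ 4 by rewrite exprn_gt0//; lra.
have c2 : 0 < C ^+ 2 by rewrite exprn_gt0.
have y0 : 0 <= y by lra.
split.
  rewrite ny; apply: (@le_trans _ _ (8 * e * y)); first by rewrite -mulrA ler_wpM2l.
  apply: (ler_wpM2r y0); apply: le_trans H.
  apply: (@le_trans _ _ (C ^+ 2 * (4 + 2 * e))); last first.
    by rewrite ler_peMr// mulr_ge0 ?(ltW c2)//; lra.
  apply: (@le_trans _ _ (8 * (4 + 2 * e))); first lra.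
  by apply: ler_wpM2r => //; lra.
have B : 1 + 2 * k + 3 * l <= (4 + 2 * e) * l * y.
  have h1 : 1 <= l * y by rewrite -[leLHS]mulr1; apply: ler_pM => //; lra.
  have h2 : l <= l * y by rewrite ler_peMr//; lra.
  have h3 : e * y <= e * (l * y).
    by rewrite (ler_pM2l e1) ler_peMl.
  have -> : (4 + 2 * e) * l * y = 4 * (l * y) + 2 * (e * (l * y)) by ring.
  lra.
rewrite ny; apply: (@le_trans _ _ (C ^+ 2 * l ^+ 4 * ((4 + 2 * e) * l * y))).
  by rewrite ler_wpM2l// mulr_ge0 ?(ltW c2) ?(ltW l4).
have -> : C ^+ 2 * l ^+ 4 * ((4 + 2 * e) * l * y) = C ^+ 2 * (4 + 2 * e) * l ^+ 5 * y by ring.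
exact: (ler_wpM2r y0).
Qed.

Lemma inv_sqr_half_le {R : realType} (l v C : R) :
  0 < l -> C = 36 * 24 -> 1 / (36 * l ^+ 2) <= v -> 1 / (C * l ^+ 2) <= v / 24.
Proof.
move=> l0 -> h; rewrite ler_pdivlMr//; apply: le_trans h.
by rewrite le_eqVlt; apply/orP; left; apply/eqP; field; rewrite gt_eqF.
Qed.

(** A small q cannot be [qmax]: x = l/(2a) >= 12 gives x - 4 > 3x/5. So q is the even rounding of
    ell/a, and its smallness passes to ell. *)
Lemma log_sparsity_le {R : realType} (a l ell q Q : R) :
  6 <= a -> 24 * a <= l -> l / (2 * a) - 4 < Q -> a * q <= 3 / 10 * l ->
  ell / a - 2 < q \/ q = Q -> ell <= 3 / 10 * l + 2 * a.
Proof.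
move=> a6 l24 Qg aqs qalt; have a0 : 0 < a by lra.
have : ell / a - 2 < q.
  case: qalt => [//|qq]; exfalso.
  have : l / (2 * a) - 4 < q by rewrite qq.
  have : q <= 3 / 10 * l / a by rewrite ler_pdivlMr// mulrC.
  have -> : 3 / 10 * l / a = 3 / 5 * (l / (2 * a)) by field; lra.
  have : 12 <= l / (2 * a) by rewrite ler_pdivlMr; lra.
  lra.
rewrite ltrBlDr ltr_pdivrMr// mulrDl => h.
by rewrite ltW//; apply: lt_le_trans h _; rewrite mulrC lerD2r.
Qed.

Lemma mul_const_le {R : realType} (a l q : R) :
  0 < a -> q <= 3 / (10 * a) * l -> a * q <= 3 / 10 * l.
Proof.
move=> a0 h; have : q * a <= 3 / (10 * a) * l * a by rewrite ler_wpM2r// ltW.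
by rewrite (_ : 3 / (10 * a) * l * a = 3 / 10 * l) 1?mulrC//; field; rewrite gt_eqF.
Qed.

(** Comparing exponents, [sig2] is at most kap^2 and at most B kap. Hence every term is a multiple
    of kap / D, with 3 + 2 (1 + 1) = 7 in the first bound. *)
Lemma median_moments {R : realType} (l ell aq kap D sig2 B K r : R) :
  0 < D -> kap = expR (ell - l / 2) -> B = expR (aq - l / 2) ->
  sig2 = expR (2 / 3 * aq - l) -> 0 <= aq -> aq <= ell -> kap / D <= 4 * K * r ->
  [/\ 0 <= sig2 <= expR (ell - l),
      (3 * kap + 2 * (kap + sig2 / kap)) / D <= 28 * K * r &
      sig2 / B / D <= 4 * K * r].
Proof.
move=> D0 kapE BE sigE aq0 aql kr.
have kap0 : 0 < kap by rewrite kapE expR_gt0.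
have B0 : 0 < B by rewrite BE expR_gt0.
have Di : 0 <= D^-1 by rewrite invr_ge0 ltW.
have sk : sig2 / kap <= kap by rewrite ler_pdivrMr// kapE sigE -expRD ler_expR; lra.
have sB : sig2 / B <= kap by rewrite ler_pdivrMr// kapE BE sigE -expRD ler_expR; lra.
split; first by rewrite sigE expR_ge0 ler_expR; lra.
  apply: (@le_trans _ _ (7 * (kap / D))); last lra.
  by rewrite mulrA; apply: ler_wpM2r => //; lra.
by apply: le_trans kr; exact: ler_wpM2r.
Qed.

Lemma ratio_le_half {R : realType} (k n : R) :
  0 <= k -> 0 < n -> 8 * k <= n -> k / n <= 1 / 2.
Proof. by move=> k0 n0 h; rewrite ler_pdivrMr//; lra. Qed.

Lemma le_mul_const {R : realType} (a l q : R) :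
  0 < a -> 3 / (10 * a) * l <= q -> 3 / 10 * l <= a * q.
Proof.
move=> a0 h; have : 3 / (10 * a) * l * a <= q * a by rewrite ler_wpM2r// ltW.
by rewrite (_ : 3 / (10 * a) * l * a = 3 / 10 * l) 1?[q * a]mulrC//; field; rewrite gt_eqF.
Qed.

Lemma quarter_sub_sqr_ge0 {R : realType} (v : R) :
  0 <= v -> v <= 1 -> 0 <= 1 / 4 - (v / 24) ^+ 2.
Proof. by move=> v0 v1; nra. Qed.

(** * Assembly of the two bounds *)

Section conclusion.
Context {R : realType} {d : measure_display} {T : measurableType d}.
Local Notation a := (aconst R).
Local Notation K := (@rate_const R).
Variables (P : probability T R) (n k : nat) (mu : 'I_n -> R) (theta : R).
Variables (xi : 'I_n -> {RV P >-> R}) (C : R).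
Let l : R := ln n%:R.
Let ell : R := ln (k%:R / Num.sqrt n%:R).
Hypotheses (l144 : 144 <= l) (l24 : 24 * a <= l).
Hypothesis big : 560 * l ^+ 3 <= expR (l / 5).
Hypotheses (CE : C = 36 * 24) (C0 : 0 < C) (C8 : 8 <= C ^+ 2).
Hypothesis bigC : C ^+ 2 * (4 + 2 * expR (2 * a)) * l ^+ 5 <= expR (l / 5).
Hypothesis klow : expR (2 * a) * Num.sqrt n%:R <= k%:R.
Hypothesis khigh : k%:R < n%:R - 64 * (n%:R `^ (1 - 1 / (4 * a))).
Hypothesis mu0 : forall i, 0 <= mu i.
Hypothesis muk : (#|[pred i | mu i != 0%R]| <= k)%N.
Hypothesis iid : iid_standard_normal xi.

Let a6 : 6 <= a. Proof. exact: aconst_ge6. Qed.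

Lemma sample_size_gt0 : (0 < n)%N.
Proof.
rewrite lt0n; apply/eqP => nz; have := l144.
by rewrite /l nz ln0//; lra.
Qed.

Lemma sparsity_bounds : (0 < k < n)%N.
Proof.
have n0 := sample_size_gt0; apply/andP; split.
  rewrite -(ltr0n R); apply: lt_le_trans klow.
  by rewrite mulr_gt0 ?expR_gt0// sqrtr_gt0 ltr0n.
rewrite -(ltr_nat R); apply: lt_le_trans khigh _.
by rewrite gerBl mulr_ge0// powR_ge0.
Qed.

Lemma log_sparsity_bounds : 2 * a <= ell /\ ell <= l / 2.
Proof.
have n0 := sample_size_gt0; have /andP[k0 kn] := sparsity_bounds.
have s0 : 0 < Num.sqrt n%:R :> R by rewrite sqrtr_gt0 ltr0n.
have kR : 0 < k%:R :> R by rewrite ltr0n.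
split.
  by rewrite -ler_expR lnK ?posrE ?divr_gt0// ler_pdivlMr.
suff : expR (ell - l / 2) <= expR 0 by rewrite ler_expR; lra.
rewrite -(ratio_expR n0 k0) expR0 ler_pdivrMr ?ltr0n// mul1r ler_nat.
exact: ltnW.
Qed.

Lemma sample_expR : n%:R = expR l :> R.
Proof. by rewrite (natr_expR sample_size_gt0). Qed.

Lemma inv_sample_expR : n%:R^-1 = expR (- l) :> R.
Proof. by rewrite sample_expR expRN. Qed.

Lemma half_pow_uncontaminated : n%:R * 2 ^- (n - k) <= expR (- l).
Proof.
have n0 := sample_size_gt0; have /andP[k0 kn] := sparsity_bounds.
have l1 := l144; have a6' := a6.
apply: half_pow_le; [lra|by rewrite -sample_expR|].
rewrite natrB ?(ltnW kn)//.
have := khigh; rewrite (powR_expR n0) -/l.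
have : expR (l / 2) <= expR ((1 - 1 / (4 * a)) * l).
  rewrite ler_expR.
  have ia : 1 / (4 * a) <= 1 / 2 by rewrite ler_pdivrMr; lra.
  have : 1 / (4 * a) * l <= 1 / 2 * l by rewrite ler_wpM2r//; lra.
  lra.
lra.
Qed.

(** The small-degree case fixes 32K + 1: 28K and 4K from [median_moments], 1 from the remainders.
    The large-degree case yields 5K + 1. *)
Theorem est_bounds (est := fun w => theta_hat `|qsel R n k|%N (sample theta mu xi w)) :
  (P [set w | est w \notin `[theta, (theta + 5 * K * rate R n k)%R]%R] <=
    ((64 * expR (16 / 3 * a) + 2) * ((Num.sqrt n%:R / k%:R) `^ (4 / 3)) * ell ^+ 3)%:E)%E /\
  ('E_P[fun w => `|est w - theta|%R] <= ((32 * K + 1) * rate R n k)%:E)%E.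
Proof.
have n0 := sample_size_gt0; have kn := sparsity_bounds; have /andP[k0 kltn] := kn.
have [ell2 elll] := log_sparsity_bounds.
have [a6' l1 l24'] := And3 a6 l144 l24.
have a0 : 0 < a by lra.
have [l18 l3 lge1 lgt0] : [/\ 18 <= l, 3 <= l, 1 <= l & 0 < l] by split; lra.
have nR0 : 0 < n%:R :> R by rewrite ltr0n.
have ell43 : 4 / 3 * ell <= l by lra.
have l3l : - (3 * l) <= - l by lra.
have [q [qE q1 qe aq [qQ Ql Qg qalt]]] := qsel_spec (erefl l) (erefl ell) ell2 l24.
have ell1 : 1 <= ell by lra.
have ell0 : 0 < ell by lra.
have qR : 2 <= q%:R :> R by rewrite (ler_nat _ 2).
have qell4 : ell <= a * q%:R + 4 * a.
  have : ell / a <= q%:R + 4.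
    case: qalt => [h|qq]; first lra.
    have : ell / a <= l / (2 * a).
      by rewrite ler_pdivrMr// (_ : l / (2 * a) * a = l / 2)//; field; lra.
    lra.
  by rewrite ler_pdivrMr//; lra.
have qell : ell <= 3 * a * q%:R.
  have : a * 2 <= a * q%:R by rewrite ler_wpM2l// ltW.
  lra.
have Q1 : 1 <= (qmax R n)%:~R :> R by lra.
have Ql1 : (qmax R n)%:~R <= l :> R.
  apply: le_trans Ql _; rewrite ler_pdivrMr; last lra.
  by rewrite ler_peMr; lra.
have aq0 : 0 <= a * q%:R by rewrite mulr_ge0// ltW.
have vrb1 : expR (- (4 / 3) * (a * q%:R)) <= 1 by rewrite -[leRHS]expR0 ler_expR; lra.
have est_qE : est = fun w => theta_hat q (sample theta mu xi w) by rewrite /est qE.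
have Bkap := slack_le_ratio (erefl l) (erefl ell) kn aq.
have /andP[b1 b2] := two_sqrt_ln_bounds l144.
have bb : 0 <= 2 * Num.sqrt l <= 2 * l by apply/andP; split => //; lra.
have Lq := ln_ratio_bound n0 k0 kltn khigh l24 q1 Qg qalt.
have lamb := inv_lambdaq_bounds q1 l144 elll aq.
have rg := rate_ge_ratio (erefl ell) kn l144 ell1 elll.
have shift := shift_le_rate (erefl ell) q1 ell1 qell.
have rr := ratio_rate (erefl ell) kn q1 ell1 qell.
have K0 := @rate_const_gt0 R.
have kapE := sparsity_ratioE (erefl l) (erefl ell) kn.
have r0 := rate_gt0 (erefl l) (erefl ell) kn l144 ell1 elll.
have lamb2 : 0 <= (2 * lambdaq R q)^-1 <= l.
  have /andP[m0 m1] := lamb; rewrite invfM; apply/andP; split; first by rewrite mulr_ge0.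
  by apply: le_trans m1; rewrite ler_piMl//; lra.
have lam0 : 0 < lambdaq R q by apply: lambdaq_gt0; exact: ltnW.
have hp := half_pow_uncontaminated.
have powE : (Num.sqrt n%:R / k%:R) `^ (4 / 3) = expR (- (4 / 3 * ell)).
  have s0 : 0 < Num.sqrt n%:R :> R by rewrite sqrtr_gt0 ltr0n.
  have kR : 0 < k%:R :> R by rewrite ltr0n.
  have -> : Num.sqrt n%:R / k%:R = (k%:R / Num.sqrt n%:R)^-1 :> R by rewrite invf_div.
  rewrite /powR invr_eq0 gt_eqF ?divr_gt0//.
  by rewrite lnV ?posrE ?divr_gt0// mulrN.
rewrite est_qE powE.
have [small|free] := boolP (q%:R <= 3 / (10 * a) * ln n%:R).
  have aqs := mul_const_le a0 small.
  have ells : ell <= 3 / 10 * l + 2 * a.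
    exact: (log_sparsity_le a6' l24' Qg aqs qalt).
  have [k8 bigk] := sparse_regime lge1 sample_expR (sparsity_expR n0 k0) ells C0 C8 bigC.
  have [v01 vl vq] := vbar_bounds Q1 Ql1.
  have /andP[v0 v1] := v01.
  have vC := inv_sqr_half_le lgt0 CE vl.
  have dl := delta_le (esym sample_expR) C0 v0 vC v1 l3 k8 bigk.
  set delta := 2 ^+ n * _ in dl.
  have dlX : delta <= expR (- l) by apply: le_trans dl _; rewrite ler_expR.
  have kap2 : k%:R / n%:R <= 1 / 2 :> R.
    exact: (ratio_le_half (ler0n R k) nR0 k8).
  have vq1 := vq q (ltnW q1) qQ.
  split.
    apply: le_trans (prob_med theta iid mu0 muk kn q1 qe Bkap b1 Lq small v01 shift) _.
    rewrite lee_fin inv_sample_expR.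
    by apply: (prob_const_le ell1 ell43 qell4 erefl dlX).
  have [_ _] := mean_med theta iid mu0 muk kn q1 qe Bkap b1 Lq small v01 vq1 kap2.
  rewrite unlock => /le_trans; apply; rewrite lee_fin -/delta.
  set sig2 := expR (2 / 3 * (a * q%:R)) / n%:R.
  set kap : R := k%:R / n%:R in kapE rr rg kap2 Bkap *.
  have sigE : sig2 = expR (2 / 3 * (a * q%:R) - l) by rewrite /sig2 sample_expR expRB.
  have q2l : 0 < q%:R ^+ 2 * lambdaq R q by rewrite mulr_gt0// exprn_gt0// ltr0n ltnW.
  have [sigX m1 m2] := median_moments q2l kapE (slackE q (erefl l) kn) sigE aq0 aq rr.
  have d0 : 0 <= delta.
    by rewrite mulr_ge0 ?exprn_ge0// (quarter_sub_sqr_ge0 v0 v1).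
  have db : 0 <= delta <= expR (- (3 * l)) by rewrite d0.
  have vrb : 0 <= expR (- (4 / 3) * (a * q%:R)) <= 1 by rewrite expR_ge0.
  have rest := rest_med_le l18 (ltW ell0) bb sigX db hp vrb lamb big.
  have kl : expR (ell - l / 2) / (4 * l ^+ 2) <= rate R n k by rewrite -kapE.
  rewrite inv_sample_expR -/l -sample_expR in rest *.
  lra.
have aql : 3 / 10 * l <= a * q%:R.
  move: free; rewrite -ltNge -/l => free.
  exact: (le_mul_const a0 (ltW free)).
split.
  apply: le_trans (prob_free theta iid mu0 muk kn q1 qe Bkap b1 Lq free shift) _.
  rewrite lee_fin inv_sample_expR -[leLHS]addr0.
  exact: (prob_const_le ell1 ell43 qell4 erefl (expR_ge0 _)).
have [_ _] := mean_free theta iid mu0 muk kn q1 qe Bkap b1 Lq free.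
rewrite unlock => /le_trans; apply; rewrite lee_fin.
have vrb : 0 <= expR (- (4 / 3) * (a * q%:R)) <= expR (- (2 / 5 * l)).
  by rewrite expR_ge0 ler_expR; lra.
have ee : n%:R^-1 <= expR (- l) :> R by rewrite inv_sample_expR.
have rest := rest_free_le l18 bb vrb ee hp lamb2 big.
(* k/n = e^{ell - l/2}, and ell >= aq >= 3l/10 in this case. *)
have kl : expR (- (l / 5)) / (4 * l ^+ 2) <= rate R n k.
  apply: le_trans rg; rewrite kapE; apply: ler_wpM2r.
    by rewrite invr_ge0 mulr_ge0// sqr_ge0.
  by rewrite ler_expR; lra.
rewrite -/l in shift *.
have Kr : 0 <= K * rate R n k by rewrite mulr_ge0 ?(ltW K0) ?(ltW r0).
lra.
Qed.
End conclusion.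

(** 36 is from the lower bound 1/(36 l^2) on [vbar], and 24 from the deficit v/24 of the tail
    probability. *)
Lemma ex_const_864 {R : realType} : exists C : R, [/\ C = 36 * 24, 0 < C & 8 <= C ^+ 2].
Proof.
exists (36 * 24); split; [by []|exact: mulr_gt0|].
have h : 24 <= 36 * 24 :> R by rewrite ler_peMl// ler1n.
apply: (@le_trans _ _ (1 * 24)); first by rewrite mul1r ler_nat.
rewrite expr2; apply: ler_pM => //.
by apply: le_trans h; rewrite ler1n.
Qed.

Theorem theorem2p4 (R : realType) :
  exists (c1 c2 c3 : R) (n0 : nat),
    [/\ 0 < c1, 0 < c2, 0 < c3 & (0 < n0)%N] /\
    forall (n k : nat) (mu : 'I_n -> R) (theta : R)
      (d : measure_display) (T : measurableType d) (P : probability T R)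
      (xi : 'I_n -> {RV P >-> R}),
      (n0 <= n)%N ->
      expR (2 * aconst R) * Num.sqrt n%:R <= k%:R ->
      k%:R < n%:R - 64 * (n%:R `^ (1 - 1 / (4 * aconst R))) ->
      sparse_nonneg k mu ->
      iid_standard_normal xi ->
      let est := fun w : T => theta_hat `|qsel R n k|%N (sample theta mu xi w) in
      (P [set w | est w \notin `[theta, theta + c1 * rate R n k]%R] <=
        (c3 * ((Num.sqrt n%:R / k%:R) `^ (4 / 3))
            * ln (k%:R / Num.sqrt n%:R) ^+ 3)%:E)%E /\
      ('E_P[fun w => `|est w - theta|%R] <= (c2 * rate R n k)%:E)%E.
Proof.
have [C [CE C0 C8]] := @ex_const_864 R.
have s0 : 0 < 1 / 5 :> R by rewrite divr_gt0.
(* The size of n enters only through lower bounds on log n: one for the remainder terms, one for the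
   sparse regime, and the explicit ones 144 and 24a. *)
have [l1 H1] := poly_le_expR 560 3 s0.
have [l2 H2] := poly_le_expR (C ^+ 2 * (4 + 2 * expR (2 * aconst R))) 5 s0.
pose l0 := Num.max (Num.max 144 (24 * aconst R)) (Num.max l1 l2).
have [n0 [n00 Hn0]] := large_n l0.
have K0 := @rate_const_gt0 R.
exists (5 * rate_const), (32 * rate_const + 1), (64 * expR (16 / 3 * aconst R) + 2), n0.
split.
  have e0 := expR_gt0 (16 / 3 * aconst R).
  split; [exact: mulr_gt0| | |exact: n00].
    by apply: addr_gt0 => //; exact: mulr_gt0.
  by apply: addr_gt0 => //; exact: mulr_gt0.
move=> n k mu theta d T P xi /Hn0; rewrite /l0 !ge_max.
set l := ln n%:R => /andP[/andP[l144 l24] /andP[ll1 ll2]] klow khigh [mu0 muk] iid.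
have lE : 1 / 5 * l = l / 5 by rewrite mulrC mulrA mulr1.
have big := H1 _ ll1; have bigC := H2 _ ll2; rewrite lE in big bigC.
exact: (est_bounds theta l144 l24 big CE C0 C8 bigC klow khigh mu0 muk iid).
Qed.
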